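(* Let $(\mathbf X_{n+1},\mathbf Y_{n+1},\mathbf V_{n+1})$ have distribution $\mathbb P_n$. Assume $$M<m\,\frac{\int_{\mathcal B((\tilde x,R),R)}\lambda_* e^{-\lambda_* r}\,dx\,dr}{\int_{D\setminus\mathcal B((\tilde x,R),R)}\lambda_* e^{-\lambda_* r}\,dx\,dr},$$ and let $(y_A,\lambda_A)$ be the unique solution described below. (i) For every $\varepsilon>0$, $\lim_{n\to\infty}\mathbb P_n(|Y_{n+1}-y_A|>\varepsilon)=0$. (ii) The marginal distribution of $X_{n+1}$ under $\mathbb P_n$ is uniform on $D_b'$. Moreover, conditionally on $\{X_{n+1}=x\}$, the empirical measure $\mathbb Q_n$ converges weakly, in probability, to $\nu_{x,y_A,\lambda_A}$ as $n\to\infty$.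
   Context: Fix an integer $d\ge 2$, a bounded domain $D_b\subset\mathbb R^{d-1}$ with smooth boundary, and $R>0$. Assume that $D_b$ satisfies the inner ball condition with radius $R$: for every $x\in\partial D_b$ there is a unique open $(d-1)$-dimensional ball of radius $R$ contained in $D_b$ whose boundary is tangent to $\partial D_b$ at $x$, and $x$ is the only point of intersection of that ball's boundary with $\partial D_b$. Let $D=D_b\times[0,\infty)\subset\mathbb R^d$, and assume a closed ball of radius $R$ fits in the interior of $D$. Points of $\mathbb R^d$ are written $(x,y)$ with $x\in\mathbb R^{d-1}$ and $y\in\mathbb R$. $\mathcal B(z,r)$ denotes the open ball with center $z$ and radius $r$. Let $D_b'=\{x\in D_b:\mathcal B((x,y),R)\subset D\text{ for all }y>R\}$. In integrals $\int_{D\setminus\mathcal B((\tilde x,y),R)}(\cdot)\,dx\,dr$, $\tilde x$ is an arbitrary point of $D_b'$ (the value does not depend on the choice), $dx$ is Lebesgue measure on $\mathbb R^{d-1}$, and $dr$ is Lebesgue measure in the vertical coordinate. Fix $m>0$, $M>0$, $g>0$ and $E>MgR$. Set $m_i=m/n$ for $1\le i\le n$ and $m_{n+1}=M$. Let $\mathbf D_{n,E}$ be the set of $(\mathbf x_{n+1},\mathbf y_{n+1},\mathbf v_{n+1})$ satisfying all of the following: - $x_i\in D_b$ and $y_i\ge0$ for $i\le n$; - $x_{n+1}\in D_b'$ and $y_{n+1}\ge R$; - $v_i\in\mathbb R^d$ for all $i$; - $(x_k,y_k)\in D\setminus\mathcal B((x_{n+1},y_{n+1}),R)$ for $k\le n$;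 - $\sum_{i=1}^{n+1}\big(m_igy_i+\tfrac12m_i\|v_i\|^2\big)=E$. The probability measure $\mathbb P_n$ on $\mathbf D_{n,E}$ is defined as follows. The positions have Lebesgue density proportional to $\big(E-\sum_{i=1}^{n+1}m_iy_ig\big)^{((n+1)d-2)/2}$ on the admissible positions with $\sum_i m_iy_ig\le E$. Given the positions, $(\sqrt{m_1}v_1,\dots,\sqrt{m_{n+1}}v_{n+1})$ is uniform on the centered sphere in $\mathbb R^{(n+1)d}$ of radius $\big(2E-2\sum_i m_iy_ig\big)^{1/2}$. Define $\lambda_*$ as the unique $\lambda>0$ with $$\frac{dmg}{2\lambda}+mg\,\frac{\int_{D\setminus\mathcal B((\tilde x,R),R)}r\lambda e^{-\lambda r}\,dx\,dr}{\int_{D\setminus\mathcal B((\tilde x,R),R)}\lambda e^{-\lambda r}\,dx\,dr}+MgR=E.$$ Under the displayed hypothesis, $(y_A,\lambda_A)$ is the unique solution with $y\ge R$, $\lambda>0$ of the two equations $$M=m\,\frac{\int_{\mathcal B((\tilde x,y),R)}\lambda e^{-\lambda r}\,dx\,dr}{\int_{D\setminus\mathcal B((\tilde x,y),R)}\lambda e^{-\lambda r}\,dx\,dr},$$ $$\frac{dmg}{2\lambda}+mg\,\frac{\int_{D\setminus\mathcal B((\tilde x,y),R)}r\lambda e^{-\lambda r}\,dx\,dr}{\int_{D\setminus\mathcal B((\tilde x,y),R)}\lambda e^{-\lambda r}\,dx\,dr}+Mgy=E.$$ For $\hat x\in D_b'$, $y'\ge R$ and $\lambda>0$, $\nu_{\hat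 x,y',\lambda}$ is the probability measure on $D$ with density proportional to $\mathbf 1_{D\setminus\mathcal B((\hat x,y'),R)}(x,y)\,\lambda e^{-\lambda y}$ with respect to $dx\,dy$. The empirical measure of the gas is $\mathbb Q_n=\frac1n\sum_{i=1}^n\delta_{(X_i,Y_i)}$. *)

(* Defs.v *)
From mathcomp Require Import all_boot all_order all_algebra.
From mathcomp Require Import all_classical all_reals all_analysis.
Unset Printing Implicit Defensive.
Import Order.TTheory GRing.Theory Num.Theory.
Import numFieldNormedType.Exports.
Local Open Scope classical_set_scope.
Local Open Scope ring_scope.

(* N-dimensional Lebesgue integral of a nonnegative function g : R^N -> \bar R,
   realised as the iterated (Tonelli) integral of the one-dimensional Lebesgue
   measure.  A point of R^N is coded as a function nat -> R whose coordinates
   0 .. N-1 are integrated (coordinates >= N are set to 0). *)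
Fixpoint leb_int {R : realType} (N : nat) (g : (nat -> R) -> \bar R) : \bar R :=
  match N with
  | 0 => g (fun _ => 0)
  | N'.+1 => (\int[@lebesgue_measure R]_t
                 leb_int N' (fun u => g (fun i => if i == N' then t else u i)))%E
  end.

Definition leb_intR {R : realType} (N : nat) (h : (nat -> R) -> R) : R :=
  fine (leb_int N (fun q => (Num.max (h q) 0)%:E))
  - fine (leb_int N (fun q => (Num.max (- h q) 0)%:E)).

Definition esq {R : realType} {k : nat} (v : 'rV[R]_k) : R := \sum_(j < k) v 0 j ^+ 2.
Definition enorm {R : realType} {k : nat} (v : 'rV[R]_k) : R := Num.sqrt (esq v).

Definition pt (R : realType) (d : nat) := ('rV[R]_(d.-1) * R)%type.

Definition edist {R : realType} {d : nat} (p q : pt R d) : R :=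
  Num.sqrt (esq (p.1 - q.1) + (p.2 - q.2) ^+ 2).

Definition eball {R : realType} {d : nat} (c : pt R d) (r : R) : set (pt R d) :=
  [set p | edist p c < r].
Definition ecball {R : realType} {d : nat} (c : pt R d) (r : R) : set (pt R d) :=
  [set p | edist p c <= r].

Definition rball {R : realType} {k : nat} (c : 'rV[R]_k) (r : R) : set 'rV[R]_k :=
  [set x | enorm (x - c) < r].

Definition bdry {T : topologicalType} (A : set T) : set T := closure A `\` interior A.

Fixpoint Ck {R : realType} {k : nat} (n : nat) (f : 'rV[R]_k -> R) : Prop :=
  match n with
  | 0 => continuous f
  | n'.+1 => (forall x v, derivable f x v) /\ forall v, Ck n' (fun x => derive f x v)
  end.
Definition smooth {R : realType} {k : nat} (f : 'rV[R]_k -> R) : Prop := forall n, Ck n f.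

Definition smooth_boundary {R : realType} {k : nat} (A : set 'rV[R]_k) : Prop :=
  forall p, bdry A p ->
    exists (U : set 'rV[R]_k) (rho : 'rV[R]_k -> R),
      [/\ open U, U p, smooth rho,
          A `&` U = [set x | U x /\ rho x < 0] &
          forall x, U x -> bdry A x -> exists v, derive rho x v != 0].

Definition bounded_domain {R : realType} {k : nat} (A : set 'rV[R]_k) : Prop :=
  [/\ A !=set0, open A, connected A & bounded_set A].

Definition inner_ball_condition {R : realType} {k : nat} (A : set 'rV[R]_k) (Rr : R) :=
  forall x, bdry A x ->
    exists c : 'rV[R]_k,
      [/\ rball c Rr `<=` A, enorm (x - c) = Rr,
          (forall z, enorm (z - c) = Rr -> bdry A z -> z = x) &
          (forall c', rball c' Rr `<=` A -> enorm (x - c') = Rr -> c' = c)].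

Definition cyl {R : realType} {d : nat} (Db : set 'rV[R]_(d.-1)) : set (pt R d) :=
  [set p | Db p.1 /\ 0 <= p.2].

Definition Dbp {R : realType} {d : nat} (Db : set 'rV[R]_(d.-1)) (Rr : R)
  : set 'rV[R]_(d.-1) :=
  [set x | Db x /\ forall y, Rr < y -> eball ((x, y) : pt R d) Rr `<=` cyl Db].

Definition qpt {R : realType} (d : nat) (q : nat -> R) : pt R d :=
  (\row_(j < d.-1) q j, q d.-1).

Definition nu_dens {R : realType} {d : nat} (Db : set 'rV[R]_(d.-1)) (Rr : R)
  (xh : 'rV[R]_(d.-1)) (y' lam : R) (z : pt R d) : R :=
  \1_(cyl Db `\` eball ((xh, y') : pt R d) Rr) z * (lam * expR (- (lam * z.2))).

Definition I0 {R : realType} (d : nat) (Db : set 'rV[R]_(d.-1)) (Rr : R)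
  (xt : 'rV[R]_(d.-1)) (y lam : R) : R :=
  leb_intR d (fun q => nu_dens Db Rr xt y lam (qpt d q)).

Definition I1 {R : realType} (d : nat) (Db : set 'rV[R]_(d.-1)) (Rr : R)
  (xt : 'rV[R]_(d.-1)) (y lam : R) : R :=
  leb_intR d (fun q => (qpt d q).2 * nu_dens Db Rr xt y lam (qpt d q)).

Definition IB {R : realType} (d : nat) (Rr : R)
  (xt : 'rV[R]_(d.-1)) (y lam : R) : R :=
  leb_intR d (fun q => \1_(eball ((xt, y) : pt R d) Rr) (qpt d q)
                       * (lam * expR (- (lam * (qpt d q).2)))).

Definition nu_int {R : realType} (d : nat) (Db : set 'rV[R]_(d.-1)) (Rr : R)
  (xh : 'rV[R]_(d.-1)) (y' lam : R) (f : pt R d -> R) : R :=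
  leb_intR d (fun q => nu_dens Db Rr xh y' lam (qpt d q) * f (qpt d q))
  / I0 d Db Rr xh y' lam.

Definition lebk {R : realType} (k : nat) (A : set 'rV[R]_k) : R :=
  leb_intR k (fun q => \1_A (\row_(j < k) q j)).

(* Configurations of the n+1 particles.
   Positions are coded by p : nat -> R with (n+1)d coordinates:
     light particle i < n : x_i = coords i*d .. i*d+d-2,  y_i = coord i*d+d-1;
     heavy particle (index n+1 in the paper): Y_{n+1} = coord n*d,
                                             X_{n+1} = coords n*d+1 .. n*d+d-1.
   Velocities are coded by u : nat -> R with (n+1)d coordinates:
     particle i (i = n is the heavy one) : v_i = coords i*d .. i*d+d-1. *)
Definition lx {R : realType} (d n : nat) (p : nat -> R) (i : nat) : 'rV[R]_(d.-1) :=
  \row_(j < d.-1) p (i * d + j)%N.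
Definition ly {R : realType} (d n : nat) (p : nat -> R) (i : nat) : R :=
  p (i * d + d.-1)%N.
Definition hy {R : realType} (d n : nat) (p : nat -> R) : R := p (n * d)%N.
Definition hx {R : realType} (d n : nat) (p : nat -> R) : 'rV[R]_(d.-1) :=
  \row_(j < d.-1) p (n * d + 1 + j)%N.

Definition mass {R : realType} (n : nat) (m M : R) (i : nat) : R :=
  if (i < n)%N then m / n%:R else M.

Definition potE {R : realType} (d n : nat) (m M g : R) (p : nat -> R) : R :=
  \sum_(i < n) (m / n%:R) * g * ly d n p i + M * g * hy d n p.

Definition admissible {R : realType} (d n : nat) (Db : set 'rV[R]_(d.-1)) (Rr : R)
  (p : nat -> R) : Prop :=
  [/\ forall i, (i < n)%N ->
        [/\ Db (lx d n p i), 0 <= ly d n p i &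
            (cyl Db `\` eball ((hx d n p, hy d n p) : pt R d) Rr) (lx d n p i, ly d n p i)],
      Dbp Db Rr (hx d n p) & Rr <= hy d n p].

Definition posdens {R : realType} (d n : nat) (Db : set 'rV[R]_(d.-1)) (Rr m M g E : R)
  (p : nat -> R) : R :=
  \1_([set p | admissible d n Db Rr p /\ potE d n m M g p <= E]) p
  * (E - potE d n m M g p) `^ (((n.+1 * d)%:R - 2) / 2).

(* Given the positions p, (sqrt m_i v_i)_i is uniform on the centred sphere of
   radius rho = (2E - 2 potE)^(1/2) in R^((n+1)d).  The uniform law on the sphere
   is realised as the normalised cone measure: z uniform in the unit ball,
   w = rho z / |z|, v_k = w_k / sqrt(m_{particle of k}). *)
Definition unorm {R : realType} (N : nat) (z : nat -> R) : R :=
  Num.sqrt (\sum_(k < N) z k ^+ 2).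

Definition vel_of {R : realType} (d n : nat) (m M g E : R) (p z : nat -> R) : nat -> R :=
  fun k => Num.sqrt (2 * E - 2 * potE d n m M g p) * z k / unorm (n.+1 * d) z
           / Num.sqrt (mass n m M (k %/ d)).

Definition sphere_prob {R : realType} (d n : nat) (m M g E : R) (p : nat -> R)
  (S : (nat -> R) -> (nat -> R) -> Prop) : R :=
  fine (leb_int (n.+1 * d) (fun z =>
     (\1_([set z | 0 < unorm (n.+1 * d) z <= 1 /\ S p (vel_of d n m M g E p z)]) z)%:E))
  / fine (leb_int (n.+1 * d) (fun z =>
     (\1_([set z | unorm (n.+1 * d) z <= 1]) z)%:E)).

Definition Pn {R : realType} (d n : nat) (Db : set 'rV[R]_(d.-1)) (Rr m M g E : R)
  (S : (nat -> R) -> (nat -> R) -> Prop) : R :=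
  fine (leb_int (n.+1 * d) (fun p =>
          (posdens d n Db Rr m M g E p * sphere_prob d n m M g E p S)%:E))
  / fine (leb_int (n.+1 * d) (fun p => (posdens d n Db Rr m M g E p)%:E)).

(* k-th coordinate of a row vector (0 if out of range) *)
Definition rvnth {R : realType} {k : nat} (v : 'rV[R]_k) (j : nat) : R :=
  \sum_(j0 < k | val j0 == j) v 0 j0.

Definition setx {R : realType} (d n : nat) (x0 : 'rV[R]_(d.-1)) (p : nat -> R) : nat -> R :=
  fun i => if (n * d < i < n * d + d)%N then rvnth x0 (i - n * d - 1)%N else p i.

(* Regular conditional law of P_n given X_{n+1} = x0 (density version: the
   joint density with x_{n+1} frozen at x0, normalised over the remaining
   n*d + 1 position coordinates). *)
Definition Pcond {R : realType} (d n : nat) (Db : set 'rV[R]_(d.-1)) (Rr m M g E : R)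
  (x0 : 'rV[R]_(d.-1)) (S : (nat -> R) -> (nat -> R) -> Prop) : R :=
  fine (leb_int (n * d + 1) (fun p =>
          (posdens d n Db Rr m M g E (setx d n x0 p)
           * sphere_prob d n m M g E (setx d n x0 p) S)%:E))
  / fine (leb_int (n * d + 1) (fun p =>
          (posdens d n Db Rr m M g E (setx d n x0 p))%:E)).

Definition emp_int {R : realType} (d n : nat) (p : nat -> R) (f : pt R d -> R) : R :=
  (\sum_(i < n) f (lx d n p i, ly d n p i)) / n%:R.

(* Main.v *)
(* With N ~ nd/2, the position density (E - potential energy)^N is handled through
   a^N <= b^N e^{N (a/b - 1)}, with equality at a = b, where b is the kinetic energy
   at the saddle point.  This linearises the energy, so that for a fixed position
   (x, y) of the heavy ball the light particles become independent with density
   proportional to e^{-l r} outside the ball.  Summing them out leaves e^{n F(y, l)}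
   with the free energy
     F(y, l) = l (E - M g y) / (m g) - (d/2) ln l + ln (I0 y l / l).
   F has a strict minimum in l (Jensen) and a strict maximum in y (1 - e^{-z} <= z)
   at each solution of the two equations, whence uniqueness.  For existence one
   solves the first equation, which says IB = M A / (m + M) with A the volume of
   D_b, for y as a function of l, and applies the intermediate value theorem to the
   energy; the hypothesis on lambda_* excludes solutions with y < R.
   A matching lower bound for the partition function and Chernoff bounds for the
   tilted one-particle laws make both (Y far from y_A) and (empirical mean far from
   its limit) exponentially unlikely.  The marginal of X is uniform because each
   horizontal section of the ball, hence the joint law of all heights, is unchanged
   when the ball is translated horizontally inside D. *)
From HB Require Import structures.
Require Import Defs.
From mathcomp Require Import all_boot all_order all_algebra.
From mathcomp Require Import all_classical all_reals all_analysis.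
From mathcomp Require Import measurable_realfun ring lra.
Set Implicit Arguments.
Unset Strict Implicit.
Unset Printing Implicit Defensive.
Import Order.TTheory GRing.Theory Num.Theory.
Import numFieldNormedType.Exports.
Local Open Scope classical_set_scope.
Local Open Scope ring_scope.

(** * Iterated Lebesgue integrals *)

(** All events concern positions, so the velocities integrate out. The argument is run for the
    unnormalised conditional law at one fixed x, an integral over the height y of the ball of an
    integral over the light particles. For events in the height alone this does not depend on x,
    which is how the joint law is reached. The linearised bound holds for every l; throughout the
    concentration l is frozen at lambda_A, the minimum in l serving uniqueness only, and what
    remains is to compare e^{n F(y, lambda_A)} with its value at y_A. The tangent bound can be
    reversed, up to e^{-n delta} with delta arbitrary, only where the potential energy is near its
    saddle value; Chernoff bounds show that such configurations carry the bulk of the mass. The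
    exponent exceeds nd/2 by (d-2)/2, which costs a factor bounded in n. Light particles can be
    arbitrarily high in the linearised problem, so the functions tilted by may grow linearly in the
    height, part of the decay e^{-l r} paying for the tilt. Deviation events are bounded by
    monotonicity of the integral alone, so their measurability is never at issue. *)

(* [leb_int] is defined for every integrand; it is additive on the functions
   measurable for the coordinate sigma-algebra. *)
Definition coord_cylinders (R : realType) : set (set (nat -> R)) :=
  [set A | exists i B, measurable (B : set R) /\ A = [set q | B (q i)]].
Definition seqT (R : realType) : measurableType _ :=
  g_sigma_algebraType (@coord_cylinders R).

Definition upd (R : realType) (q : nat -> R) (n : nat) (t : R) : nat -> R :=
  fun i => if i == n then t else q i.

Definition merge (R : realType) (a : nat) (u v : nat -> R) : nat -> R :=
  fun i => if (i < a)%N then u i else v (i - a)%N.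

Lemma measurable_coord (R : realType) i :
  measurable_fun setT (fun q : seqT R => q i).
Proof.
move=> _ B mB; rewrite setTI; apply: sub_sigma_algebra.
by exists i, B.
Qed.

Lemma measurable_seqP (R : realType) d (X : measurableType d) (F : X -> seqT R) :
  (forall i, measurable_fun setT (fun x => F x i)) -> measurable_fun setT F.
Proof.
move=> mF.
apply: (@measurability _ _ X (seqT R) setT F (@coord_cylinders R)) => //.
move=> _ [_ [i [B [mB ->]]] <-].
exact: mF.
Qed.

Lemma measurable_upd (R : realType) n :
  measurable_fun setT (fun p : measurableTypeR R * seqT R => upd p.2 n p.1 : seqT R).
Proof.
apply: measurable_seqP => i; rewrite /upd.
case: (i == n); first exact: measurable_fst.
exact: (measurableT_comp (measurable_coord i) measurable_snd).
Qed.


Section leb_int.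
Context {R : realType}.
Local Notation mu := (@lebesgue_measure R).
Implicit Types (N : nat) (g : seqT R -> \bar R).

Lemma leb_intS N g :
  (leb_int N.+1 g = \int[mu]_t leb_int N (fun u => g (upd u N t)))%E.
Proof. by []. Qed.

Lemma leb_int_ge0 N g : (forall q, (0 <= g q)%E) -> (0 <= leb_int N g)%E.
Proof.
elim: N g => [|N IH] g g0; first exact: g0.
by apply: integral_ge0 => t _; apply: IH => u; exact: g0.
Qed.

(** The parameter space is arbitrary so that the induction on [N] can move the outermost coordinate
    into it and invoke Tonelli there. *)
Lemma measurable_leb_int_param N d (X : measurableType d) (G : X * seqT R -> \bar R) :
  measurable_fun setT G -> (forall z, (0 <= G z)%E) ->
  measurable_fun setT (fun x => leb_int N (fun u => G (x, u))).
Proof.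
elim: N d X G => [|N IH] d X G mG G0.
  apply: (measurableT_comp mG).
  apply/measurable_fun_pair => //=.
rewrite /=.
pose G' (z : (X * measurableTypeR R) * seqT R) := G (z.1.1, upd z.2 N z.1.2).
have mG' : measurable_fun setT G'.
  apply: (measurableT_comp mG); apply: measurable_fun_pair => /=.
    by apply: (measurableT_comp measurable_fst); exact: measurable_fst.
  pose h (z : (X * measurableTypeR R) * seqT R) : measurableTypeR R * seqT R :=
    (z.1.2, z.2).
  have mh : measurable_fun setT h.
    apply: measurable_fun_pair => //=.
    by apply: (measurableT_comp measurable_snd); exact: measurable_fst.
  exact: (measurableT_comp (measurable_upd N) mh).
have := IH _ _ G' mG' (fun z => G0 _).
move=> /(@measurable_fun_fubini_tonelli_F _ _ X (measurableTypeR R) R mu).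
apply=> z; apply: leb_int_ge0 => u; exact: G0.
Qed.

Lemma measurable_leb_int_upd N g (mg : measurable_fun setT g)
  (g0 : forall q, (0 <= g q)%E) :
  measurable_fun (setT : set (measurableTypeR R))
    (fun t => leb_int N (fun u => g (upd u N t))).
Proof.
apply: (@measurable_leb_int_param N _ (measurableTypeR R)
  (fun z => g (upd z.2 N z.1))) => //.
exact: (measurableT_comp mg (measurable_upd (R:=R) N)).
Qed.

Lemma measurable_comp_upd N g t : measurable_fun setT g ->
  measurable_fun setT (fun u : seqT R => g (upd u N t)).
Proof.
move=> mg; apply: (measurableT_comp mg); apply: measurable_seqP => i.
by rewrite /upd; case: (i == N) => //; exact: measurable_coord.
Qed.

(* The integral of a nonnegative function is a supremum over simple functions,
   so monotonicity needs no measurability. *)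
Lemma ge0_le_integral_nomeas d (T : measurableType d)
    (nu : {measure set T -> \bar R}) (f1 f2 : T -> \bar R) :
  (forall x, (0 <= f1 x)%E) -> (forall x, (f1 x <= f2 x)%E) ->
  (\int[nu]_x f1 x <= \int[nu]_x f2 x)%E.
Proof.
move=> f10 f12; have f20 x : (0 <= f2 x)%E by exact: le_trans (f12 x).
rewrite !ge0_integralTE //; apply: le_ereal_sup => _ [h hf1 <-].
by exists h => // x; exact: le_trans (f12 x).
Qed.

Lemma le_leb_int N g1 g2 : (forall q, (0 <= g1 q)%E) -> (forall q, (g1 q <= g2 q)%E) ->
  (leb_int N g1 <= leb_int N g2)%E.
Proof.
elim: N g1 g2 => [|N IH] g1 g2 g0 g12; first exact: g12.
by apply: ge0_le_integral_nomeas => t; [exact: leb_int_ge0|exact: IH].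
Qed.

Lemma leb_intD N g1 g2 : measurable_fun setT g1 -> measurable_fun setT g2 ->
  (forall q, (0 <= g1 q)%E) -> (forall q, (0 <= g2 q)%E) ->
  (leb_int N (fun q => g1 q + g2 q) = leb_int N g1 + leb_int N g2)%E.
Proof.
elim: N g1 g2 => [//|N IH] g1 g2 m1 m2 g10 g20.
rewrite !leb_intS -ge0_integralD //.
- by apply: eq_integral => t _; apply: IH => //; exact: measurable_comp_upd.
- by move=> t _; apply: leb_int_ge0.
- exact: measurable_leb_int_upd.
- by move=> t _; apply: leb_int_ge0.
- exact: measurable_leb_int_upd.
Qed.

Lemma leb_intZl N g (c : \bar R) : measurable_fun setT g ->
  (forall q, (0 <= g q)%E) -> (0 <= c)%E ->
  (leb_int N (fun q => c * g q) = c * leb_int N g)%E.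
Proof.
elim: N g => [//|N IH] g mg g0 c0.
rewrite !leb_intS -ge0_integralZl //.
- by apply: eq_integral => t _; apply: IH => //; exact: measurable_comp_upd.
- exact: measurable_leb_int_upd.
- by move=> t _; apply: leb_int_ge0.
Qed.

(** Unfolding down to [N = 0] evaluates the integrand only at sequences that vanish from index [N]
    on. *)
Lemma leb_int_supp N g1 g2 :
  (forall q, (forall i, (N <= i)%N -> q i = 0) -> g1 q = g2 q) ->
  leb_int N g1 = leb_int N g2.
Proof.
elim: N g1 g2 => [|N IH] g1 g2 g12; first exact: g12.
rewrite !leb_intS; apply: eq_integral => t _; apply: IH => q q0.
apply: g12 => i Ni; rewrite /upd gtn_eqF //; exact: q0 (ltnW Ni).
Qed.

Lemma eq_leb_int N g1 g2 : (forall q, g1 q = g2 q) -> leb_int N g1 = leb_int N g2.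
Proof. by move=> g12; apply: leb_int_supp. Qed.

Lemma leb_int0 N : leb_int N (fun _ : seqT R => 0%:E) = 0%:E :> \bar R.
Proof.
transitivity (leb_int N (fun _ : seqT R => 0%:E * 0%:E))%E.
  by apply: eq_leb_int => q; rewrite mule0.
by rewrite leb_intZl // mul0e.
Qed.

(** The coordinate of highest index is integrated outermost, so splitting off the last [b]
    coordinates is a regrouping, without any exchange of integrals. *)
Lemma leb_int_cat a b g :
  leb_int (a + b) g = leb_int b (fun v => leb_int a (fun u => g (merge a u v))).
Proof.
elim: b g => [|b IH] g.
  rewrite addn0; apply: leb_int_supp => q q0; congr g; apply/funext => i.
  by rewrite /merge; case: ltnP => // /q0.
rewrite addnS leb_intS [RHS]leb_intS; apply: eq_integral => t _; rewrite IH.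
apply: eq_leb_int => v; apply: eq_leb_int => u; congr g; apply/funext => i.
rewrite /upd /merge; case: ltnP => [ia|ai].
  by rewrite ltn_eqF // ltn_addr.
by rewrite -(eqn_add2l a (i - a)) subnKC.
Qed.

Lemma leb_int_monotone_convergence N (gk : nat -> seqT R -> \bar R) g :
  (forall k, measurable_fun setT (gk k)) -> (forall k q, (0 <= gk k q)%E) ->
  (forall q, {homo (fun k => gk k q) : k l / (k <= l)%N >-> (k <= l)%E}) ->
  (forall q, gk k q @[k --> \oo] --> g q) ->
  leb_int N (gk k) @[k --> \oo] --> leb_int N g.
Proof.
elim: N gk g => [|N IH] gk g mg g0 ndg cg; first exact: cg.
have -> : leb_int N.+1 g =
  (\int[mu]_t limn (fun k => leb_int N (fun u => gk k (upd u N t))))%E.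
  rewrite leb_intS; apply: eq_integral => t _; apply/esym/cvg_lim => //.
  apply: (IH (fun k u => gk k (upd u N t)) (fun u => g (upd u N t))) => //.
  - by move=> k; exact: measurable_comp_upd.
apply: cvg_monotone_convergence => //.
- by move=> k; apply: measurable_leb_int_upd.
- by move=> k t _; exact: leb_int_ge0.
- by move=> t _ k l kl; apply: le_leb_int => // q; exact: ndg.
Qed.

End leb_int.

(** * Translation invariance of Lebesgue measure on the line *)

Section lebesgue_shift.
Context {R : realType}.
Local Notation mu := (@lebesgue_measure R).

Lemma lebesgue_measure_shift (c : R) (A : set R) : measurable A ->
  pushforward mu ((fun t => t + c) : _ -> measurableTypeR R) A = mu A.
Proof.
move=> mA; apply/esym/lebesgue_measure_unique => //=.
  exact: measurable_funD.
move=> _ _ [[a b] _ <-] /=; rewrite /pushforward.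
have -> : [set x | a < x <= b]%classic = `]a, b]%classic.
  by apply/seteqP; split => t /=; rewrite in_itv.
have -> : (fun t => t + c) @^-1` `]a, b]%classic = `]a - c, b - c]%classic.
  by apply/seteqP; split => t /=; rewrite !in_itv /= ltrBlDr lerBrDr.
rewrite !lebesgue_measure_itv /= !lte_fin ltrD2r.
case: ifP => // _; rewrite -!EFinD; congr EFin; ring.
Qed.

Lemma lebesgue_integral_shift (g : measurableTypeR R -> \bar R) (c : R) :
  measurable_fun setT g -> (forall t, (0 <= g t)%E) ->
  (\int[mu]_t g (t + c)%R = \int[mu]_t g t)%E.
Proof.
move=> mg g0.
have mc : measurable_fun setT ((fun t => t + c) : measurableTypeR R -> measurableTypeR R).
  exact: measurable_funD.
rewrite -[LHS](@ge0_integral_pushforward _ _ _ _ _ _ mc mu setT g) //.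
apply: eq_measure_integral => //= A mA _; exact: lebesgue_measure_shift.
Qed.

End lebesgue_shift.

(** * Product integrands and independent blocks *)

Section leb_int_products.
Context {R : realType}.
Local Notation mu := (@lebesgue_measure R).

Lemma leb_int_shift N (c : nat -> R) (g : seqT R -> \bar R) :
  measurable_fun setT g -> (forall q, (0 <= g q)%E) ->
  leb_int N (fun q => g (fun i => if (i < N)%N then q i + c i else q i)) = leb_int N g.
Proof.
elim: N g => [|N IH] g mg g0; first by apply: eq_leb_int => q; congr g.
rewrite !leb_intS -[RHS](@lebesgue_integral_shift _ (fun t => leb_int N (fun u => g (upd u N t))) (c N)); last 2 first.
- by apply: (@measurable_leb_int_upd R N g mg g0).
- by move=> t; apply: leb_int_ge0.
apply: eq_integral => t _.
rewrite -[RHS]IH //; last exact: measurable_comp_upd.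
apply: leb_int_supp => q q0; congr g; apply/funext => i.
rewrite /upd ltnS leq_eqVlt; case: eqVneq => [->|iN] //=.
Qed.

Lemma leb_int_prod N (phi : nat -> measurableTypeR R -> R) (J : nat -> R) :
  (forall i, measurable_fun setT (phi i)) -> (forall i t, 0 <= phi i t) ->
  (forall i, (\int[mu]_t (phi i t)%:E)%E = (J i)%:E) ->
  leb_int N (fun q => (\prod_(i < N) phi i (q i))%:E) = (\prod_(i < N) J i)%:E.
Proof.
move=> mphi phi0 Jphi.
have mprod n : measurable_fun setT (fun q : seqT R => (\prod_(i < n) phi i (q i))%:E).
  apply/measurable_EFinP; apply: measurable_prod => i _.
  exact: (measurableT_comp (mphi i) (measurable_coord _)).
elim: N => [|N IH]; first by rewrite /= !big_ord0.
rewrite leb_intS big_ord_recr /=.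
transitivity (\int[mu]_t ((\prod_(i < N) J i)%:E * (phi N t)%:E))%E.
  apply: eq_integral => t _; rewrite -IH muleC -leb_intZl //; last 2 first.
  - by move=> q; rewrite lee_fin prodr_ge0.
  - by rewrite lee_fin.
  apply: eq_leb_int => q; rewrite big_ord_recr /= /upd eqxx -EFinM mulrC.
  by congr (_ * _)%:E; apply: eq_bigr => i _; rewrite ltn_eqF.
rewrite ge0_integralZl //.
- by rewrite Jphi -EFinM.
- exact/measurable_EFinP.
- by move=> t _; rewrite lee_fin.
- rewrite lee_fin prodr_ge0 // => i _.
  by rewrite -lee_fin -Jphi integral_ge0 // => t _; rewrite lee_fin.
Qed.

(** The padding by 0 matches the sequences at which [leb_int d] evaluates its integrand, so that
    block 0 of such a sequence is the sequence itself. *)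
Definition block d i (q : nat -> R) : nat -> R :=
  fun j => if (j < d)%N then q (i * d + j)%N else 0.

Lemma measurable_block d i : measurable_fun setT (block d i : seqT R -> seqT R).
Proof.
apply: measurable_seqP => j; rewrite /block; case: (j < d)%N => //.
exact: measurable_coord.
Qed.

Lemma block_merge_last d n (u v : nat -> R) :
  block d n (merge (n * d) u v) = block d 0 v.
Proof.
apply/funext => j; rewrite /block /merge; case: ifP => // jd.
by rewrite ltnNge leq_addr /= addKn.
Qed.

Lemma block_index_lt d n i j : (i < n)%N -> (j < d)%N -> (i * d + j < n * d)%N.
Proof.
move=> iN jd; apply: (@leq_trans (i.+1 * d)); last by rewrite leq_mul2r iN orbT.
by rewrite mulSn addnC ltn_add2r.
Qed.

Lemma block_merge_lt d n i (u v : nat -> R) : (i < n)%N ->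
  block d i (merge (n * d) u v) = block d i u.
Proof.
move=> ltin; apply/funext => j; rewrite /block /merge; case: ifP => // jd.
by rewrite block_index_lt.
Qed.

Lemma block0_supp d (q : nat -> R) : (forall i, (d <= i)%N -> q i = 0) ->
  block d 0 q = q.
Proof.
by move=> q0; apply/funext => j; rewrite /block; case: ltnP => // /q0.
Qed.

(** This is the independence of the light particles once the energy has been linearised; each
    induction step peels off the last block. *)
Lemma leb_int_blocks n d (G : seqT R -> R) (J : R) :
  measurable_fun setT G -> (forall q, 0 <= G q) ->
  leb_int d (fun q => (G q)%:E) = J%:E ->
  leb_int (n * d) (fun q => (\prod_(i < n) G (block d i q))%:E) = (J ^+ n)%:E.
Proof.
move=> mG G0 JG.
have mprod k : measurable_fun setT (fun q : seqT R => (\prod_(i < k) G (block d i q))%:E).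
  apply/measurable_EFinP; apply: measurable_prod => i _.
  exact: (measurableT_comp mG (measurable_block _ _)).
elim: n => [|n IH]; first by rewrite mul0n /= big_ord0 expr0.
rewrite mulSnr leb_int_cat exprS EFinM -JG.
transitivity (leb_int d (fun v => (J ^+ n)%:E * (G v)%:E)%E); last first.
  rewrite [LHS](@leb_intZl R d (fun v => (G v)%:E)); first exact: muleC.
  - exact/measurable_EFinP.
  - by move=> q; rewrite lee_fin.
  - by rewrite lee_fin exprn_ge0 // -lee_fin -JG leb_int_ge0 // => q; rewrite lee_fin.
apply: leb_int_supp => v v0; rewrite -IH muleC -leb_intZl //; last 2 first.
- by move=> q; rewrite lee_fin prodr_ge0.
- by rewrite lee_fin.
apply: eq_leb_int => u; rewrite big_ord_recr /= block_merge_last block0_supp //.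
rewrite mulrC EFinM; congr (_ * _%:E)%E; apply: eq_bigr => i _.
by rewrite block_merge_lt.
Qed.

End leb_int_products.

(** * Real-valued iterated integrals *)

Section leb_int_real.
Context {R : realType}.

(** [fine] sends an infinite integral to 0, so linearity of [leb_intR] is established on integrable
    functions. *)
Definition lint N (h : seqT R -> R) : Prop :=
  measurable_fun setT h /\ (leb_int N (fun q => `|h q|%:E) < +oo)%E.

Lemma leb_intR_ge0E N (h : seqT R -> R) : (forall q, 0 <= h q) ->
  leb_intR N h = fine (leb_int N (fun q => (h q)%:E)).
Proof.
move=> h0; rewrite /leb_intR.
rewrite (_ : leb_int N (fun q => (Num.max (- h q) 0)%:E) = 0%:E); last first.
  by rewrite -(leb_int0 N); apply: eq_leb_int => q; rewrite max_r // oppr_le0.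
by rewrite subr0; congr fine; apply: eq_leb_int => q; rewrite max_l.
Qed.

Lemma lintP N (h : seqT R -> R) : lint N h -> (forall q, 0 <= h q) ->
  leb_int N (fun q => (h q)%:E) = (leb_intR N h)%:E.
Proof.
move=> [mh fh] h0; rewrite leb_intR_ge0E // fineK // ge0_fin_numE; last first.
  by apply: leb_int_ge0 => q; rewrite lee_fin.
rewrite (_ : leb_int _ _ = leb_int N (fun q => `|h q|%:E)) //.
by apply: eq_leb_int => q; rewrite ger0_norm.
Qed.

Lemma lintI N (h : seqT R -> R) (c : R) : measurable_fun setT h ->
  (forall q, 0 <= h q) -> leb_int N (fun q => (h q)%:E) = c%:E ->
  lint N h /\ leb_intR N h = c.
Proof.
move=> mh h0 hc; split; last by rewrite leb_intR_ge0E // hc.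
split => //; rewrite (_ : leb_int _ _ = c%:E) ?ltry // -hc.
by apply: eq_leb_int => q; rewrite ger0_norm.
Qed.

Lemma measurable_EFinS (h : seqT R -> R) : measurable_fun setT h ->
  measurable_fun setT (fun q : seqT R => (h q)%:E).
Proof. by move=> mh; exact/measurable_EFinP. Qed.

Lemma lint_le N (h k : seqT R -> R) : measurable_fun setT h -> lint N k ->
  (forall q, `|h q| <= `|k q|) -> lint N h.
Proof.
move=> mh [mk fk] hk; split => //; apply: le_lt_trans fk.
exact: le_leb_int.
Qed.

Lemma lintD N (h k : seqT R -> R) : lint N h -> lint N k ->
  lint N (fun q => h q + k q).
Proof.
move=> [mh fh] [mk fk]; split; first exact: measurable_funD.
apply: (@le_lt_trans _ _ (leb_int N (fun q => `|h q|%:E + `|k q|%:E)%E)).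
  by apply: le_leb_int => // q; rewrite -EFinD lee_fin ler_normD.
rewrite leb_intD //; first by rewrite lte_add_pinfty.
- by apply: measurable_EFinS; exact: measurableT_comp.
- by apply: measurable_EFinS; exact: measurableT_comp.
Qed.

Lemma lintZ N (c : R) (h : seqT R -> R) : lint N h -> lint N (fun q => c * h q).
Proof.
move=> [mh fh]; split; first exact: measurable_funM.
rewrite (_ : leb_int _ _ = `|c|%:E * leb_int N (fun q => `|h q|%:E))%E.
  by apply: lte_mul_pinfty; rewrite ?lee_fin.
rewrite -leb_intZl //.
- by apply: eq_leb_int => q; rewrite -EFinM normrM.
- by apply: measurable_EFinS; exact: measurableT_comp.
Qed.

Lemma lintN N (h : seqT R -> R) : lint N h -> lint N (fun q => - h q).
Proof.
move=> /(lintZ (-1)); rewrite (_ : (fun q => -1 * h q) = (fun q => - h q)) //.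
by apply/funext => q; rewrite mulN1r.
Qed.

Lemma lint_pos N (h : seqT R -> R) : lint N h -> lint N (fun q => Num.max (h q) 0).
Proof.
move=> hh; apply: (lint_le _ hh).
  by apply: measurable_maxr => //; exact: hh.1.
by move=> q; rewrite ger0_norm ?le_max ?lexx ?orbT // ge_max ler_norm normr_ge0.
Qed.

Lemma leb_intR_split N (h : seqT R -> R) :
  leb_intR N h = leb_intR N (fun q => Num.max (h q) 0)
                 - leb_intR N (fun q => Num.max (- h q) 0).
Proof.
by rewrite [in RHS]leb_intR_ge0E ?[in RHS]leb_intR_ge0E // => q;
  rewrite le_max lexx orbT.
Qed.

Lemma leb_intRD_ge0 N (h k : seqT R -> R) : lint N h -> lint N k ->
  (forall q, 0 <= h q) -> (forall q, 0 <= k q) ->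
  leb_intR N (fun q => h q + k q) = leb_intR N h + leb_intR N k.
Proof.
move=> lh lk h0 k0; apply: (@EFin_inj R); rewrite [RHS]EFinD -!lintP //.
- rewrite -leb_intD //; first exact: measurable_EFinS lh.1.
  exact: measurable_EFinS lk.1.
- exact: lintD.
- by move=> q; apply: addr_ge0.
Qed.

Lemma leb_intRD N (h k : seqT R -> R) : lint N h -> lint N k ->
  leb_intR N (fun q => h q + k q) = leb_intR N h + leb_intR N k.
Proof.
move=> lh lk; have lhk := lintD lh lk.
have p0 (x : R) : 0 <= Num.max x 0 by rewrite le_max lexx orbT.
have mxE (x : R) : Num.max x 0 = x + Num.max (- x) 0.
  by case: (leP x 0) => x0; [rewrite max_l|rewrite max_r]; lra.
rewrite leb_intR_split [leb_intR N h]leb_intR_split [leb_intR N k]leb_intR_split.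
(* Positive and negative parts satisfy (h+k)^+ + h^- + k^- = (h+k)^- + h^+ + k^+, where every term
   is nonnegative. *)
have E : leb_intR N (fun q => Num.max (h q + k q) 0) +
   leb_intR N (fun q => Num.max (- h q) 0 + Num.max (- k q) 0) =
   leb_intR N (fun q => Num.max (- (h q + k q)) 0) +
   leb_intR N (fun q => Num.max (h q) 0 + Num.max (k q) 0).
  rewrite -!leb_intRD_ge0 //; do ?[exact: lint_pos | exact/lint_pos/lintN
     | apply: lintD | by move=> q; rewrite ?addr_ge0].
  congr leb_intR; apply/funext => q.
  by rewrite (mxE (h q + k q)) (mxE (h q)) (mxE (k q)); ring.
rewrite !leb_intRD_ge0 // in E; do ?[exact: lint_pos | exact/lint_pos/lintN].
lra.
Qed.

Lemma leb_intRZ_ge0 N (c : R) (h : seqT R -> R) : lint N h ->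
  0 <= c -> (forall q, 0 <= h q) ->
  leb_intR N (fun q => c * h q) = c * leb_intR N h.
Proof.
move=> lh c0 h0; apply: (@EFin_inj R); rewrite [RHS]EFinM -!lintP //.
- by rewrite -leb_intZl //; exact: measurable_EFinS lh.1.
- exact: lintZ.
- by move=> q; apply: mulr_ge0.
Qed.

Lemma leb_intRN N (h : seqT R -> R) :
  leb_intR N (fun q => - h q) = - leb_intR N h.
Proof.
rewrite /leb_intR opprB; congr (_ - fine _).
by apply: eq_leb_int => q; rewrite opprK.
Qed.

Lemma leb_intRZ N (c : R) (h : seqT R -> R) : lint N h ->
  leb_intR N (fun q => c * h q) = c * leb_intR N h.
Proof.
move=> lh.
have pos (c' : R) : 0 <= c' -> leb_intR N (fun q => c' * h q) = c' * leb_intR N h.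
  move=> c0; rewrite leb_intR_split [leb_intR N h]leb_intR_split mulrBr.
  rewrite -!leb_intRZ_ge0 //; do ?[exact: lint_pos | exact/lint_pos/lintN
     | by move=> q; rewrite le_max lexx orbT].
  by congr (leb_intR N _ - leb_intR N _); apply/funext => q;
    rewrite ?mulrN maxr_pMr // ?mulr0 ?mulrN.
case: (leP 0 c) => [|c0]; first exact: pos.
rewrite -[c]opprK mulNr -pos ?oppr_ge0 ?ltW // -leb_intRN.
by congr leb_intR; apply/funext => q; rewrite mulNr.
Qed.

Lemma leb_intRB N (h k : seqT R -> R) : lint N h -> lint N k ->
  leb_intR N (fun q => h q - k q) = leb_intR N h - leb_intR N k.
Proof. by move=> lh lk; rewrite leb_intRD ?leb_intRN //; exact: lintN. Qed.

Lemma leb_intR_ge0 N (h : seqT R -> R) : (forall q, 0 <= h q) -> 0 <= leb_intR N h.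
Proof.
move=> h0; rewrite leb_intR_ge0E //; apply: fine_ge0; apply: leb_int_ge0 => q.
by rewrite lee_fin.
Qed.

Lemma le_leb_intR N (h k : seqT R -> R) : lint N h -> lint N k ->
  (forall q, h q <= k q) -> leb_intR N h <= leb_intR N k.
Proof.
move=> lh lk hk; rewrite -subr_ge0 -leb_intRB //.
by apply: leb_intR_ge0 => q; rewrite subr_ge0.
Qed.

End leb_int_real.

(** * Measurability and one-particle integrals *)

Section measurability.
Context {R : realType}.

(** This is [qpt k.+1 q]; writing d = k+1 removes the predecessors from the types. *)
Definition snoc_pt k (q : nat -> R) : 'rV[R]_k * R := (\row_(j < k) q j, q k).


(** An open set is the countable union of the boxes with rational centre and half-width 1/(n+1) that
    it contains; a half-width below e/2 keeps such a box, taken around a nearby rational point,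
    inside the ball of radius e. *)
Lemma measurable_open_snoc k (U : set ('rV[R]_k * R)) : open U ->
  measurable [set q : seqT R | U (snoc_pt k q)].
Proof.
move=> oU.
pose box (i : 'rV[rat]_k * rat * nat) := [set z : 'rV[R]_k * R |
  (forall j, `|z.1 0 j - ratr (i.1.1 0 j)| < i.2.+1%:R^-1) /\
  `|z.2 - ratr i.1.2| < i.2.+1%:R^-1].
pose F i := if pselect (box i `<=` U) then
  [set q : seqT R | box i (snoc_pt k q)] else set0.
have -> : [set q : seqT R | U (snoc_pt k q)] = \bigcup_i F i.
  apply/seteqP; split => [q /= Uq|q /= [i _]]; last first.
    by rewrite /F; case: pselect => // bU /bU.
  have /nbhs_ballP [e /= e0 eU] : nbhs (snoc_pt k q) U.
    by apply: open_nbhs_nbhs; split.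
  have [n n_e] : exists n, (n.+1%:R^-1 : R) < e / 2.
    have e2 : 0 < e / 2 by exact: divr_gt0.
    by have [n _ /(_ n (leqnn n)) /= nP] := near_infty_natSinv_lt (PosNum e2); exists n.
  have ex (x : R) : exists a : rat, `|x - ratr a| < n.+1%:R^-1.
    have ltx : x - n.+1%:R^-1 < x + n.+1%:R^-1 by rewrite ltrD2l gtrN // invr_gt0.
    have [a] := rat_in_itvoo ltx.
    rewrite in_itv /= => /andP[a1 a2]; exists a.
    by rewrite ltr_distlC a1.
  pose a (x : R) := projT1 (cid (ex x)).
  have aP x : `|x - ratr (a x)| < n.+1%:R^-1 by rewrite /a; case: cid.
  exists ((\row_j a (q j), a (q k)), n) => //=; rewrite /F.
  set i0 := (_, _, _).
  case: (pselect (box i0 `<=` U)) => [bU|nbU] /=.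
    by split => [j|] /=; rewrite ?mxE; exact: aP.
  exfalso; apply: nbU => z [z1 z2]; apply: eU; split.
    split => // i j; rewrite ord1 /= /ball /= mxE.
    have /= := z1 j; rewrite mxE => zj; have qj := aP (q j).
    move: n_e zj qj; set w := _^-1 => n_e zj qj.
    rewrite -(subrKA (ratr (a (q j)))) (le_lt_trans (ler_normD _ _)) //.
    by rewrite [X in _ + X]distrC; lra.
  rewrite /ball /=.
  have /= zj := z2; have qj := aP (q k).
  move: n_e zj qj; set w := _^-1 => n_e zj qj.
  rewrite -(subrKA (ratr (a (q k)))) (le_lt_trans (ler_normD _ _)) //.
  by rewrite [X in _ + X]distrC; lra.
apply: countable_bigcupT_measurable; first exact: countableP.
move=> i; rewrite /F; case: pselect => bU //=.
have -> : [set q : seqT R | box i (snoc_pt k q)] =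
  (\bigcap_(j in [set: 'I_k]) (fun q : seqT R => q j) @^-1`
     [set t | `|t - ratr (i.1.1 0 j)| < i.2.+1%:R^-1]) `&`
  (fun q : seqT R => q k) @^-1` [set t | `|t - ratr i.1.2| < i.2.+1%:R^-1].
  apply/seteqP; split => q /= [q1 q2]; split => //.
    by move=> j _ /=; have := q1 j; rewrite mxE.
  by move=> j; rewrite mxE; exact: q1.
have mball (c e : R) : measurable [set t : R | `|t - c| < e].
  apply: open_measurable.
  rewrite (_ : [set t | _] = (ball c e)); first exact: ball_open.
  by apply/seteqP; split => t; rewrite /ball /= distrC.
apply: measurableI.
  apply: fin_bigcap_measurable => // j _.
  by rewrite -[X in measurable X]setTI; apply: measurable_coord.
by rewrite -[X in measurable X]setTI; apply: measurable_coord.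
Qed.

Lemma measurable_open_row k (U : set 'rV[R]_k) : open U ->
  measurable [set q : seqT R | U (\row_(j < k) q j)].
Proof.
move=> oU; apply: (@measurable_open_snoc k (fst @^-1` U)).
by apply: open_comp => // z _; exact: cvg_fst.
Qed.

Lemma measurable_continuous_snoc k (f : 'rV[R]_k * R -> R) : continuous f ->
  measurable_fun setT (fun q : seqT R => f (snoc_pt k q)).
Proof.
move=> cf; apply: (measurability _ (RGenOInfty.measurableE R)) => // _ [_ [a ->] <-].
rewrite setTI; apply: (@measurable_open_snoc k (f @^-1` `]a, +oo[%classic)).
by apply: open_comp => // z _; exact: cf.
Qed.

(** The sets with measurable preimage form a sigma-algebra that contains the open sets. *)
Lemma measurable_borel_row k (A : set 'rV[R]_k) : <<s [set U | open U] >> A ->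
  measurable [set q : seqT R | A (\row_(j < k) q j)].
Proof.
move=> /(_ (fun A => measurable [set q : seqT R | A (\row_(j < k) q j)])); apply.
split; last by move=> U; exact: measurable_open_row.
split.
- by rewrite (_ : [set q | _] = set0) // ; apply/seteqP; split.
- move=> B mB.
  rewrite (_ : [set q | _] = ~` [set q : seqT R | B (\row_j q j)]); first exact: measurableC.
  by apply/seteqP; split => q /=; [case|].
- move=> F mF; rewrite (_ : [set q | _] = \bigcup_n [set q : seqT R | F n (\row_j q j)]).
    exact: bigcupT_measurable.
  by apply/seteqP; split => q /=.
Qed.

End measurability.

(** * Indicators, cubes and Euclidean balls *)

Section single_particle.
Context {R : realType}.
Local Notation mu := (@lebesgue_measure R).

Lemma indic01 (T : Type) (A : set T) x : 0 <= (\1_A x : R) <= 1.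
Proof. by rewrite indicE; case: (x \in A); rewrite /= ?lexx ler01. Qed.

Lemma indic_ge0 (T : Type) (A : set T) x : 0 <= (\1_A x : R).
Proof. by case/andP: (indic01 A x). Qed.

Lemma indic_le1 (T : Type) (A : set T) x : (\1_A x : R) <= 1.
Proof. by case/andP: (indic01 A x). Qed.

Lemma indicT1 (T : Type) (A : set T) x : A x -> (\1_A x : R) = 1.
Proof. by move=> Ax; rewrite indicE mem_set. Qed.

Lemma indicF0 (T : Type) (A : set T) x : ~ A x -> (\1_A x : R) = 0.
Proof. by move=> Ax; rewrite indicE memNset. Qed.

Definition cube N (C : R) (q : nat -> R) : R := \prod_(i < N) \1_(`[- C, C]%classic) (q i).

Lemma cube_ge0 N (C : R) q : 0 <= cube N C q.
Proof. by apply: prodr_ge0 => i _; exact: indic_ge0. Qed.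

Lemma cube_in N (C : R) (q : nat -> R) : (forall i, (i < N)%N -> `|q i| <= C) -> cube N C q = 1.
Proof.
move=> qC; rewrite /cube big1 // => i _; rewrite indicT1 //= in_itv /=.
by rewrite -ler_norml; exact: qC.
Qed.

Lemma measurable_itv_indic (i : interval R) : measurable_fun setT (\1_[set` i] : R -> R).
Proof. by apply/measurable_indicP; exact: measurable_itv. Qed.

Lemma lint_cube N (C : R) : 0 <= C -> lint N (cube N C).
Proof.
move=> C0.
have H : leb_int N (fun q => (cube N C q)%:E) = (\prod_(i < N) (C - - C))%:E.
  apply: (@leb_int_prod R N (fun=> \1_(`[- C, C]%classic)) (fun=> C - - C)).
  - by move=> _; exact: measurable_itv_indic.
  - by move=> _ t; exact: indic_ge0.
  - move=> _; rewrite integral_indic // setIT.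
    by rewrite /= lebesgue_measure_itv /= lte_fin; case: ifP => // /negbT;
       rewrite -leNgt => CC; congr EFin; lra.
apply: (lintI _ (cube_ge0 _ _) H).1.
apply: measurable_prod => i _.
by apply: (measurableT_comp (measurable_itv_indic _)); exact: measurable_coord.
Qed.

Lemma lint_bounded N (C K : R) (h : seqT R -> R) : 0 <= C -> measurable_fun setT h ->
  (forall q, `|h q| <= K * cube N C q) -> lint N h.
Proof.
move=> C0 mh hK; apply: (lint_le mh (lintZ K (lint_cube N C0))) => q.
exact: le_trans (hK q) (ler_norm _).
Qed.

Context {k : nat}.
Implicit Types (q : nat -> R) (x : 'rV[R]_k) (c z : pt R k.+1).

Lemma edist_snoc q c :
  Defs.edist (snoc_pt k q : pt R k.+1) c =
  Num.sqrt (\sum_(j < k) (q j - c.1 0 j) ^+ 2 + (q k - c.2) ^+ 2).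
Proof.
rewrite /Defs.edist /esq /=; congr (Num.sqrt (_ + _)).
by apply: eq_bigr => j _; rewrite !mxE.
Qed.

Lemma edist_lt q c r : 0 < r ->
  (Defs.edist (snoc_pt k q : pt R k.+1) c < r) =
  (\sum_(j < k) (q j - c.1 0 j) ^+ 2 + (q k - c.2) ^+ 2 < r ^+ 2).
Proof.
move=> r0; rewrite edist_snoc -[X in _ < X](ger0_norm (ltW r0)) -sqrtr_sqr.
by rewrite ltr_sqrt // exprn_gt0.
Qed.

Lemma edist_lt_pt z c r : 0 < r ->
  (Defs.edist (d := k.+1) z c < r) = (\sum_(j < k) (z.1 0 j - c.1 0 j) ^+ 2 + (z.2 - c.2) ^+ 2 < r ^+ 2).
Proof.
move=> r0; rewrite /Defs.edist -[X in _ < X](ger0_norm (ltW r0)) -sqrtr_sqr.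
rewrite ltr_sqrt ?exprn_gt0 // /esq.
by congr (_ + _ < _); apply: eq_bigr => j _; rewrite !mxE.
Qed.

Lemma measurable_edist c : measurable_fun setT
  (fun q : seqT R => Defs.edist (snoc_pt k q : pt R k.+1) c).
Proof.
rewrite (_ : (fun q : seqT R => _) = (fun q : seqT R =>
   Num.sqrt (\sum_(j < k) (q j - c.1 0 j) ^+ 2 + (q k - c.2) ^+ 2))); last first.
  by apply/funext => q; rewrite edist_snoc.
have ms : measurable_fun setT (fun q : seqT R =>
    \sum_(j < k) (q j - c.1 0 j) ^+ 2 + (q k - c.2) ^+ 2).
  apply: measurable_funD.
    apply: measurable_sum => j; apply: measurable_funX.
    by apply: measurable_funB => //; exact: measurable_coord.
  by apply: measurable_funX; apply: measurable_funB => //; exact: measurable_coord.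
by have := measurableT_comp (continuous_measurable_fun (@sqrt_continuous R)) ms.
Qed.

Lemma measurable_eball c r : measurable [set q : seqT R | eball c r (snoc_pt k q)].
Proof.
rewrite -[X in measurable X]setTI.
have := measurable_edist c measurableT (measurable_itv `]-oo, r[).
congr measurable; apply/seteqP; split => q /=; rewrite in_itv /= => -[//].
Qed.

Lemma measurable_indicS (T : Type) (F : seqT R -> T) (A : set T) :
  measurable [set q : seqT R | A (F q)] -> measurable_fun setT (fun q : seqT R => (\1_A (F q) : R)).
Proof.
move=> mA; rewrite (_ : (fun q : seqT R => _) = \1_[set q : seqT R | A (F q)]).
  exact/measurable_indicP.
by apply/funext => q; rewrite !indicE; congr (nat_of_bool _)%:R; apply/idP/idP;
  rewrite !inE.
Qed.

End single_particle.

(** * Exponential integrals on the half-line *)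

Section exponential_moments.
Context {R : realType}.
Local Notation mu := (@lebesgue_measure R).

Lemma measurable_expRN (l : R) : measurable_fun setT (fun t : R => expR (- (l * t))).
Proof.
have m1 : measurable_fun setT (fun t : R => - (l * t)).
  by apply: measurable_funN; exact: measurable_funM.
exact: (measurableT_comp (@measurable_expR R) m1).
Qed.

Lemma integral_halfline_expR (l : R) : 0 < l ->
  (\int[mu]_t (\1_(`[0%R, +oo[%classic) t * expR (- (l * t)))%:E = (l^-1)%:E)%E.
Proof.
move=> l0; have := integral_exponential_pdf l0.
rewrite (_ : (\int[mu]_x (exponential_pdf l x)%:E)%E =
  (l%:E * \int[mu]_t (\1_(`[0%R, +oo[%classic) t * expR (- (l * t)))%:E)%E).
  move=> /(congr1 (fun z => (l^-1)%:E * z)%E).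
  by rewrite muleA -EFinM mulVf ?gt_eqF // mul1e mule1.
rewrite -ge0_integralZl //.
- apply: eq_integral => t _; rewrite -EFinM /exponential_pdf patchE indicE; congr EFin.
  by case: ifP => _; rewrite ?mul1r ?mul0r ?mulr0 //= mulNr.
- apply/measurable_EFinP; apply: measurable_funM; first exact: measurable_itv_indic.
  exact: measurable_expRN.
- by rewrite lee_fin ltW.
Qed.

Lemma integral_halfline_idexpR (l : R) : 0 < l ->
  (\int[mu]_t (\1_(`[0%R, +oo[%classic) t * (t * expR (- (l * t))))%:E = (l^-2)%:E)%E.
Proof.
move=> l0.
have cE : continuous (fun t : R => expR (- (l * t))).
  move=> t; apply: (@continuous_comp _ _ _ (fun t : R => - (l * t)) expR).
    by apply: continuousN; apply: continuousM; [exact: cst_continuous|].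
  exact: continuous_expR.
(* Antiderivative of t e^{-l t} that tends to 0 at infinity. *)
pose F (t : R) := - ((t / l + l^-2) * expR (- (l * t))).
have dF (t : R) : is_derive t 1 F (t * expR (- (l * t))).
  rewrite /F.
  apply: is_derive_eq; rewrite !scaler0 !add0r /GRing.scale /=.
  rewrite ?mulr1 ?mulr0 ?oppr0.
  by field; rewrite gt_eqF.
have cF : continuous F.
  by move=> t; apply: differentiable_continuous; apply/derivable1_diffP; exact: ex_derive.
transitivity (\int[mu]_(t in `[0%R, +oo[) (t * expR (- (l * t)))%:E)%E.
  rewrite [RHS]integral_mkcond; apply: eq_integral => t _.
  by rewrite patchE indicE; case: ifP => _; rewrite ?mul1r ?mul0r.
rewrite (@ge0_continuous_FTC2y _ _ F _ 0) //.
- by rewrite -EFinB sub0r /F mul0r mulr0 oppr0 expR0 mulr1 add0r opprK.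
- by move=> t t0; rewrite mulr_ge0 ?expR_ge0.
- by apply: continuous_subspaceT => t; apply: cvgM; [exact: cvg_id|exact: cE].
- rewrite /F -oppr0; apply: cvgN.
  have hl : expR (- (l / 2 * t)) @[t --> +oo%R] --> 0.
    apply: (@cvg_comp _ _ _ (fun t : R => l / 2 * t) (fun z => expR (- z)) _
      (pinfty_nbhs R)); last exact: cvgr_expR.
    by apply: gt0_cvgMry => //; exact: divr_gt0.
  (* Half of the decay pays for the linear factor: 1 + l t <= 2 e^{l t / 2}. *)
  apply: (@squeeze_cvgr _ _ _ _ (cst 0) (fun t => 2 * l^-2 * expR (- (l / 2 * t)))).
  - near=> t.
    have t0 : 0 <= t by near: t; exact: nbhs_pinfty_ge.
    have l20 : 0 <= l^-2 by rewrite invr_ge0 exprn_ge0 // ltW.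
    rewrite /cst; apply/andP; split.
      by rewrite mulr_ge0 ?expR_ge0 // addr_ge0 // divr_ge0 // ltW.
    rewrite (_ : - (l * t) = - (l / 2 * t) + - (l / 2 * t)); last by lra.
    rewrite expRD mulrA. rewrite ler_wpM2r ?expR_ge0 //.
    rewrite (_ : t / l + l^-2 = l^-2 * (1 + l * t)); last by field; rewrite gt_eqF.
    rewrite [X in _ <= X]mulrC -[X in X <= _]mulrA ler_wpM2l // expRN ler_pdivrMr ?expR_gt0 //.
    have := expR_ge1Dx (l / 2 * t).
    by lra.
  - exact: cvg_cst.
  - by rewrite -[X in _ --> X](mulr0 (2 * l^-2)); apply: cvgMr.
- by apply: cvg_at_right_filter; exact: cF.
- by move=> t _; rewrite derive1E; apply: derive_val.
Unshelve. all: by end_near. Qed.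

End exponential_moments.

(** * Weighted integrals over the cylinder and the ball *)

Section cylinder_ball.
Context {R : realType} {k : nat}.
Variables (Db : set 'rV[R]_k) (Rr : R).
Hypotheses (oDb : open Db) (bDb : bounded_set Db) (Rr0 : 0 < Rr).
Local Notation mu := (@lebesgue_measure R).
Implicit Types (x : 'rV[R]_k) (y l : R) (q : nat -> R).

Lemma bounded_coord : exists2 C : R, 0 <= C & forall x, Db x -> forall j, `|x 0 j| <= C.
Proof.
have [M [_ HM]] := bDb.
exists (`|M| + 1); first by rewrite addr_ge0.
move=> x Dx j; have := HM (`|M| + 1) _ x Dx.
rewrite (le_lt_trans (ler_norm M)) ?ltrDl // => /(_ isT); apply: le_trans.
rewrite [X in _ <= X]mx_normrE.
exact: (le_bigmax _ (fun ij : 'I_1 * 'I_k => `|x ij.1 ij.2|) (0, j)).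
Qed.

Lemma measurable_base : measurable [set q : seqT R | Db (\row_(j < k) q j)].
Proof. exact: measurable_open_row. Qed.

Lemma lint_base : lint k (fun q => \1_Db (\row_(j < k) q j)).
Proof.
have [C C0 HC] := bounded_coord.
apply: (lint_bounded C0 (K := 1)).
  exact: (measurable_indicS measurable_base).
move=> q; rewrite mul1r ger0_norm ?indic_ge0 //.
have [Dq|nDq] := pselect (Db (\row_j q j)); last by rewrite indicF0 // cube_ge0.
rewrite cube_in ?indic_le1 // => i ik.
by have := HC _ Dq (Ordinal ik); rewrite mxE.
Qed.

Lemma cyl_snoc q : (\1_(cyl (d := k.+1) Db) (snoc_pt k q) : R) =
  \1_Db (\row_(j < k) q j) * \1_(`[0%R, +oo[%classic) (q k).
Proof.
rewrite !indicE -natrM mulnb; congr (nat_of_bool _)%:R.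
apply/idP/andP; rewrite !inE /= in_itv /= andbT.
  by move=> [].
by move=> [].
Qed.

Lemma leb_int_cyl (phi : R -> R) : measurable_fun setT phi -> (forall t, 0 <= phi t) ->
  leb_int k.+1 (fun q => (\1_(cyl (d := k.+1) Db) (snoc_pt k q) * phi (q k))%:E) =
  ((lebk k Db)%:E * \int[mu]_t (\1_(`[0%R, +oo[%classic) t * phi t)%:E)%E.
Proof.
move=> mphi phi0; rewrite leb_intS.
have mp : measurable_fun setT (fun t : R => \1_(`[0%R, +oo[%classic) t * phi t).
  by apply: measurable_funM => //; exact: measurable_itv_indic.
have p0 (t : R) : 0 <= \1_(`[0%R, +oo[%classic) t * phi t by rewrite mulr_ge0 // indic_ge0.
rewrite -ge0_integralZl //; last 3 first.
- exact/measurable_EFinP.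
- by move=> t _; rewrite lee_fin.
- by rewrite lee_fin leb_intR_ge0 // => q; exact: indic_ge0.
apply: eq_integral => t _; rewrite -[(lebk k Db)%:E](lintP lint_base); last first.
  by move=> q; exact: indic_ge0.
rewrite muleC -leb_intZl //.
- apply: eq_leb_int => u; rewrite cyl_snoc -EFinM; congr EFin.
  rewrite /upd eqxx -mulrA mulrC; congr (_ * \1_Db _); apply/rowP => j.
  by rewrite !mxE ltn_eqF.
- by apply: measurable_EFinS; exact: (measurable_indicS measurable_base).
- by rewrite lee_fin.
Qed.

Definition cylw l (q : nat -> R) : R :=
  \1_(cyl (d := k.+1) Db) (snoc_pt k q) * expR (- (l * q k)).

Lemma measurable_cyl : measurable [set q : seqT R | cyl (d := k.+1) Db (snoc_pt k q)].
Proof.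
rewrite (_ : [set q | _] = [set q : seqT R | Db (\row_(j < k) q j)] `&`
   (fun q => q k) @^-1` `[0, +oo[%classic).
  apply: measurableI; first exact: measurable_base.
  rewrite -[X in measurable X]setTI; apply: measurable_coord => //.
by apply/seteqP; split => q /=; rewrite in_itv /= andbT.
Qed.

Lemma measurable_expRcoord l i : measurable_fun setT (fun q : seqT R => expR (- (l * q i))).
Proof.
exact: (measurableT_comp (measurable_expRN l) (measurable_coord i)).
Qed.

Lemma cylw_ge0 l q : 0 <= cylw l q.
Proof. by rewrite mulr_ge0 ?expR_ge0 // indic_ge0. Qed.

Lemma cylw_int l : 0 < l -> lint k.+1 (cylw l) /\ leb_intR k.+1 (cylw l) = lebk k Db / l.
Proof.
move=> l0; apply: lintI; last first.
- rewrite (leb_int_cyl (phi := fun t => expR (- (l * t)))).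
  + by rewrite integral_halfline_expR.
  + exact: measurable_expRN.
  + by move=> t; exact: expR_ge0.
- exact: cylw_ge0.
- apply: measurable_funM; last exact: measurable_expRcoord.
  exact: (measurable_indicS measurable_cyl).
Qed.

Lemma cylw1_int l : 0 < l -> lint k.+1 (fun q => q k * cylw l q) /\
  leb_intR k.+1 (fun q => q k * cylw l q) = lebk k Db / l ^+ 2.
Proof.
move=> l0.
(* Heights are nonnegative on the cylinder; the absolute value extends the factor to a function
   nonnegative everywhere, as [leb_int_cyl] requires. *)
have E q : q k * cylw l q =
   \1_(cyl (d := k.+1) Db) (snoc_pt k q) * (`|q k| * expR (- (l * q k))).
  rewrite /cylw; have [[_ /= qk]|nc] := pselect (cyl (d := k.+1) Db (snoc_pt k q)).
    by rewrite (ger0_norm qk) mulrCA.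
  by rewrite indicF0 // !mul0r mulr0.
have mq : measurable_fun setT (fun q : seqT R => q k * cylw l q).
  apply: measurable_funM; first exact: measurable_coord.
  apply: measurable_funM; last exact: measurable_expRcoord.
  exact: (measurable_indicS measurable_cyl).
apply: lintI => //.
  by move=> q; rewrite E !mulr_ge0 ?expR_ge0 // indic_ge0.
transitivity (leb_int k.+1 (fun q => (\1_(cyl (d := k.+1) Db) (snoc_pt k q) *
    (`|q k| * expR (- (l * q k))))%:E)); first by apply: eq_leb_int => q; rewrite E.
rewrite (leb_int_cyl (phi := fun t => `|t| * expR (- (l * t)))).
- rewrite EFinM -(integral_halfline_idexpR l0); congr (_ * _)%E.
  apply: eq_integral => t _; congr EFin.
  have [t0|t0] := leP 0 t; first by rewrite ger0_norm.
  by rewrite indicF0 ?mul0r //= in_itv /= andbT leNgt t0.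
- by apply: measurable_funM => //; exact: measurable_expRN.
- by move=> t; rewrite mulr_ge0 ?expR_ge0.
Qed.

Definition ballw (c : 'rV[R]_k * R) l (q : nat -> R) : R :=
  \1_(eball (c : pt R k.+1) Rr) (snoc_pt k q) * expR (- (l * q k)).

Lemma ballw_ge0 c l q : 0 <= ballw c l q.
Proof. by rewrite mulr_ge0 ?expR_ge0 // indic_ge0. Qed.

Lemma eball_coord c q : eball (c : pt R k.+1) Rr (snoc_pt k q) ->
  `|q k - c.2| < Rr /\ forall j : 'I_k, `|q j - c.1 0 j| < Rr.
Proof.
rewrite /eball /= edist_lt // => H.
have s0 : 0 <= \sum_(j < k) (q j - c.1 0 j) ^+ 2 by apply: sumr_ge0 => j _; exact: sqr_ge0.
have sq (a : R) : a ^+ 2 < Rr ^+ 2 -> `|a| < Rr.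
  move=> aR; rewrite ltNge; apply: contraL aR => Ra; rewrite -leNgt.
  by rewrite -[a ^+ 2]real_normK ?num_real // ler_pXn2r // nnegrE // ltW.
split; first by apply: sq; apply: le_lt_trans H; rewrite lerDr.
move=> j; apply: sq; apply: le_lt_trans H.
rewrite (bigD1 j) //= -addrA lerDl addr_ge0 ?sqr_ge0 //.
by apply: sumr_ge0 => i _; exact: sqr_ge0.
Qed.

Lemma measurable_ballw c l : measurable_fun setT (ballw c l : seqT R -> R).
Proof.
apply: measurable_funM; last exact: measurable_expRcoord.
exact: (measurable_indicS (measurable_eball _ _)).
Qed.

Lemma lint_eball_bounded c (h : seqT R -> R) (K : R) : measurable_fun setT h ->
  (forall q, eball (c : pt R k.+1) Rr (snoc_pt k q) -> `|h q| <= K) ->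
  lint k.+1 (fun q => \1_(eball (c : pt R k.+1) Rr) (snoc_pt k q) * h q).
Proof.
move=> mh hK.
pose C := Rr + \sum_(j < k) `|c.1 0 j| + `|c.2|.
have S0 : 0 <= \sum_(j < k) `|c.1 0 j| by apply: sumr_ge0.
have C0 : 0 <= C by rewrite !addr_ge0 // ltW.
apply: (lint_bounded C0 (K := `|K|)).
  apply: measurable_funM => //; exact: (measurable_indicS (measurable_eball _ _)).
move=> q; have [Bq|nB] := pselect (eball (c : pt R k.+1) Rr (snoc_pt k q)); last first.
  by rewrite indicF0 // mul0r normr0 mulr_ge0 ?cube_ge0.
rewrite indicT1 // mul1r cube_in ?mulr1; first exact: le_trans (hK _ Bq) (ler_norm _).
have [B1 B2] := eball_coord Bq.
have tri (a b : R) : `|a - b| < Rr -> `|a| <= Rr + `|b|.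
  move=> ab; rewrite -[X in `|X|](subrK b a) (le_trans (ler_normD _ _)) //.
  by rewrite lerD2r ltW.
move=> i; rewrite ltnS leq_eqVlt => /orP[/eqP->|ik].
  by rewrite (le_trans (tri _ _ B1)) // /C; lra.
rewrite (le_trans (tri _ _ (B2 (Ordinal ik)))) // /C -addrA lerD2l.
rewrite (bigD1 (Ordinal ik)) //= -addrA lerDl addr_ge0 //.
by apply: sumr_ge0.
Qed.

Lemma expR_le_norm l (t C : R) : `|t| <= C -> expR (- (l * t)) <= expR (`|l| * C).
Proof.
move=> tC; rewrite ler_expR (le_trans (ler_norm _)) // normrN normrM.
by rewrite ler_wpM2l.
Qed.

Lemma eball_height c q : eball (c : pt R k.+1) Rr (snoc_pt k q) -> `|q k| <= Rr + `|c.2|.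
Proof.
move=> /eball_coord[+ _] => H; rewrite -(subrK c.2 (q k)).
by rewrite (le_trans (ler_normD _ _)) // lerD2r ltW.
Qed.

Lemma lint_ballw c l : lint k.+1 (ballw c l).
Proof.
apply: (lint_eball_bounded (K := expR (`|l| * (Rr + `|c.2|)))).
  exact: measurable_expRcoord.
move=> q /eball_height H; rewrite ger0_norm ?expR_ge0 //; exact: expR_le_norm.
Qed.

Lemma lint_ballw1 c l : lint k.+1 (fun q => q k * ballw c l q).
Proof.
rewrite (_ : (fun q => _) = (fun q => \1_(eball (c : pt R k.+1) Rr) (snoc_pt k q) *
   (q k * expR (- (l * q k))))); last by apply/funext => q; rewrite mulrCA.
apply: (lint_eball_bounded (K := (Rr + `|c.2|) * expR (`|l| * (Rr + `|c.2|)))).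
  by apply: measurable_funM; [exact: measurable_coord|exact: measurable_expRcoord].
move=> q /eball_height H; rewrite normrM [`|expR _|]ger0_norm ?expR_ge0 //.
by rewrite ler_pM ?expR_ge0 //; exact: expR_le_norm.
Qed.

Lemma leb_intR_shift N (c : nat -> R) (h : seqT R -> R) : measurable_fun setT h ->
  leb_intR N (fun q => h (fun i => if (i < N)%N then q i + c i else q i)) = leb_intR N h.
Proof.
move=> mh.
have mm (h' : seqT R -> R) : measurable_fun setT h' ->
    measurable_fun setT (fun q : seqT R => (Num.max (h' q) 0)%:E).
  by move=> mh'; apply: measurable_EFinS; exact: measurable_maxr.
have m0 (h' : seqT R -> R) q : (0 <= (Num.max (h' q) 0)%:E)%E.
  by rewrite lee_fin le_max lexx orbT.
rewrite /leb_intR; congr (fine _ - fine _).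
  by rewrite -[RHS](leb_int_shift N c) //; exact: mm.
rewrite -[RHS](leb_int_shift N c) //; last by move=> q; exact: (m0 (fun q => - h q)).
by apply: (mm (fun q => - h q)); exact: measurableT_comp.
Qed.

Definition pt_coords (c : 'rV[R]_k * R) (i : nat) : R :=
  if (i < k)%N then rvnth c.1 i else c.2.

Lemma rvnth_ord x (j : 'I_k) : rvnth x j = x 0 j.
Proof. by rewrite /rvnth (big_pred1 j). Qed.

Lemma eball_shift c q :
  eball (c : pt R k.+1) Rr
    (snoc_pt k (fun i => if (i < k.+1)%N then q i + pt_coords c i else q i)) =
  eball ((0, 0) : pt R k.+1) Rr (snoc_pt k q).
Proof.
rewrite /eball /=; congr is_true; rewrite !edist_lt //=.
rewrite ltnSn /pt_coords ltnn addrK subr0; congr (_ + _ < _).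
by apply: eq_bigr => j _; rewrite ltnW ?ltnS // ltn_ord rvnth_ord addrK mxE subr0.
Qed.

Definition ballL l : R := leb_intR k.+1 (ballw (0, 0) l).
Definition ballL1 l : R := leb_intR k.+1 (fun q => q k * ballw (0, 0) l q).

(** Translating the ball to the origin pulls out e^{-l y} and leaves no trace of [x]; hence the
    integrals of the statement do not depend on the chosen point of D_b'. *)
Lemma ballw_int x y l : leb_intR k.+1 (ballw (x, y) l) = expR (- (l * y)) * ballL l.
Proof.
rewrite -(leb_intR_shift k.+1 (pt_coords (x, y))); last exact: measurable_ballw.
rewrite -leb_intRZ; last exact: lint_ballw.
congr leb_intR; apply/funext => q; rewrite /ballw !indicE.
rewrite mulrCA -expRD; congr ((nat_of_bool _)%:R * expR _).
  by apply/idP/idP; rewrite !inE eball_shift.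
by rewrite ltnSn /pt_coords ltnn /=; lra.
Qed.

Lemma ballw1_int x y l : leb_intR k.+1 (fun q => q k * ballw (x, y) l q) =
  expR (- (l * y)) * (y * ballL l + ballL1 l).
Proof.
rewrite -(leb_intR_shift k.+1 (pt_coords (x, y))); last first.
  by apply: measurable_funM; [exact: measurable_coord|exact: measurable_ballw].
have lb := lint_ballw (0, 0) l; have lb1 := lint_ballw1 (0, 0) l.
rewrite -(leb_intRZ y) // -leb_intRD //; last exact: lintZ.
rewrite -leb_intRZ; last by apply: lintD => //; exact: lintZ.
congr leb_intR; apply/funext => q; rewrite /ballw !indicE -mulrDl.
rewrite ltnSn /pt_coords ltnn /=.
rewrite (_ : (_ \in _) = (snoc_pt k q \in eball ((0, 0) : pt R k.+1) Rr)); last first.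
  by apply/idP/idP; rewrite !inE eball_shift.
rewrite (_ : - (l * (q k + y)) = - (l * y) + - (l * q k)); last by lra.
by rewrite expRD; ring.
Qed.

Definition xi x y (z : 'rV[R]_k * R) : R :=
  \1_(cyl (d := k.+1) Db `\` eball ((x, y) : pt R k.+1) Rr) z.

(** [Dbp] speaks of heights strictly above [Rr]: the horizontal part is read off after lifting the
    ball by 1, and the floor is respected because [Rr <= y]. *)
Lemma Dbp_ball x y : Dbp (d := k.+1) Db Rr x -> Rr <= y ->
  eball ((x, y) : pt R k.+1) Rr `<=` cyl (d := k.+1) Db.
Proof.
move=> [Dx xD] Ry z zB; split.
  have yR : Rr < y + 1 by apply: le_lt_trans Ry _; rewrite ltrDl.
  have [] // := xD (y + 1) yR (z.1, z.2 + 1).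
  move: zB; rewrite /eball /= !edist_lt_pt //=.
  by rewrite opprD addrACA subrr addr0.
move: zB; rewrite /eball /= edist_lt_pt //= => H.
have s0 : 0 <= \sum_(j < k) (z.1 0 j - x 0 j) ^+ 2 by apply: sumr_ge0 => j _; exact: sqr_ge0.
rewrite leNgt; apply/negP => z0.
have zy : Rr <= y - z.2 by rewrite lerBrDr (le_trans _ Ry) // gerDl ltW.
have : Rr ^+ 2 <= (z.2 - y) ^+ 2.
  rewrite -[(z.2 - y) ^+ 2]sqrrN opprB ler_pXn2r // nnegrE ?ltW //.
  exact: lt_le_trans zy.
by rewrite leNgt => /negP; apply; apply: le_lt_trans H; rewrite lerDr.
Qed.

(** The ball lies inside the cylinder, so the hole can be subtracted; masses and first moments
    outside the ball then reduce to [lebk k Db], [ballL] and [ballL1]. *)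
Lemma xiE x y z : Dbp (d := k.+1) Db Rr x -> Rr <= y ->
  xi x y z = \1_(cyl (d := k.+1) Db) z - \1_(eball ((x, y) : pt R k.+1) Rr) z.
Proof.
move=> Dx Ry; rewrite /xi; have sub := Dbp_ball Dx Ry.
have [zB|zB] := pselect (eball ((x, y) : pt R k.+1) Rr z).
  by rewrite (indicT1 zB) (indicT1 (sub _ zB)) subrr indicF0 // => -[].
have [zC|zC] := pselect (cyl (d := k.+1) Db z).
  by rewrite (indicT1 zC) (indicF0 zB) subr0 indicT1.
by rewrite (indicF0 zC) (indicF0 zB) subr0 indicF0 // => -[].
Qed.

Lemma measurable_xi x y : measurable_fun setT (fun q : seqT R => xi x y (snoc_pt k q)).
Proof.
apply: (measurable_indicS (F := snoc_pt k)).
rewrite (_ : [set q | _] = [set q : seqT R | cyl (d := k.+1) Db (snoc_pt k q)] `\`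
  [set q : seqT R | eball ((x, y) : pt R k.+1) Rr (snoc_pt k q)]).
  by apply: measurableD; [exact: measurable_cyl|exact: measurable_eball].
by apply/seteqP; split => q.
Qed.

End cylinder_ball.

(** * Saddle point of the free energy *)

Section saddle_point.
Context {R : realType}.
Variables (L L1 : R -> R) (A Rr m M g E dd : R).
Hypotheses (A0 : 0 < A) (Rr0 : 0 < Rr) (m0 : 0 < m) (M0 : 0 < M) (g0 : 0 < g)
  (dd0 : 0 < dd) (ERr : M * g * Rr < E).
Implicit Types y l : R.

(* With [L l] and [L1 l] the integrals of e^{-l r} and r e^{-l r} over the ball of
   radius [Rr] centred at 0, and [A] the volume of D_b, these are the integrals
   [IB], [I0] and [I1] of the statement. *)
Definition cap y l : R := l * expR (- (l * y)) * L l.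
Definition moment0 y l : R := A - cap y l.
Definition moment1 y l : R := A / l - l * expR (- (l * y)) * (y * L l + L1 l).
Definition energy y l : R :=
  dd * m * g / (2 * l) + m * g * (moment1 y l / moment0 y l) + M * g * y.
Definition saddle y l : Prop :=
  [/\ Rr <= y, 0 < l, M = m * (cap y l / moment0 y l) & energy y l = E].

Lemma cap_shift y y' l : cap y' l = expR (- (l * (y' - y))) * cap y l.
Proof.
rewrite /cap mulrA [expR _ * (l * _)]mulrCA -expRD.
by congr (_ * expR _ * _); ring.
Qed.

Lemma ln_lt_subr1 (x : R) : 0 < x -> x != 1 -> ln x < x - 1.
Proof.
move=> x0 x1; have lx : ln x != 0.
  by apply: contra_neq x1 => lx; rewrite -(lnK (x := x)) ?posrE // lx expR0.
have := expR_gt1Dx lx; rewrite lnK ?posrE //; lra.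
Qed.

Lemma ln_le_subr1 (x : R) : 0 < x -> ln x <= x - 1.
Proof.
move=> x0; have := expR_ge1Dx (ln x); rewrite lnK ?posrE //; lra.
Qed.

Section uniqueness.
(** Jensen's inequality for the weight e^{-l r} outside the ball, whose total mass is
    [moment0 y l / l] and whose mean height is [moment1 y l / moment0 y l]. *)
Hypothesis jensen : forall y l l', Rr <= y -> 0 < l -> 0 < l' -> 0 < moment0 y l ->
  moment0 y l / l * expR (- ((l' - l) * (moment1 y l / moment0 y l))) <=
  moment0 y l' / l'.
Hypothesis moment0_ge0 : forall y l, Rr <= y -> 0 < l -> 0 <= moment0 y l.

Lemma saddle_moment0_gt0 y l : saddle y l -> 0 < moment0 y l.
Proof.
move=> [Ry l0 HM _]; rewrite lt_neqAle moment0_ge0 // andbT.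
(* Since division by 0 yields 0, a vanishing [moment0] would turn the first equation into M = 0. *)
apply/eqP => H0; move: M0; rewrite HM -H0 invr0 !mulr0 ltxx //.
Qed.

Definition free_energy y l : R :=
  l * (E - M * g * y) / (m * g) - dd / 2 * ln l + ln (moment0 y l / l).

(** By the energy equation the linear term has slope dd/(2l) + r, with r the mean height. This
    cancels the tangent slopes of -(dd/2) ln l, which is strictly convex, and of the logarithm of
    the mass, which lies above its tangent by Jensen. Positivity of [moment0 y l'] is returned
    because [l'] will come from another solution. *)
Lemma free_energy_min y l l' : saddle y l -> 0 < l' -> l' != l ->
  0 < moment0 y l' /\ free_energy y l < free_energy y l'.
Proof.
move=> s l'0 l'l; have i0 := saddle_moment0_gt0 s; case: s => Ry l0 _ HE.
have J := jensen Ry l0 l'0 i0.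
have J0 : 0 < moment0 y l / l * expR (- ((l' - l) * (moment1 y l / moment0 y l))).
  by rewrite mulr_gt0 ?expR_gt0 // divr_gt0.
have i0' : 0 < moment0 y l' / l' by exact: lt_le_trans J.
split; first by move: i0'; rewrite pmulr_lgt0 // invr_gt0.
set r := moment1 y l / moment0 y l in J J0.
have lnJ : ln (moment0 y l / l) - (l' - l) * r <= ln (moment0 y l' / l').
  move: J; rewrite -ler_ln ?posrE // lnM ?posrE ?expR_gt0 ?divr_gt0 // expRK; lra.
have EE : (E - M * g * y) / (m * g) = dd / (2 * l) + r.
  rewrite -HE /energy -/r; field; rewrite !gt_eqF //.
have lnl : ln l' - ln l < l' / l - 1.
  rewrite -ln_div ?posrE //; apply: ln_lt_subr1; first exact: divr_gt0.
  by apply: contra_neq l'l => /(congr1 ( *%R^~ l)); rewrite mul1r divfK ?gt_eqF.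
have dlnl : dd / 2 * (ln l' - ln l) < (l' - l) * (dd / (2 * l)).
  rewrite (_ : (l' - l) * _ = dd / 2 * (l' / l - 1)).
    by rewrite ltr_pM2l // divr_gt0.
  by field; rewrite gt_eqF.
have fE (a : R) : a * (E - M * g * y) / (m * g) = a * (dd / (2 * l) + r).
  by rewrite -mulrA EE.
rewrite /free_energy !fE.
move: (ln (_ / _)) lnJ => a; move: (ln (_ / _)) => b lnJ.
lra.
Qed.

(** The first equation gives [cap y l = M / m * moment0 y l], so moving to [y'] multiplies [moment0]
    by 1 + (M/m)(1 - e^{-z}) with z = l (y' - y), while the linear term drops by (M/m) z. *)
Lemma free_energy_max y l y' : saddle y l -> 0 < moment0 y' l -> y' != y ->
  free_energy y' l < free_energy y l.
Proof.
move=> s i0' y'y; have i0 := saddle_moment0_gt0 s; case: s => Ry l0 HM HE.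
set z := l * (y' - y).
have z0 : - z != 0 by rewrite oppr_eq0 mulf_neq0 ?subr_eq0 // gt_eqF.
have capE : cap y l = M / m * moment0 y l.
  by rewrite {1}HM; field; rewrite !gt_eqF.
have momE : moment0 y' l / moment0 y l = 1 + M / m * (1 - expR (- z)).
  rewrite {1}/moment0 (cap_shift y) -/z.
  have -> : A = moment0 y l + cap y l by rewrite /moment0 subrK.
  by rewrite capE; field; rewrite !gt_eqF.
have lnlt : ln (moment0 y' l / l) - ln (moment0 y l / l) < M / m * z.
  rewrite -ln_div ?posrE ?divr_gt0 //.
  rewrite (_ : _ / _ = moment0 y' l / moment0 y l); last by field; rewrite !gt_eqF.
  apply: (@le_lt_trans _ _ (moment0 y' l / moment0 y l - 1)).
    by apply: ln_le_subr1; exact: divr_gt0.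
  rewrite momE addrAC subrr add0r ltr_pM2l ?divr_gt0 //.
  by have := expR_gt1Dx z0; lra.
rewrite /free_energy.
have -> : l * (E - M * g * y') / (m * g) = l * (E - M * g * y) / (m * g) - M / m * z.
  by rewrite /z; field; rewrite !gt_eqF.
lra.
Qed.

(** If l1 and l2 differ, going round the rectangle spanned by the two solutions gives F(y1,l1) <
    F(y1,l2) <= F(y2,l2) < F(y2,l1) <= F(y1,l1). *)
Lemma saddle_unique y1 l1 y2 l2 : saddle y1 l1 -> saddle y2 l2 -> y1 = y2 /\ l1 = l2.
Proof.
move=> s1 s2; have [_ l10 _ _] := s1; have [_ l20 _ _] := s2.
have [ll|ll] := eqVneq l1 l2.
  split => //; apply/eqP; apply/negPn/negP => yy; subst l2.
  have := free_energy_max s1 (saddle_moment0_gt0 s2) (contra_neq (@esym _ _ _) yy).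
  have := free_energy_max s2 (saddle_moment0_gt0 s1) yy.
  lra.
have [p1 m1] := free_energy_min s1 l20 (contra_neq (@esym _ _ _) ll).
have [p2 m2] := free_energy_min s2 l10 ll.
have [yy|yy] := eqVneq y1 y2; first by subst y2; lra.
have := free_energy_max s1 p2 (contra_neq (@esym _ _ _) yy).
have := free_energy_max s2 p1 yy.
lra.
Qed.

End uniqueness.

Section existence.
Hypotheses (cL : continuous L) (cL1 : continuous L1) (L_gt0 : forall l, 0 < l -> 0 < L l).
Hypothesis moment0_ge0 : forall y l, Rr <= y -> 0 < l -> 0 <= moment0 y l.
Hypothesis moment1_bounds : forall y l, Rr <= y -> 0 < l -> 0 <= moment1 y l <= A / l.

Lemma saddle_exists ls : 0 < ls ->
  (forall l, 0 < l -> energy Rr l = E -> l = ls) ->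
  M < m * (cap Rr ls / moment0 Rr ls) ->
  exists y l, saddle y l.
Proof.
move=> ls0 ls_uniq hyp.
have s0 : 0 < moment0 Rr ls.
  rewrite lt_neqAle moment0_ge0 // andbT; apply/eqP => H0.
  by move: hyp; rewrite -H0 invr0 !mulr0 ltNge ltW.
(* The value of [cap] forced by the first equation, M (A - cap) = m cap. *)
pose beta := M * A / (m + M).
have mM0 : 0 < m + M by exact: addr_gt0.
have beta0 : 0 < beta by rewrite divr_gt0 // mulr_gt0.
have Abeta : A - beta = m * A / (m + M) by rewrite /beta; field; rewrite gt_eqF.
have Abeta0 : 0 < A - beta by rewrite Abeta divr_gt0 // mulr_gt0.
(* Solves l e^{-l y} L(l) = [beta] for y. *)
pose yl l := ln (l * L l / beta) / l.
have lL0 l : 0 < l -> 0 < l * L l / beta.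
  by move=> l0; rewrite divr_gt0 // mulr_gt0 // L_gt0.
have cap_yl l : 0 < l -> cap (yl l) l = beta.
  move=> l0; rewrite /cap /yl mulrCA divff ?gt_eqF // mulr1 expRN lnK ?posrE ?lL0 //.
  by field; rewrite !gt_eqF //; exact: L_gt0.
have cap_le y l : 0 < l -> yl l <= y -> cap y l <= beta.
  move=> l0 yy; rewrite -(cap_yl _ l0) (cap_shift (yl l) y) cap_yl // ler_piMl ?(ltW beta0) //.
  by rewrite -expR0 ler_expR oppr_le0 mulr_ge0 ?subr_ge0 // ltW.
(* Truncation at [Rr] keeps the height in the range where the bounds on the moments hold, and
   [moment0] stays at least [A - beta]. *)
pose y l := Num.max (yl l) Rr.
have yR l : Rr <= y l by rewrite le_max lexx orbT.
have yyl l : yl l <= y l by rewrite le_max lexx.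
have m_y l : 0 < l -> A - beta <= moment0 (y l) l.
  by move=> l0; rewrite lerD2l lerN2 cap_le.
pose G l := energy (y l) l.
have cG l : 0 < l -> {for l, continuous G}.
  move=> l0; have ln0 : l != 0 by rewrite gt_eqF.
  have cl : t @[t --> l] --> l by exact: cvg_id.
  have cln : ln (t * L t / beta) @[t --> l] --> ln (l * L l / beta).
    apply: (@cvg_comp _ _ _ (fun t => t * L t / beta) (@ln R) _ (nbhs (l * L l / beta))).
      by apply: cvgMr_tmp; apply: cvgM => //; exact: cL.
    by apply: continuous_ln; exact: lL0.
  have cyl : yl t @[t --> l] --> yl l by apply: cvgM => //; exact: cvgV.
  have cy : y t @[t --> l] --> y l.
    rewrite /y maxr_absE (_ : (fun t => _) =
      (fun t => (yl t + Rr + `|yl t - Rr|) / 2)); last first.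
      by apply/funext => t; rewrite maxr_absE.
    have c2 : Rr @[t --> l] --> Rr by exact: cvg_cst.
    apply: cvgMr_tmp; apply: cvgD; first exact: cvgD.
    by apply: cvg_norm; exact: cvgB.
  have cE : expR (- (t * y t)) @[t --> l] --> expR (- (l * y l)).
    apply: (@cvg_comp _ _ _ (fun t => - (t * y t)) expR _ (nbhs (- (l * y l)))).
      by apply: cvgN; exact: cvgM.
    exact: continuous_expR.
  have cA (a : R) : a @[t --> l] --> a by exact: cvg_cst.
  have cLl := cL (x := l); have cL1l := cL1 (x := l).
  rewrite /prop_for /continuous_at /G /energy /moment1 /moment0 /cap.
  apply: cvgD; last exact: cvgM.
  apply: cvgD.
    apply: cvgM => //; apply: cvgV; first by rewrite mulf_neq0 // pnatr_eq0.
    exact: cvgM.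
  apply: cvgM => //; apply: cvgM.
    apply: cvgB; first by apply: cvgM => //; exact: cvgV.
    by apply: cvgM; [exact: cvgM|apply: cvgD => //; exact: cvgM].
  apply: cvgV; last by apply: cvgB => //; apply: cvgM => //; exact: cvgM.
  by rewrite gt_eqF // (lt_le_trans Abeta0) // m_y.
(* The mass of the hole cannot exceed that of the whole: [cap Rr l <= A] bounds the height by
   [Rr + C / l]. *)
pose C := ln (A / beta).
have C0 : 0 < C by rewrite ln_gt0 // ltr_pdivlMr // mul1r; lra.
have y_le l : 0 < l -> y l <= Rr + C / l.
  move=> l0; rewrite /y ge_max; apply/andP; split; last by rewrite lerDl divr_ge0 ?ltW.
  have : cap Rr l <= A by rewrite -subr_ge0; exact: moment0_ge0.
  rewrite (cap_shift (yl l)) cap_yl // -ler_pdivlMr // -ler_ln ?posrE ?expR_gt0 ?divr_gt0 ?mulr_gt0 //.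
  rewrite expRK -/C -lerBlDl ler_pdivlMr //; lra.
pose C' := dd * m * g / 2 + m * g * (A / (A - beta)) + M * g * C.
(* At [l1] the upper bound [C' / l + M * g * Rr] for the energy equals E; at [l0] the kinetic term
   alone equals E. *)
pose l1 := C' / (E - M * g * Rr).
pose l0 := dd * m * g / (2 * E).
have mg0 : 0 < m * g by exact: mulr_gt0.
have Mg0 : 0 < M * g by exact: mulr_gt0.
have E0 : 0 < E by apply: lt_trans ERr; rewrite mulr_gt0.
have dmg0 : 0 < dd * m * g by rewrite -mulrA mulr_gt0.
have ER0 : 0 < E - M * g * Rr by rewrite subr_gt0.
have AA0 : 0 < A / (A - beta) by exact: divr_gt0.
have C'0 : 0 < C'.
  by rewrite /C' addr_gt0 // ?(mulr_gt0 Mg0) // addr_gt0 ?(mulr_gt0 mg0) // divr_gt0.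
have l10 : 0 < l1 by exact: divr_gt0.
have l00 : 0 < l0 by rewrite divr_gt0 // mulr_gt0.
have l01 : l0 <= l1.
  rewrite /l0 /l1 ler_pdivrMr ?mulr_gt0 // [leRHS]mulrAC ler_pdivlMr //.
  have h1 : dd * m * g <= C' * 2 by rewrite /C'; have := mulr_gt0 mg0 AA0; have := mulr_gt0 Mg0 C0; lra.
  have h2 : E - M * g * Rr <= E by have := mulr_gt0 Mg0 Rr0; lra.
  apply: (@le_trans _ _ (C' * 2 * E)); last by lra.
  by apply: ler_pM => //; exact: ltW.
have G0 : E <= G l0.
  rewrite /G /energy.
  have -> : dd * m * g / (2 * l0) = E.
    by rewrite /l0; field; rewrite !gt_eqF.
  rewrite -addrA lerDl addr_ge0 // mulr_ge0 ?(ltW mg0) ?(ltW Mg0) //.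
    have /andP[h1 _] := moment1_bounds (yR l0) l00.
    by rewrite divr_ge0 // moment0_ge0.
  exact: le_trans (ltW Rr0) (yR l0).
have G1 : G l1 <= E.
  have -> : E = C' / l1 + M * g * Rr by rewrite /l1; field; rewrite !gt_eqF.
  rewrite /G /energy.
  have /andP[h0 h1] := moment1_bounds (yR l1) l10.
  have hI : moment1 (y l1) l1 / moment0 (y l1) l1 <= A / (A - beta) / l1.
    rewrite [leRHS]mulrAC; apply: ler_pM => //.
      by rewrite invr_ge0 moment0_ge0.
    by rewrite lef_pV2 ?posrE ?m_y // (lt_le_trans Abeta0) ?m_y.
  have := ler_wpM2l (ltW mg0) hI; have := ler_wpM2l (ltW Mg0) (y_le _ l10).
  have -> : C' / l1 = dd * m * g / (2 * l1) + m * g * (A / (A - beta) / l1) + M * g * (C / l1).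
    by rewrite /C'; field; rewrite !gt_eqF.
  rewrite mulrDr; lra.
have cGi : {within `[l0, l1], continuous G}.
  apply: continuous_in_subspaceT => l; rewrite inE /= in_itv /= => /andP[h _].
  by apply: cG; exact: lt_le_trans h.
have mm : Num.min (G l0) (G l1) <= E <= Num.max (G l0) (G l1).
  by rewrite ge_min le_max G0 G1 orbT.
have [l] := IVT l01 cGi mm.
rewrite in_itv /= => /andP[ll _] HG.
have l_gt0 : 0 < l by exact: lt_le_trans ll.
have [yly|yly] := ltP Rr (yl l).
  have yE : y l = yl l by rewrite /y max_l // ltW.
  exists (y l), l; split => //; rewrite yE cap_yl // /moment0 cap_yl // Abeta.
  by rewrite /beta; field; rewrite !gt_eqF.
(* If the truncation is active then l is [ls], and [cap Rr ls <= beta] contradicts the hypothesis,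
   which amounts to [cap Rr ls > beta]. *)
exfalso.
have yE : y l = Rr by rewrite /y max_r.
have lls : l = ls by apply: ls_uniq => //; rewrite -yE.
have hle := cap_le _ _ l_gt0 yly; rewrite lls in hle.
have : M * moment0 Rr ls < m * cap Rr ls.
  by move: hyp; rewrite mulrA ltr_pdivlMr.
have := ler_wpM2l (ltW mM0) hle.
have -> : (m + M) * beta = M * A by rewrite /beta; field; rewrite gt_eqF.
rewrite /moment0; lra.
Qed.

End existence.
End saddle_point.

(** * One-particle integrals at the saddle point *)

Section ball_laplace.
Context {R : realType} {k : nat}.
Variables (Rr : R).
Hypotheses (Rr0 : 0 < Rr).
Implicit Types (l : R) (q : nat -> R).
Local Notation B0 := (eball ((0, 0) : pt R k.+1) Rr).

Section laplace.
Variables (h : seqT R -> R) (K : R).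
Hypotheses (mh : measurable_fun setT h)
  (h_bounds : forall q, B0 (snoc_pt k q) -> 0 <= h q <= K).

(** Used with [h] equal to 1 and to the height plus [Rr]: the height changes sign on the ball about
    0, and adding [Rr] makes it nonnegative. *)
Definition laplace l := leb_intR k.+1 (fun q => \1_B0 (snoc_pt k q) * (h q * expR (- (l * q k)))).

Lemma lint_laplace l : lint k.+1 (fun q => \1_B0 (snoc_pt k q) * (h q * expR (- (l * q k)))).
Proof.
apply: (lint_eball_bounded Rr0 (K := K * expR (`|l| * (Rr + 0)))).
  by apply: measurable_funM => //; exact: measurable_expRcoord.
move=> q Bq; have /andP[h0 hK] := h_bounds Bq; have := eball_height Rr0 Bq.
rewrite /= normr0 => qR; rewrite ger0_norm ?mulr_ge0 ?expR_ge0 //.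
by rewrite ler_pM ?expR_ge0 //; exact: expR_le_norm.
Qed.

(** Heights on the ball are at most [Rr] in absolute value, so changing l costs a bounded factor;
    continuity and the transfer of positivity both come from this. *)
Lemma laplace_le l l' : laplace l' <= expR (`|l' - l| * Rr) * laplace l.
Proof.
rewrite -leb_intRZ; last exact: lint_laplace.
apply: le_leb_intR; [exact: lint_laplace|exact/lintZ/lint_laplace|].
move=> q; have [Bq|nB] := pselect (B0 (snoc_pt k q)); last first.
  by rewrite indicF0 // !mul0r mulr0.
have /andP[h0 _] := h_bounds Bq; have := eball_height Rr0 Bq.
rewrite /= normr0 addr0 => qR.
rewrite indicT1 // !mul1r mulrCA ler_wpM2l // -expRD ler_expR.
rewrite -lerBlDr (_ : - (l' * q k) - - (l * q k) = - ((l' - l) * q k)); last by ring.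
by rewrite (le_trans (ler_norm _)) // normrN normrM ler_wpM2l.
Qed.

Lemma laplace_ge0 l : 0 <= laplace l.
Proof.
apply: leb_intR_ge0 => q; have [Bq|nB] := pselect (B0 (snoc_pt k q)); last first.
  by rewrite indicF0 // mul0r.
by have /andP[h0 _] := h_bounds Bq; rewrite !mulr_ge0 ?expR_ge0 ?indic_ge0.
Qed.

Lemma continuous_laplace : continuous laplace.
Proof.
move=> l.
have c1 : `|t - l| * Rr @[t --> l] --> 0.
  rewrite -[X in _ --> X](mul0r Rr); apply: cvgMr_tmp.
  rewrite -[X in _ --> X](normr0 R) -[X in `|X|](subrr l).
  by apply: cvg_norm; apply: cvgB; [exact: cvg_id|exact: cvg_cst].
have cexp (u : R -> R) : u t @[t --> l] --> 0 -> expR (u t) * laplace l @[t --> l] --> laplace l.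
  move=> cu; rewrite -[X in _ --> X](mul1r (laplace l)) -expR0; apply: cvgMr_tmp.
  by apply: (@cvg_comp _ _ _ u (@expR R) _ (nbhs 0)) => //; exact: continuous_expR.
apply: (@squeeze_cvgr _ _ _ _ (fun t => expR (- (`|t - l| * Rr)) * laplace l)
   (fun t => expR (`|t - l| * Rr) * laplace l)).
- near=> t; rewrite laplace_le andbT expRN mulrC ler_pdivrMr ?expR_gt0 // mulrC.
  by rewrite distrC; exact: laplace_le.
- by apply: cexp; rewrite -oppr0; exact: cvgN.
- exact: cexp.
Unshelve. all: by end_near. Qed.
End laplace.

Lemma ballL_laplace : ballL (k := k) Rr = laplace (fun=> 1).
Proof.
by apply/funext => l; congr leb_intR; apply/funext => q; rewrite mul1r.
Qed.

Lemma ballL1_laplace : ballL1 (k := k) Rr =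
  (fun l => laplace (fun q => q k + Rr) l - Rr * ballL (k := k) Rr l).
Proof.
apply/funext => l; have lb := lint_ballw (k := k) Rr0 (0, 0) l.
rewrite -leb_intRZ // -leb_intRB //; last exact: lintZ.
  by congr leb_intR; apply/funext => q; rewrite /ballw; ring.
apply: (lint_laplace (K := Rr + Rr)).
  by apply: measurable_funD => //; exact: measurable_coord.
move=> q /(eball_height Rr0); rewrite /= normr0 addr0 ler_norml => /andP[q1 q2].
by apply/andP; split; lra.
Qed.

Lemma continuous_ballL : continuous (ballL (k := k) Rr).
Proof. by rewrite ballL_laplace; apply: (continuous_laplace (K := 1)) => // q _; rewrite ler01 lexx. Qed.

Lemma continuous_ballL1 : continuous (ballL1 (k := k) Rr).
Proof.
rewrite ballL1_laplace => l; apply: cvgB.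
  apply: (continuous_laplace (K := Rr + Rr)).
    by apply: measurable_funD => //; exact: measurable_coord.
  move=> q /(eball_height Rr0); rewrite /= normr0 addr0 ler_norml => /andP[q1 q2].
  by apply/andP; split; lra.
by apply: cvgMl_tmp; exact: continuous_ballL.
Qed.

Lemma ballL_ge0 l : 0 <= ballL (k := k) Rr l.
Proof. by rewrite ballL_laplace; apply: (laplace_ge0 (K := 1)) => q _; rewrite ler01 lexx. Qed.

(** Positivity at [ls] will be supplied by the hypothesis on M, and spreads from there to every
    parameter. *)
Lemma ballL_gt0 l l' : 0 < ballL (k := k) Rr l -> 0 < ballL (k := k) Rr l'.
Proof.
move=> Ll; rewrite -(pmulr_rgt0 _ (expR_gt0 (`|l - l'| * Rr))).
apply: lt_le_trans Ll _; rewrite ballL_laplace; apply: (laplace_le (K := 1)) => // q _.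
by rewrite ler01 lexx.
Qed.

End ball_laplace.

Section saddle_integrals.
Context {R : realType} {k : nat}.
Variables (Db : set 'rV[R]_k) (Rr : R).
Hypotheses (oDb : open Db) (bDb : bounded_set Db) (Rr0 : 0 < Rr).
Implicit Types (x : 'rV[R]_k) (y l : R) (q : nat -> R).
Local Notation A := (lebk k Db).
Local Notation L := (ballL (k := k) Rr).
Local Notation L1 := (ballL1 (k := k) Rr).

Definition xiw x y l q : R := xi Db Rr x y (snoc_pt k q) * expR (- (l * q k)).

Lemma xi_ge0 x y z : 0 <= xi Db Rr x y z.
Proof. exact: indic_ge0. Qed.

Lemma xiw_ge0 x y l q : 0 <= xiw x y l q.
Proof. by rewrite mulr_ge0 ?expR_ge0 // xi_ge0. Qed.

Lemma measurable_xiw x y l : measurable_fun setT (xiw x y l : seqT R -> R).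
Proof.
by apply: measurable_funM; [exact: measurable_xi|exact: measurable_expRcoord].
Qed.

Section fixed.
Variables (x : 'rV[R]_k) (y l : R).
Hypotheses (Dx : Dbp (d := k.+1) Db Rr x) (Ry : Rr <= y) (l0 : 0 < l).

Lemma xiwE : xiw x y l = (fun q => cylw Db l q - ballw Rr (x, y) l q).
Proof. by apply/funext => q; rewrite /xiw xiE // mulrBl. Qed.

Lemma lint_xiw : lint k.+1 (xiw x y l).
Proof.
rewrite xiwE; apply: lintD; first exact: (cylw_int oDb bDb l0).1.
exact/lintN/lint_ballw.
Qed.

Lemma lint_xiw1 : lint k.+1 (fun q => q k * xiw x y l q).
Proof.
rewrite xiwE (_ : (fun q => _) = (fun q => q k * cylw Db l q - q k * ballw Rr (x, y) l q)).
  apply: lintD; first exact: (cylw1_int oDb bDb l0).1.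
  exact/lintN/lint_ballw1.
by apply/funext => q; rewrite mulrBr.
Qed.

Lemma xiw_int : leb_intR k.+1 (xiw x y l) = moment0 L A y l / l.
Proof.
rewrite xiwE leb_intRB; [|exact: (cylw_int oDb bDb l0).1|exact: lint_ballw].
rewrite (cylw_int oDb bDb l0).2 ballw_int // /moment0 /cap.
by field; rewrite gt_eqF.
Qed.

Lemma xiw1_int : leb_intR k.+1 (fun q => q k * xiw x y l q) = moment1 L L1 A y l / l.
Proof.
rewrite xiwE (_ : (fun q => _) = (fun q => q k * cylw Db l q - q k * ballw Rr (x, y) l q)); last first.
  by apply/funext => q; rewrite mulrBr.
rewrite leb_intRB; [|exact: (cylw1_int oDb bDb l0).1|exact: lint_ballw1].
rewrite (cylw1_int oDb bDb l0).2 ballw1_int // /moment1.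
by field; rewrite gt_eqF.
Qed.

Lemma nu_dens_xiw q : nu_dens (d := k.+1) Db Rr x y l (qpt k.+1 q) = l * xiw x y l q.
Proof. by rewrite /nu_dens /xiw /xi mulrCA. Qed.

Lemma I0E : I0 k.+1 Db Rr x y l = moment0 L A y l.
Proof.
rewrite /I0 (_ : (fun q => _) = (fun q => l * xiw x y l q)); last first.
  by apply/funext => q; exact: nu_dens_xiw.
by rewrite leb_intRZ ?xiw_int; [field; rewrite gt_eqF|exact: lint_xiw].
Qed.

Lemma I1E : I1 k.+1 Db Rr x y l = moment1 L L1 A y l.
Proof.
rewrite /I1 (_ : (fun q => _) = (fun q => l * (q k * xiw x y l q))); last first.
  by apply/funext => q; rewrite nu_dens_xiw /= mulrCA.
by rewrite leb_intRZ ?xiw1_int; [field; rewrite gt_eqF|exact: lint_xiw1].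
Qed.

Lemma moment0_ge0 : 0 <= moment0 L A y l.
Proof.
have := leb_intR_ge0 k.+1 (xiw_ge0 x y l).
by rewrite xiw_int pmulr_lge0 // invr_gt0.
Qed.

Lemma moment1_bounds : 0 <= moment1 L L1 A y l <= A / l.
Proof.
apply/andP; split.
  have : 0 <= leb_intR k.+1 (fun q => q k * xiw x y l q).
    apply: leb_intR_ge0 => q; rewrite /xiw /xi.
    have [[[_ /= q0] _]|nc] :=
      pselect ((cyl (d := k.+1) Db `\` eball ((x, y) : pt R k.+1) Rr) (snoc_pt k q)).
      by rewrite !mulr_ge0 ?expR_ge0 // indic_ge0.
    by rewrite indicF0 // mul0r mulr0.
  by rewrite xiw1_int pmulr_lge0 // invr_gt0.
rewrite /moment1 gerBl -mulrA -(ballw1_int Rr0 x) mulr_ge0 ?(ltW l0) //.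
apply: leb_intR_ge0 => q.
rewrite /ballw; have [Bq|nB] := pselect (eball ((x, y) : pt R k.+1) Rr (snoc_pt k q)).
  by have [_ /= q0] := Dbp_ball Rr0 Dx Ry Bq; rewrite !mulr_ge0 ?expR_ge0 // indic_ge0.
by rewrite indicF0 // mul0r mulr0.
Qed.

End fixed.

Lemma IBE x y l : IB k.+1 Rr x y l = cap L y l.
Proof.
rewrite /IB (_ : (fun q => _) = (fun q => l * ballw Rr (x, y) l q)); last first.
  by apply/funext => q; rewrite /ballw mulrCA.
by rewrite leb_intRZ ?ballw_int ?/cap ?mulrA //; exact: lint_ballw.
Qed.

(** This is e^{-u} >= 1 - u with u = (l' - l)(height - mean height); the linear term integrates to
    0. *)
Lemma moment_jensen x : Dbp (d := k.+1) Db Rr x ->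
  forall y l l', Rr <= y -> 0 < l -> 0 < l' -> 0 < moment0 L A y l ->
  moment0 L A y l / l * expR (- ((l' - l) * (moment1 L L1 A y l / moment0 L A y l))) <=
  moment0 L A y l' / l'.
Proof.
move=> Dx y l l' Ry l0 l'0 i0.
set r := _ / moment0 L A y l; set c := l' - l.
rewrite -[leRHS](xiw_int Dx Ry l'0).
have lx := lint_xiw Dx Ry l0; have lx1 := lint_xiw1 Dx Ry l0.
rewrite (_ : _ * expR _ = leb_intR k.+1 (fun q => expR (- (c * r)) *
   ((1 + c * r) * xiw x y l q - c * (q k * xiw x y l q)))); last first.
  rewrite leb_intRZ ?leb_intRB ?leb_intRZ //; do ?[exact: lintZ].
    rewrite (xiw_int Dx Ry l0) (xiw1_int Dx Ry l0).
    rewrite (_ : moment1 L L1 A y l = r * moment0 L A y l); last by rewrite divfK ?gt_eqF.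
    by rewrite mulrC; congr (_ * _); ring.
  by apply: lintD; [exact: lintZ|exact/lintN/lintZ].
apply: le_leb_intR.
- by apply: lintZ; apply: lintD; [exact: lintZ|exact/lintN/lintZ].
- exact: lint_xiw.
move=> q; rewrite [xiw x y l' q]/xiw /xiw.
rewrite (_ : - (l' * q k) = - (l * q k) + - (c * r) + - (c * (q k - r))); last by rewrite /c; ring.
rewrite !expRD.
set X := xi _ _ _ _ _.
rewrite (_ : _ * (_ - _) = (X * (expR (- (l * q k)) * expR (- (c * r)))) *
   (1 + - (c * (q k - r)))); last by ring.
rewrite [leRHS]mulrA ler_wpM2l ?expR_ge1Dx //.
by rewrite !mulr_ge0 ?expR_ge0 // xi_ge0.
Qed.

End saddle_integrals.

(** * Exponential tilting of the one-particle law *)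

Section chernoff.
Context {R : realType} {k : nat}.
Variables (Db : set 'rV[R]_k) (Rr : R).
Hypotheses (oDb : open Db) (bDb : bounded_set Db) (Rr0 : 0 < Rr).
Implicit Types (x : 'rV[R]_k) (y l : R) (q : nat -> R).
Local Notation A := (lebk k Db).
Local Notation L := (ballL (k := k) Rr).
Local Notation xiwD := (xiw Db Rr).
Local Notation cylD := (cyl (d := k.+1) Db).

Lemma eball_shrink x y y' (e : R) : `|y - y'| <= e ->
  eball ((x, y') : pt R k.+1) (Rr - e) `<=` eball ((x, y) : pt R k.+1) Rr.
Proof.
move=> ye z zB.
have e0 : 0 <= e by exact: le_trans ye.
have re0 : 0 < Rr - e.
  by apply: le_lt_trans zB; exact: sqrtr_ge0.
move: zB; rewrite /eball /= !edist_lt_pt //=.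
set S := \sum_(j < k) _ => H.
have S0 : 0 <= S by apply: sumr_ge0 => j _; exact: sqr_ge0.
set a := z.2 - y' in H *; set b := y' - y.
have -> : z.2 - y = a + b by rewrite /a /b; ring.
have be : `|b| <= e by rewrite /b distrC.
have are : `|a| <= Rr - e.
  rewrite -(ler_pXn2r (n := 2)) ?nnegrE ?normr_ge0 ?(ltW re0) //.
  by rewrite real_normK ?num_real //; lra.
have ab : a * b <= (Rr - e) * e.
  by rewrite (le_trans (ler_norm _)) // normrM ler_pM.
have b2 : b ^+ 2 <= e ^+ 2.
  by rewrite -[b ^+ 2]real_normK ?num_real // ler_pXn2r ?nnegrE.
by move: H; rewrite !expr2 in b2 *; lra.
Qed.

(** An open ball is the increasing union of the concentric smaller ones, so thin shells have small
    volume by monotone convergence. *)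
Lemma ball_volume_cvg (c : 'rV[R]_k * R) :
  leb_intR k.+1 (fun q => \1_(eball (c : pt R k.+1) (Rr - j.+1%:R^-1)) (snoc_pt k q))
    @[j --> \oo] -->
  leb_intR k.+1 (fun q => \1_(eball (c : pt R k.+1) Rr) (snoc_pt k q)).
Proof.
pose g (r : R) q : R := \1_(eball (c : pt R k.+1) r) (snoc_pt k q).
have mg r : measurable_fun setT (g r : seqT R -> R).
  exact: (measurable_indicS (measurable_eball _ _)).
have g0 r q : 0 <= g r q by exact: indic_ge0.
have gle r r' q : r <= r' -> g r q <= g r' q.
  move=> rr; rewrite /g; have [B|nB] := pselect (eball (c : pt R k.+1) r (snoc_pt k q)).
    by rewrite indicT1 // indicT1 //; exact: lt_le_trans B rr.
  by rewrite indicF0.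
have lg r : r <= Rr -> lint k.+1 (g r).
  move=> rR; apply: (lint_le (mg r) (lint_ballw (k := k) Rr0 c 0)) => q.
  by rewrite !ger0_norm ?ballw_ge0 // /ballw mul0r oppr0 expR0 mulr1 gle.
have rj j : Rr - j.+1%:R^-1 <= Rr by rewrite gerBl invr_ge0.
have H : leb_int k.+1 (fun q => (g (Rr - j.+1%:R^-1) q)%:E) @[j --> \oo] -->
    leb_int k.+1 (fun q => (g Rr q)%:E).
  apply: leb_int_monotone_convergence.
  - by move=> j; exact: measurable_EFinS.
  - by move=> j q; rewrite lee_fin.
  - move=> q i j ij; rewrite lee_fin gle // lerD2l lerN2 lef_pV2 ?posrE //.
    by rewrite ler_nat ltnS.
  - move=> q; apply: cvg_near_cst.
    have [B|nB] := pselect (eball (c : pt R k.+1) Rr (snoc_pt k q)); last first.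
      near=> j; congr EFin; rewrite /g indicF0 ?indicF0 // => B; apply: nB.
      exact: lt_le_trans B (rj j).
    have d0 : 0 < Rr - Defs.edist (snoc_pt k q : pt R k.+1) c by rewrite subr_gt0.
    near=> j; congr EFin; rewrite /g indicT1 ?indicT1 //.
    have : j.+1%:R^-1 < Rr - Defs.edist (snoc_pt k q : pt R k.+1) c.
      by near: j; exact: (near_infty_natSinv_lt (PosNum d0)).
    by rewrite /eball /= ltrBrDl -ltrBrDr.
have E r : r <= Rr -> leb_int k.+1 (fun q => (g r q)%:E) = (leb_intR k.+1 (g r))%:E.
  by move=> rR; rewrite lintP //; exact: lg.
rewrite E // in H; rewrite (_ : (fun j => _) =
    (fun j : nat => (leb_intR k.+1 (g (Rr - j.+1%:R^-1)))%:E)) in H; last first.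
  by apply/funext => j; rewrite E.
move: H.
by move/fine_cvgP => [].
Unshelve. all: by end_near. Qed.

(** A second-order bound on the whole line, obtained from 1 + v <= e^v alone. *)
Lemma expR_le_quad (u : R) : expR u <= 1 + u + u ^+ 2 * expR `|u|.
Proof.
have key (v : R) : expR v <= 1 + v * expR v.
  have := expR_ge1Dx (- v); rewrite -(ler_pM2r (expR_gt0 v)) -expRD addNr expR0; lra.
have H : u * (expR u - 1) <= u ^+ 2 * expR `|u|.
  have [u0|u0] := leP 0 u.
    rewrite ger0_norm // expr2 -mulrA ler_wpM2l //; have := key u; lra.
  have h1 : (- u) * (1 - expR u) <= (- u) * (- u).
    by rewrite ler_wpM2l ?oppr_ge0 ?(ltW u0) //; have := expR_ge1Dx u; lra.
  have h2 : u ^+ 2 * 1 <= u ^+ 2 * expR `|u|.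
    by rewrite ler_wpM2l ?sqr_ge0 // -expR0 ler_expR.
  by rewrite expr2 in h2 *; lra.
have := key u; lra.
Qed.

(* For small [s] the tilted mass is [J + s H + O(s^2) < J], with [J] the total mass
   at [yA] and [H < 0] the integral of [h]; moving the hole from [yA] to [y] costs
   at most the volume of a thin spherical shell. *)
Lemma chernoff x yA l (h : seqT R -> R) (C : R) :
  Dbp (d := k.+1) Db Rr x -> Rr <= yA -> 0 < l -> 0 < moment0 L A yA l ->
  measurable_fun setT h -> 0 <= C ->
  (forall q, cylD (snoc_pt k q) -> `|h q| <= C * (1 + q k)) ->
  leb_intR k.+1 (fun q => h q * xiwD x yA l q) < 0 ->
  exists s th eta : R, [/\ 0 < s, 0 <= th < 1, 0 < eta &
    forall y, Rr <= y -> `|y - yA| <= eta -> exists2 K : R,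
      0 <= K <= th * (moment0 L A yA l / l) &
      leb_int k.+1 (fun q => (xiwD x y l q * expR (s * h q))%:E) = K%:E].
Proof.
move=> Dx RyA l0 i0 mh C0 hC H0.
set J := moment0 L A yA l / l.
have J0 : 0 < J by exact: divr_gt0.
set H := leb_intR _ _ in H0.
(* Makes s0 |h| at most (l/4)(1 + height): a factor e^{s |h|} uses up at most a quarter of the decay
   e^{-l r}. *)
pose s0 := l / (4 * (C + 1)).
have C1 : 0 < C + 1 by lra.
have s00 : 0 < s0 by rewrite divr_gt0 // mulr_gt0.
have s0h q : cylD (snoc_pt k q) -> s0 * `|h q| <= l / 4 * (1 + q k).
  move=> cq; have q0 : 0 <= q k by case: cq.
  apply: (@le_trans _ _ (s0 * ((C + 1) * (1 + q k)))).
    rewrite ler_wpM2l ?(ltW s00) // (le_trans (hC _ cq)) // ler_wpM2r ?addr_ge0 //.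
    by rewrite lerDl.
  by rewrite /s0 le_eqVlt; apply/orP; left; apply/eqP; field; rewrite gt_eqF.
have sh s q : 0 <= s <= s0 -> cylD (snoc_pt k q) -> s * `|h q| <= l / 4 * (1 + q k).
  move=> /andP[_ ss] cq; apply: le_trans (s0h _ cq).
  by rewrite ler_wpM2r.
have mexp s : measurable_fun setT (fun q : seqT R => expR (s * h q)).
  have m1 : measurable_fun setT (fun q : seqT R => s * h q) by exact: measurable_funM.
  exact: (measurableT_comp (@measurable_expR R) m1).
have mxi y : measurable_fun setT (xiwD x y l : seqT R -> R) by exact: measurable_xiw.
have xiw0 y q : ~ cylD (snoc_pt k q) -> xiwD x y l q = 0.
  by move=> nc; rewrite /xiw /xi indicF0 ?mul0r // => -[].
have xiwe y q : xiwD x y l q <= expR (- (l * q k)).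
  by rewrite /xiw ler_piMl ?expR_ge0 // indic_le1.
have lexp y s : 0 <= s <= s0 -> lint k.+1 (fun q => xiwD x y l q * expR (s * h q)).
  move=> ss.
  apply: (lint_le _ (lintZ (expR (l / 4)) (cylw_int oDb bDb (divr_gt0 l0 (ltr0n R 2))).1)).
    exact: measurable_funM.
  move=> q; rewrite ger0_norm ?mulr_ge0 ?expR_ge0 ?xiw_ge0 //.
  have [cq|nc] := pselect (cylD (snoc_pt k q)); last by rewrite xiw0 // mul0r.
  have q0 : 0 <= q k by case: cq.
  rewrite ger0_norm ?mulr_ge0 ?expR_ge0 ?cylw_ge0 //.
  rewrite /cylw indicT1 // mul1r -expRD.
  apply: (@le_trans _ _ (expR (- (l * q k)) * expR (s * h q))).
    by rewrite ler_wpM2r ?expR_ge0.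
  rewrite -expRD ler_expR.
  have := sh s q ss cq; have : s * h q <= s * `|h q|.
    by rewrite ler_wpM2l ?ler_norm //; case/andP: ss.
  have := mulr_ge0 (ltW l0) q0; lra.
(* From h^2 <= (2 / s0^2) e^{s0 |h|}. Together with e^{|s h|} this spends two quarters of the decay,
   which leaves the parameter l/2 and the constant e^{l/2}. *)
pose K2 := 2 / s0 ^+ 2 * expR (l / 2).
have K20 : 0 <= K2 by rewrite mulr_ge0 ?expR_ge0 // divr_ge0 // sqr_ge0.
have quad s q : 0 <= s <= s0 ->
  xiwD x yA l q * expR (s * h q) <= xiwD x yA l q + s * (h q * xiwD x yA l q) +
    s ^+ 2 * K2 * cylw Db (l / 2) q.
  move=> ss.
  have [cq|nc] := pselect (cylD (snoc_pt k q)); last first.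
    by rewrite xiw0 // !mul0r mulr0 mulr0 !add0r mulr_ge0 ?cylw_ge0 // mulr_ge0 ?sqr_ge0.
  have q0 : 0 <= q k by case: cq.
  have /andP[sge0 sles0] := ss.
  have := ler_wpM2l (xiw_ge0 Db Rr x yA l q) (expR_le_quad (s * h q)).
  move=> /le_trans; apply.
  suff : xiwD x yA l q * (h q ^+ 2 * expR `|s * h q|) <= K2 * cylw Db (l / 2) q.
    move=> /(ler_wpM2l (sqr_ge0 s)); rewrite exprMn; lra.
  have hq2 : h q ^+ 2 <= 2 / s0 ^+ 2 * expR (s0 * `|h q|).
    have := @expR_ge1Dxn R (s0 * `|h q|) 1 (mulr_ge0 (ltW s00) (normr_ge0 _)).
    rewrite exprMn real_normK ?num_real // => h1.
    have h2 : s0 ^+ 2 * h q ^+ 2 <= 2 * expR (s0 * `|h q|).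
      by move: h1; rewrite (_ : (2`!)%:R = 2 :> R) //; lra.
    rewrite mulrAC ler_pdivlMr ?exprn_gt0 //; lra.
  rewrite /cylw indicT1 // mul1r.
  have e1 : expR `|s * h q| <= expR (l / 4 * (1 + q k)).
    by rewrite ler_expR normrM ger0_norm //; exact: sh.
  have e2 : h q ^+ 2 <= 2 / s0 ^+ 2 * expR (l / 4 * (1 + q k)).
    apply: le_trans hq2 _; rewrite ler_wpM2l ?divr_ge0 ?sqr_ge0 // ler_expR.
    exact: s0h.
  apply: (@le_trans _ _ (expR (- (l * q k)) * (2 / s0 ^+ 2 * expR (l / 4 * (1 + q k)) *
     expR (l / 4 * (1 + q k))))).
    apply: ler_pM => //; [exact: xiw_ge0|by rewrite mulr_ge0 ?sqr_ge0 ?expR_ge0|].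
    by apply: ler_pM => //; rewrite ?sqr_ge0 ?expR_ge0.
  rewrite -mulrA -expRD mulrCA /K2 -!mulrA ler_wpM2l // ler_wpM2l ?invr_ge0 ?sqr_ge0 //.
  by rewrite -!expRD ler_expR; lra.
have lxiw := lint_xiw oDb bDb Rr0 Dx RyA l0.
have lhx : lint k.+1 (fun q => h q * xiwD x yA l q).
  have lx1 := lint_xiw1 oDb bDb Rr0 Dx RyA l0.
  apply: (lint_le _ (lintZ C (lintD lxiw lx1))); first exact: measurable_funM.
  move=> q; have [cq|nc] := pselect (cylD (snoc_pt k q)); last first.
    by rewrite xiw0 // mulr0 normr0.
  have q0 : 0 <= q k by case: cq.
  rewrite normrM [`|xiwD _ _ _ _|]ger0_norm ?xiw_ge0 //.
  rewrite [leRHS]ger0_norm ?mulr_ge0 ?addr_ge0 ?mulr_ge0 ?xiw_ge0 //.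
  have := ler_wpM2r (xiw_ge0 Db Rr x yA l q) (hC _ cq); lra.
have lcyl := (cylw_int oDb bDb (divr_gt0 l0 (ltr0n R 2))).1.
pose A' := leb_intR k.+1 (cylw Db (l / 2)).
have A'0 : 0 <= A' by apply: leb_intR_ge0 => q; exact: cylw_ge0.
have KA0 : 0 <= K2 * A' by rewrite mulr_ge0.
(* Makes the quadratic term at most half of the linear gain -s H. *)
pose s := Num.min s0 (- H / (2 * (K2 * A' + 1))).
have s_gt0 : 0 < s.
  rewrite lt_min s00 /= divr_gt0 //; first lra.
  by rewrite mulr_gt0 // ltr_wpDl.
have ss : 0 <= s <= s0 by rewrite (ltW s_gt0) ge_min lexx.
pose Ks := leb_intR k.+1 (fun q => xiwD x yA l q * expR (s * h q)).
have KsJ : Ks < J.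
  have : Ks <= J + s * H + s ^+ 2 * K2 * A'.
    have lB := lintZ (s ^+ 2 * K2) lcyl; have lC := lintZ s lhx.
    have lAC := lintD lxiw lC.
    have -> : J + s * H + s ^+ 2 * K2 * A' = leb_intR k.+1 (fun q =>
        xiwD x yA l q + s * (h q * xiwD x yA l q) + s ^+ 2 * K2 * cylw Db (l / 2) q).
      rewrite (leb_intRD lAC lB) (leb_intRD lxiw lC) (leb_intRZ _ lhx) (leb_intRZ _ lcyl).
      by rewrite (xiw_int oDb bDb Rr0 Dx RyA l0).
    apply: le_leb_intR => [||q]; [exact: lexp|exact: lintD|exact: quad].
  have h1 : s * (2 * (K2 * A' + 1)) <= - H.
    by rewrite -ler_pdivlMr ?mulr_gt0 ?ltr_wpDl // ge_min lexx orbT.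
  have := ler_wpM2l (ltW s_gt0) h1; have := mulr_gt0 s_gt0 s_gt0.
  have : s * H < 0 by rewrite pmulr_rlt0.
  rewrite expr2; lra.
have Ks0 : 0 <= Ks.
  by apply: leb_intR_ge0 => q; rewrite mulr_ge0 ?expR_ge0 ?xiw_ge0.
pose V j := leb_intR k.+1
  (fun q => \1_(eball ((x, yA) : pt R k.+1) (Rr - j.+1%:R^-1)) (snoc_pt k q)).
pose V' := leb_intR k.+1 (fun q => \1_(eball ((x, yA) : pt R k.+1) Rr) (snoc_pt k q)).
have VV : V j @[j --> \oo] --> V' by exact: ball_volume_cvg.
pose K' := expR (l / 4).
have K'0 : 0 < K' by exact: expR_gt0.
have [j Vj] : exists j, K' * (V' - V j) <= (J - Ks) / 2.
  have e0 : 0 < (J - Ks) / 2 / K' by rewrite !divr_gt0 ?subr_gt0.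
  have /cvgrPdist_le/(_ _ e0)[j _ /(_ j (leqnn j)) /= Hj] := VV.
  exists j; rewrite mulrC -ler_pdivlMr //; exact: le_trans (ler_norm _) Hj.
(* The ratio is the midpoint between Ks/J and 1: half of the gap J - Ks is left for the mass gained
   when the hole moves. *)
exists s, ((J + Ks) / (2 * J)), j.+1%:R^-1; split => //.
- have J2 : 0 < 2 * J by exact: mulr_gt0.
  apply/andP; split; last by rewrite ltr_pdivrMr //; lra.
  apply: divr_ge0; last by apply: mulr_ge0 => //; exact: ltW.
  by apply: addr_ge0 => //; exact: ltW.
move=> y Ry yyA.
have l1 := lexp y s ss.
exists (leb_intR k.+1 (fun q => xiwD x y l q * expR (s * h q))); last first.
  by rewrite -lintP // => q; rewrite mulr_ge0 ?expR_ge0 ?xiw_ge0.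
rewrite leb_intR_ge0 /=; last by move=> q; rewrite mulr_ge0 ?expR_ge0 ?xiw_ge0.
rewrite (_ : _ / _ * J = Ks + (J - Ks) / 2); last by field; rewrite gt_eqF.
apply: (@le_trans _ _ (Ks + K' * (V' - V j))); last by rewrite lerD2l.
have lV r : r <= Rr -> lint k.+1 (fun q => \1_(eball ((x, yA) : pt R k.+1) r) (snoc_pt k q)).
  move=> rR; apply: (lint_le _ (lint_ballw (k := k) Rr0 (x, yA) 0)).
    exact: (measurable_indicS (measurable_eball _ _)).
  move=> q; rewrite !ger0_norm ?ballw_ge0 ?indic_ge0 // /ballw mul0r oppr0 expR0 mulr1.
  have [B|nB] := pselect (eball ((x, yA) : pt R k.+1) r (snoc_pt k q)).
    by rewrite indicT1 // indicT1 //; exact: lt_le_trans B rR.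
  by rewrite indicF0 // indic_ge0.
have lVj : lint k.+1 (fun q => \1_(eball ((x, yA) : pt R k.+1) (Rr - j.+1%:R^-1)) (snoc_pt k q)).
  by apply: lV; rewrite gerBl invr_ge0.
have lV' := lV Rr (lexx _).
rewrite -leb_intRB // -leb_intRZ; last exact/lintD/lintN.
rewrite -leb_intRD; [|exact: lexp|exact/lintZ/lintD/lintN].
apply: le_leb_intR => //; first by apply: lintD; [exact: lexp|exact/lintZ/lintD/lintN].
move=> q; have [cq|nc] := pselect (cylD (snoc_pt k q)); last first.
  rewrite xiw0 // mul0r xiw0 // mul0r add0r indicF0; last first.
    by move=> B; apply: nc; exact: Dbp_ball B.
  rewrite indicF0 ?subrr ?mulr0 // => B; apply: nc.
  apply: (Dbp_ball Rr0 Dx RyA); apply: lt_le_trans B _.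
  by rewrite gerBl invr_ge0.
have q0 : 0 <= q k by case: cq.
have Ee : expR (- (l * q k)) * expR (s * h q) <= K'.
  rewrite -expRD ler_expR; have := sh s q ss cq; have : s * h q <= s * `|h q|.
    by rewrite ler_wpM2l ?ler_norm // ltW.
  have := mulr_ge0 (ltW l0) q0; lra.
(* A point freed by moving the hole lies in the old ball but outside the shrunk one, which the moved
   ball still covers. *)
have xe : xi Db Rr x y (snoc_pt k q) <= xi Db Rr x yA (snoc_pt k q) +
   (\1_(eball ((x, yA) : pt R k.+1) Rr) (snoc_pt k q) -
    \1_(eball ((x, yA) : pt R k.+1) (Rr - j.+1%:R^-1)) (snoc_pt k q)).
  rewrite !xiE //.
  have [B|nB] := pselect (eball ((x, yA) : pt R k.+1) (Rr - j.+1%:R^-1) (snoc_pt k q)).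
    by rewrite [X in _ - X <= _](indicT1 (eball_shrink yyA B)) indicT1 // [\1_(eball _ (_ - _)) _]indicT1 //; lra.
  by rewrite [\1_(eball _ (_ - _)) _]indicF0 //; have := @indic_ge0 R _ (eball ((x, y) : pt R k.+1) Rr) (snoc_pt k q); lra.
have D0 : 0 <= \1_(eball ((x, yA) : pt R k.+1) Rr) (snoc_pt k q) -
    \1_(eball ((x, yA) : pt R k.+1) (Rr - j.+1%:R^-1)) (snoc_pt k q) :> R.
  rewrite subr_ge0.
  have [B|nB] := pselect (eball ((x, yA) : pt R k.+1) (Rr - j.+1%:R^-1) (snoc_pt k q)).
    rewrite indicT1 // indicT1 //; apply: lt_le_trans B _.
    by rewrite gerBl invr_ge0.
  by rewrite indicF0 // indic_ge0.
rewrite /xiw -!mulrA.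
set e := expR _ * expR _ in Ee *.
have e0 : 0 <= e by rewrite mulr_ge0 ?expR_ge0.
have := ler_wpM2r e0 xe; have := ler_wpM2r D0 Ee; lra.
Qed.

End chernoff.

(** * Velocities *)

Section sphere.
Context {R : realType}.
Local Notation mu := (@lebesgue_measure R).

Lemma unorm_ge N (z : nat -> R) i : (i < N)%N -> `|z i| <= unorm N z.
Proof.
move=> iN; rewrite /unorm -sqrtr_sqr ler_wsqrtr //.
rewrite (bigD1 (Ordinal iN)) //= lerDl.
by apply: sumr_ge0 => j _; exact: sqr_ge0.
Qed.

Lemma measurable_unorm N : measurable_fun setT (unorm N : seqT R -> R).
Proof.
have ms : measurable_fun setT (fun z : seqT R => \sum_(j < N) z j ^+ 2).
  apply: measurable_sum => j; apply: measurable_funX; exact: measurable_coord.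
exact: (measurableT_comp (continuous_measurable_fun (@sqrt_continuous R)) ms).
Qed.

(** Both sets occur in [sphere_prob]: the full ball in the denominator, the ball without its centre
    in the numerator. *)
Lemma unit_ball_volume N : (0 < N)%N -> exists2 v : R, 0 < v &
  leb_int N (fun z => (\1_([set z | unorm N z <= 1]) z)%:E) = v%:E /\
  leb_int N (fun z => (\1_([set z | 0 < unorm N z <= 1]) z)%:E) = v%:E.
Proof.
move=> N0.
pose B := [set z : seqT R | unorm N z <= 1].
pose B' := [set z : seqT R | 0 < unorm N z <= 1].
have mB : measurable_fun setT (fun z : seqT R => (\1_B z : R)).
  apply: (measurable_indicS (F := unorm N) (A := `]-oo, 1]%classic)) => //.
  rewrite -[X in measurable X]setTI; exact: measurable_unorm.
have mB' : measurable_fun setT (fun z : seqT R => (\1_B' z : R)).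
  apply: (measurable_indicS (F := unorm N) (A := `]0, 1]%classic)) => //.
  rewrite -[X in measurable X]setTI; exact: measurable_unorm.
have lB : lint N (fun z => \1_B z).
  apply: (lint_bounded ler01 (K := 1)) => // z; rewrite mul1r ger0_norm ?indic_ge0 //.
  have [Bz|nB] := pselect (B z); last by rewrite indicF0 // cube_ge0.
  rewrite cube_in ?indic_le1 // => i iN; exact: le_trans (unorm_ge z iN) Bz.
exists (leb_intR N (fun z => \1_B z)).
  (* The cube [0, 1/N]^N lies in the unit ball: N squares, each at most 1/N, sum to at most 1. *)
  pose c := (N%:R : R)^-1.
  have c0 : 0 < c by rewrite invr_gt0 ltr0n.
  have P := @leb_int_prod R N (fun=> \1_(`[0, c]%classic)) (fun=> c)
    (fun=> measurable_itv_indic _) (fun _ t => indic_ge0 _ _).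
  have Q : leb_int N (fun q => (\prod_(i < N) \1_(`[0, c]%classic) (q i))%:E) =
      (\prod_(i < N) c)%:E.
    apply: P => _; rewrite integral_indic // setIT /= lebesgue_measure_itv /= lte_fin c0.
    by rewrite -EFinB subr0.
  rewrite -lte_fin -lintP //.
  apply: (@lt_le_trans _ _ (\prod_(i < N) c)%:E); first by rewrite lte_fin prodr_gt0.
  rewrite -Q; apply: le_leb_int => z; first by rewrite lee_fin prodr_ge0.
  rewrite lee_fin.
  have [zc|/existsNP[i /not_implyP[iN zi]]] :=
    pselect (forall i, (i < N)%N -> 0 <= z i <= c); last first.
    by rewrite (bigD1 (Ordinal iN)) //= indicF0 ?mul0r ?indic_ge0.
  have -> : \1_B z = 1 :> R.
    apply: indicT1; rewrite /B /= /unorm -[leRHS]sqrtr1 ler_wsqrtr //.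
    apply: (@le_trans _ _ (\sum_(i < N) c)).
      apply: ler_sum => i _; have /andP[z0 z1] := zc i (ltn_ord i).
      rewrite expr2 (le_trans (ler_pM z0 z0 z1 z1)) // ler_piMr ?(ltW c0) //.
      by rewrite /c invf_le1 ?ltr0n // ler1n.
    by rewrite sumr_const card_ord /c -[c *+ N]mulr_natr mulVf ?pnatr_eq0 -?lt0n.
  by apply: prodr_ile1 => i _; exact: indic01.
split; first by rewrite -lintP.
rewrite -lintP //; apply/eqP; rewrite eq_le; apply/andP; split.
  apply: le_leb_int => z; rewrite lee_fin //.
  have [Bz|nB] := pselect (B' z); last by rewrite indicF0 // indic_ge0.
  by rewrite indicT1 // indicT1 //; case/andP: Bz.
(* The centre lies in the null box {0} x [-1, 1]^{N-1}. *)
pose phi (i : nat) : R -> R := if i == 0 then \1_[set 0] else \1_(`[- 1, 1]%classic).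
have Q : leb_int N (fun q => (\prod_(i < N) phi i (q i))%:E) =
  (\prod_(i < N) (if i == 0 :> nat then 0 else 1 - - 1))%:E.
  apply: (@leb_int_prod R N phi (fun i => if i == 0 :> nat then 0 else 1 - - 1)).
  - move=> i; rewrite /phi; case: ifP => _; last exact: measurable_itv_indic.
    by apply/measurable_indicP; exact: measurable_set1.
  - by move=> i t; rewrite /phi; case: ifP => _; exact: indic_ge0.
  - move=> i; rewrite /phi; case: ifP => _; rewrite integral_indic // setIT /=.
      exact: lebesgue_measure_set1.
    rewrite lebesgue_measure_itv /= lte_fin ifT //; lra.
have Q0 : (\prod_(i < N) (if i == 0 :> nat then 0 else 1 - - 1)) = 0 :> R.
  by rewrite (bigD1 (Ordinal N0)) //= mul0r.
rewrite Q0 in Q.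
have mphi : measurable_fun setT (fun q : seqT R => (\prod_(i < N) phi i (q i))%:E).
  apply: measurable_EFinS; apply: measurable_prod => i _.
  have mi : measurable_fun setT (phi i).
    rewrite /phi; case: ifP => _; last exact: measurable_itv_indic.
    by apply/measurable_indicP; exact: measurable_set1.
  exact: (measurableT_comp mi (measurable_coord i)).
have phi0 q : 0 <= \prod_(i < N) phi i (q i).
  by apply: prodr_ge0 => i _; rewrite /phi; case: ifP => _; exact: indic_ge0.
have -> : leb_int N (fun z => (\1_B' z)%:E) = leb_int N (fun z =>
    (\1_B' z)%:E + (\prod_(i < N) phi i (z i))%:E)%E.
  rewrite leb_intD; [by rewrite Q adde0|exact: measurable_EFinS|exact: mphi| |].
    by move=> q; rewrite lee_fin indic_ge0.
  by move=> q; rewrite lee_fin.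
apply: le_leb_int => z; rewrite ?lee_fin //.
have [Bz|nB] := pselect (B z); last first.
  by rewrite indicF0 // addr_ge0 // indic_ge0.
have [z0|z0] := ltP 0 (unorm N z).
  have B'z : B' z by rewrite /B' /= z0.
  by rewrite (indicT1 Bz) (indicT1 B'z) lerDl.
have zi i : (i < N)%N -> z i = 0.
  by move=> iN; apply/eqP; rewrite -normr_le0; exact: le_trans (unorm_ge z iN) z0.
rewrite (indicT1 Bz) (_ : \prod_(i < N) _ = 1) ?lerDr ?indic_ge0 //.
rewrite big1 // => i _; rewrite zi // /phi; case: ifP => _; rewrite indicT1 //=.
by rewrite in_itv /=; apply/andP; split; lra.
Qed.

(** The event ignores the direction of the velocities, so the ratio is 1 or 0; the velocities
    disappear from here on. *)
Lemma sphere_prob_position d n (m M g E : R) (p : nat -> R) (P : set (nat -> R)) :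
  (0 < d)%N -> sphere_prob d n m M g E p (fun p _ => P p) = \1_P p.
Proof.
move=> d0; have N0 : (0 < n.+1 * d)%N by rewrite muln_gt0.
have [v v0 [H1 H2]] := unit_ball_volume N0.
rewrite /sphere_prob H1.
have [Pp|nP] := pselect (P p).
  rewrite (indicT1 Pp) (_ : leb_int _ _ = v%:E) /= ?divff ?gt_eqF // -H2.
  apply: eq_leb_int => z; congr (EFin (\1_ _ _)).
  by apply/seteqP; split => w /=; tauto.
rewrite (indicF0 nP) (_ : leb_int _ _ = 0%:E) /= ?mul0r // -(leb_int0 (n.+1 * d)).
by apply: eq_leb_int => z; rewrite indicF0 //= => -[].
Qed.

End sphere.

(** * Positions and the uniform marginal *)

Section positions.
Context {R : realType} {k : nat}.
Variables (Db : set 'rV[R]_k) (Rr m M g E : R).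
Hypotheses (oDb : open Db) (bDb : bounded_set Db) (Rr0 : 0 < Rr).
Local Notation mu := (@lebesgue_measure R).
Local Notation d := k.+1.
Local Notation xiD := (xi Db Rr).
Implicit Types (x : 'rV[R]_k) (y t l : R) (p q u v : nat -> R) (n : nat).

Definition chi n x y u : R := \prod_(i < n) xiD x y (snoc_pt k (block d i u)).

(** The indicator is the energy constraint; the real power alone does not vanish at negative
    energies. *)
Definition wgt n (e : R) : R :=
  \1_(`[0, +oo[%classic) e * e `^ (((n.+1 * d)%:R - 2) / 2).

(** Energy left for motion; the height of the heavy ball is a separate argument since [u] stands for
    the light coordinates only. *)
Definition avail n u y : R :=
  E - (\sum_(i < n) m / n%:R * g * u (i * d + k)%N + M * g * y).

Lemma chi_ge0 n x y u : 0 <= chi n x y u.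
Proof. by apply: prodr_ge0 => i _; exact: indic_ge0. Qed.

Lemma measurable_chi n x y : measurable_fun setT (chi n x y : seqT R -> R).
Proof.
apply: measurable_prod => i _.
exact: (measurableT_comp (measurable_xi Rr oDb x y) (measurable_block _ _)).
Qed.

Lemma wgt_ge0 n e : 0 <= wgt n e.
Proof. by rewrite mulr_ge0 ?indic_ge0 // powR_ge0. Qed.

Lemma snoc_block n p i : snoc_pt k (block d i p) = (lx d n p i, ly d n p i).
Proof.
rewrite /snoc_pt /lx /ly /block ltnSn; congr pair.
by apply/rowP => j; rewrite !mxE ltnW // ltnS ltn_ord.
Qed.

Lemma posdensE n p : posdens d n Db Rr m M g E p =
  \1_(Dbp (d := d) Db Rr) (hx d n p) * \1_(`[Rr, +oo[%classic) (hy d n p) *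
  chi n (hx d n p) (hy d n p) p * wgt n (avail n p (hy d n p)).
Proof.
rewrite /posdens /wgt mulrA.
set S := [set p | _]; set w := _ `^ _; congr (_ * w).
have [Dx|nDx] := pselect (Dbp (d := d) Db Rr (hx d n p)); last first.
  by rewrite (indicF0 nDx) !mul0r indicF0 // => -[[]].
have [Ry|nRy] := leP Rr (hy d n p); last first.
  rewrite [\1_(`[Rr, +oo[%classic) _]indicF0 ?mulr0 ?mul0r; last first.
    by rewrite /= in_itv /= andbT leNgt nRy.
  by rewrite indicF0 // => -[[_ _]]; rewrite leNgt nRy.
have [D|/existsNP[i /not_implyP[iN nDi]]] := pselect (forall i, (i < n)%N ->
   (cyl (d := d) Db `\` eball ((hx d n p, hy d n p) : pt R d) Rr)
     (lx d n p i, ly d n p i)); last first.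
  rewrite /chi (bigD1 (Ordinal iN)) //= (snoc_block n) /xi (indicF0 nDi) mul0r mulr0 mul0r.
  by rewrite indicF0 // => -[[H _ _] _]; apply: nDi; have [] := H i iN.
have -> : chi n (hx d n p) (hy d n p) p = 1.
  by rewrite /chi big1 // => i _; rewrite (snoc_block n) /xi indicT1 //; exact: D.
rewrite (indicT1 Dx) [\1_(`[Rr, +oo[%classic) _]indicT1; last first.
  by rewrite /= in_itv /= andbT.
rewrite !mul1r; have [pE|pE] := leP (potE d n m M g p) E.
  rewrite indicT1; last first.
    split => //; split => // i iN; have Di := D i iN; split => //.
      by case: Di => -[].
    by case: Di => -[].
  by rewrite indicT1 // /= in_itv /= andbT subr_ge0.
rewrite indicF0; last by move=> -[_]; rewrite leNgt pE.
by rewrite indicF0 //= in_itv /= andbT subr_ge0 leNgt; apply/negP; rewrite negbK.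
Qed.

Lemma hx_setx n x p : hx d n (setx d n x p) = x.
Proof.
apply/rowP => j; rewrite mxE /setx.
have -> : (n * d < n * d + 1 + j < n * d + d)%N.
  by rewrite addn1 addSn ltnS leq_addr addnS ltnS ltn_add2l ltn_ord.
by rewrite -addnA addKn add1n subn1 /= rvnth_ord.
Qed.

(* Light coordinates [u], heavy particle at [(x, y)]. *)
Definition cfg n x y u : nat -> R :=
  setx d n x (merge (n * d) u (upd (fun=> 0) 0 y)).

Lemma cfg_hy n x y u : hy d n (cfg n x y u) = y.
Proof. by rewrite /hy /cfg /setx ltnn /= /merge ltnn subnn /upd. Qed.

Lemma cfg_hx n x y u : hx d n (cfg n x y u) = x.
Proof. exact: hx_setx. Qed.

Lemma cfg_lt n x y u i : (i < n * d)%N -> cfg n x y u i = u i.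
Proof.
move=> ind; rewrite /cfg /setx /merge ind.
by rewrite ltnNge (ltnW ind).
Qed.

Lemma cfg_block n x y u i : (i < n)%N -> block d i (cfg n x y u) = block d i u.
Proof.
move=> iN; apply/funext => j; rewrite /block; case: ltnP => // jd.
by rewrite cfg_lt // block_index_lt.
Qed.

Lemma cfg_chi n x y u x' y' : chi n x' y' (cfg n x y u) = chi n x' y' u.
Proof. by apply: eq_bigr => i _; rewrite cfg_block. Qed.

Lemma cfg_avail n x y u y' : avail n (cfg n x y u) y' = avail n u y'.
Proof.
congr (_ - (_ + _)); apply: eq_bigr => i _; congr (_ * _).
by rewrite cfg_lt // block_index_lt.
Qed.

(** The light particles integrated out at a fixed position of the ball. [Q] is an arbitrary set:
    bounds rest on monotonicity of [leb_int]. *)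
Definition inner n x y (Q : set (nat -> R)) : \bar R :=
  leb_int (n * d) (fun u => (chi n x y u * wgt n (avail n u y) * \1_Q u)%:E).

(* The unnormalised conditional law given [X_{n+1} = x]. *)
Definition Tc n x (P : set (nat -> R)) : \bar R :=
  leb_int (n * d + 1) (fun p =>
    (posdens d n Db Rr m M g E (setx d n x p) * \1_P (setx d n x p))%:E).

Lemma TcE n x P : Dbp (d := d) Db Rr x -> Tc n x P =
  (\int[mu]_y (if (Rr <= y)%R then inner n x y [set u | P (cfg n x y u)] else 0%:E))%E.
Proof.
move=> Dx; rewrite /Tc leb_int_cat leb_intS; apply: eq_integral => y _.
rewrite [LHS]/=; case: ifP => [Ry|/negbT Ry].
  apply: eq_leb_int => u; congr EFin.
  rewrite -/(cfg n x y u) posdensE cfg_hx cfg_hy (indicT1 Dx) mul1r.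
  rewrite [\1_(`[Rr, +oo[%classic) _]indicT1 ?mul1r; last by rewrite /= in_itv /= andbT.
  rewrite cfg_chi cfg_avail; congr (_ * _).
transitivity (leb_int (n * d) (fun _ : seqT R => 0%:E)); last exact: leb_int0.
apply: eq_leb_int => u; congr EFin.
rewrite -/(cfg n x y u) posdensE cfg_hx cfg_hy [\1_(`[Rr, +oo[%classic) _]indicF0.
  by rewrite mulr0 !mul0r.
by rewrite /= in_itv /= andbT; apply/negP.
Qed.

Lemma lint_section c t : lint k (fun u => \1_(eball (c : pt R d) Rr) (snoc_pt k (upd u k t))).
Proof.
pose C := \sum_(j < k) `|c.1 0 j| + Rr.
have S0 : 0 <= \sum_(j < k) `|c.1 0 j| by apply: sumr_ge0.
have C0 : 0 <= C by rewrite addr_ge0 // ltW.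
have mB : measurable_fun setT (fun u : seqT R =>
    \1_(eball (c : pt R d) Rr) (snoc_pt k (upd u k t)) : R).
  apply: (measurable_indicS (F := fun u => snoc_pt k (upd u k t))).
  have mup : measurable_fun setT (fun u : seqT R => upd u k t : seqT R).
    apply: measurable_seqP => i; rewrite /upd; case: (i == k) => //.
    exact: measurable_coord.
  by rewrite -[X in measurable X]setTI; exact: (mup measurableT _ (measurable_eball c Rr)).
apply: (lint_bounded C0 (K := 1)) => // u; rewrite mul1r ger0_norm ?indic_ge0 //.
have [B|nB] := pselect (eball (c : pt R d) Rr (snoc_pt k (upd u k t))); last first.
  by rewrite indicF0 // cube_ge0.
rewrite cube_in ?indic_le1 // => i ik; have [_ /(_ (Ordinal ik))] := eball_coord Rr0 B.
rewrite /= /upd ltn_eqF // => H.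
rewrite -(subrK (c.1 0 (Ordinal ik)) (u i)) (le_trans (ler_normD _ _)) // /C [leRHS]addrC lerD ?(ltW H) //.
by rewrite (bigD1 (Ordinal ik)) //= lerDl sumr_ge0.
Qed.

Lemma section_cyl u t : \1_(cyl (d := d) Db) (snoc_pt k (upd u k t)) =
  \1_(`[0, +oo[%classic) t * \1_Db (\row_(j < k) u j) :> R.
Proof.
rewrite cyl_snoc mulrC /upd eqxx; congr (_ * \1_Db _).
by apply/rowP => j; rewrite !mxE ltn_eqF.
Qed.

(** Translation by [x] carries the section of the ball at height [t] from the one about the vertical
    axis, and it stays inside the section of the cylinder; hence the right-hand side is free of
    [x]. *)
Lemma xi_section_int x y t : Dbp (d := d) Db Rr x -> Rr <= y ->
  leb_int k (fun u => (xiD x y (snoc_pt k (upd u k t)))%:E) =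
  (leb_intR k (fun u => \1_(cyl (d := d) Db) (snoc_pt k (upd u k t))) -
   leb_intR k (fun u => \1_(eball ((0, y) : pt R d) Rr) (snoc_pt k (upd u k t))))%:E.
Proof.
move=> Dx Ry.
have lc : lint k (fun u => \1_(cyl (d := d) Db) (snoc_pt k (upd u k t))).
  rewrite (_ : (fun u => _) =
    (fun u => \1_(`[0, +oo[%classic) t * \1_Db (\row_(j < k) u j))).
    exact/lintZ/lint_base.
  by apply/funext => u; rewrite section_cyl.
have lb := lint_section (x, y) t.
have -> : leb_intR k (fun u => \1_(eball ((0, y) : pt R d) Rr) (snoc_pt k (upd u k t))) =
    leb_intR k (fun u => \1_(eball ((x, y) : pt R d) Rr) (snoc_pt k (upd u k t))).
  rewrite -[RHS](leb_intR_shift k (rvnth x)); last exact: lb.1.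
  congr leb_intR; apply/funext => u; rewrite !indicE; congr (nat_of_bool _)%:R.
  apply/idP/idP; rewrite !inE /eball /= !edist_lt //= /upd eqxx;
  rewrite (eq_bigr (fun j : 'I_k => (u j) ^+ 2)).
  - move=> H; rewrite (eq_bigr (fun j : 'I_k => (u j) ^+ 2)) // => j _.
    by rewrite ltn_eqF // ltn_ord rvnth_ord addrK.
  - by move=> j _; rewrite ltn_eqF // mxE subr0.
  - move=> H; rewrite (eq_bigr (fun j : 'I_k => (u j) ^+ 2)) // => j _.
    by rewrite ltn_eqF // mxE subr0.
  - by move=> j _; rewrite ltn_eqF // ltn_ord rvnth_ord addrK.
rewrite -leb_intRB // -lintP; [|by apply: lintD => //; exact: lintN|].
  by apply: eq_leb_int => u; rewrite xiE.
by move=> u; rewrite -(xiE Rr0 _ Dx Ry) indic_ge0.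
Qed.

Lemma leb_int_xi_indep x x' y (Psi : R -> \bar R) :
  Dbp (d := d) Db Rr x -> Dbp (d := d) Db Rr x' -> Rr <= y ->
  (forall t, (0 <= Psi t)%E) ->
  leb_int d (fun q => ((xiD x y (snoc_pt k q))%:E * Psi (q k))%E) =
  leb_int d (fun q => ((xiD x' y (snoc_pt k q))%:E * Psi (q k))%E).
Proof.
move=> Dx Dx' Ry Psi0; rewrite !leb_intS; apply: eq_integral => t _.
have mxi z : measurable_fun setT (fun u : seqT R => (xiD z y (snoc_pt k (upd u k t)))%:E).
  apply: (@measurable_comp_upd R k (fun q => (xiD z y (snoc_pt k q))%:E)).
  by apply: measurable_EFinS; exact: measurable_xi.
have S z : leb_int k (fun u => ((xiD z y (snoc_pt k (upd u k t)))%:E * Psi (upd u k t k))%E) =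
   (Psi t * leb_int k (fun u => (xiD z y (snoc_pt k (upd u k t)))%:E))%E.
  rewrite -leb_intZl //; last by move=> u; rewrite lee_fin indic_ge0.
  by apply: eq_leb_int => u; rewrite muleC /upd eqxx.
by rewrite !S !xi_section_int.
Qed.

Definition heights n u : nat -> R := fun i => if (i < n)%N then u (i * d + k)%N else 0.

(** The last particle is peeled off and its height frozen as a coordinate of [Phi]; given that
    height, its horizontal section has the same volume for [x] and [x']. *)
Lemma leb_int_chi_indep n x x' y (Phi : seqT R -> \bar R) :
  Dbp (d := d) Db Rr x -> Dbp (d := d) Db Rr x' -> Rr <= y ->
  measurable_fun setT Phi -> (forall q, (0 <= Phi q)%E) ->
  leb_int (n * d) (fun u => ((chi n x y u)%:E * Phi (heights n u))%E) =
  leb_int (n * d) (fun u => ((chi n x' y u)%:E * Phi (heights n u))%E).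
Proof.
move=> Dx Dx' Ry; elim: n Phi => [|n IH] Phi mPhi Phi0.
  by rewrite mul0n /= /chi !big_ord0.
rewrite mulSnr !leb_int_cat.
have mh : measurable_fun setT (heights n : seqT R -> seqT R).
  apply: measurable_seqP => i; rewrite /heights; case: (i < n)%N => //.
  exact: measurable_coord.
have mxi z : measurable_fun setT (fun u : seqT R => chi n z y u) by exact: measurable_chi.
pose Psi z t := leb_int (n * d) (fun u => ((chi n z y u)%:E * Phi (upd (heights n u) n t))%E).
have S z : leb_int d (fun v => leb_int (n * d) (fun u =>
    ((chi n.+1 z y (merge (n * d) u v))%:E * Phi (heights n.+1 (merge (n * d) u v)))%E)) =
  leb_int d (fun v => ((xiD z y (snoc_pt k v))%:E * Psi z (v k))%E).
  apply: leb_int_supp => v v0; rewrite /Psi -leb_intZl.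
  - apply: eq_leb_int => u.
    have -> : chi n.+1 z y (merge (n * d) u v) = xiD z y (snoc_pt k v) * chi n z y u.
      rewrite /chi big_ord_recr /= block_merge_last block0_supp // mulrC; congr (_ * _).
      by apply: eq_bigr => i _; rewrite block_merge_lt.
    rewrite EFinM -muleA; congr (_ * (_ * Phi _))%E.
    apply/funext => i; rewrite /heights /upd /merge ltnS leq_eqVlt.
    case: eqVneq => [->|ine] /=; first by rewrite ltnNge leq_addr /= addKn.
    by case: ifP => // iN; rewrite block_index_lt.
  - apply: emeasurable_funM; first exact: measurable_EFinS (mxi z).
    exact: (measurableT_comp (measurable_comp_upd n (v k) mPhi) mh).
  - by move=> u; rewrite mule_ge0 // lee_fin chi_ge0.
  - by rewrite lee_fin indic_ge0.
rewrite !S (leb_int_xi_indep (x' := x') Dx Dx' Ry); last first.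
  by move=> t; apply: leb_int_ge0 => u; rewrite mule_ge0 // lee_fin chi_ge0.
apply: eq_leb_int => v; congr (_ * _)%E.
apply: (IH (fun q => Phi (upd q n (v k)))) => //.
exact: measurable_comp_upd.
Qed.

Lemma Tc_indep n x x' (P : set (nat -> R)) (Y : set R) :
  Dbp (d := d) Db Rr x -> Dbp (d := d) Db Rr x' ->
  (forall z y u, P (cfg n z y u) <-> Y y) -> Tc n x P = Tc n x' P.
Proof.
move=> Dx Dx' HP; rewrite !TcE //; apply: eq_integral => y _; case: ifP => // Ry.
pose Phi (h : seqT R) : \bar R :=
  (wgt n (E - (\sum_(i < n) m / n%:R * g * h i + M * g * y)) * \1_Y y)%:E.
have S z : inner n z y [set u | P (cfg n z y u)] =
    leb_int (n * d) (fun u => ((chi n z y u)%:E * Phi (heights n u))%E).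
  apply: eq_leb_int => u; rewrite -EFinM -mulrA; congr (_ * (wgt n _ * _))%:E.
    congr (_ - (_ + _)); apply: eq_bigr => i _; congr (_ * _).
    by rewrite /heights ltn_ord.
  rewrite !indicE; congr (nat_of_bool _)%:R; apply/idP/idP; rewrite !inE /= => H.
    exact/(HP z y u).
  exact/(HP z y u).
rewrite !S; apply: leb_int_chi_indep => //; last first.
  by move=> h; rewrite lee_fin mulr_ge0 ?wgt_ge0 ?indic_ge0.
apply: measurable_EFinS; apply: measurable_funM => //.
have me : measurable_fun setT (fun h : seqT R =>
    E - (\sum_(i < n) m / n%:R * g * h i + M * g * y)).
  apply: measurable_funB => //; apply: measurable_funD => //.
  apply: measurable_sum => i; apply: measurable_funM => //; exact: measurable_coord.
have mw : measurable_fun setT (wgt n).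
  apply: measurable_funM; first exact: measurable_itv_indic.
  exact: measurable_powR.
exact: (measurableT_comp mw me).
Qed.

End positions.

Lemma lebesgue_integralZl (R : realType) (f : R -> R) (c : R) :
  measurable_fun setT f -> (forall t, 0 <= f t) -> 0 <= c ->
  (\int[@lebesgue_measure R]_t (c%:E * (f t)%:E) =
   c%:E * \int[@lebesgue_measure R]_t (f t)%:E)%E.
Proof.
move=> mf f0 c0; apply: ge0_integralZl => //.
- exact/measurable_EFinP.
- by move=> t _; rewrite lee_fin.
Qed.

(** * Marginal law of the horizontal position *)

Section marginals.
Context {R : realType} {k : nat}.
Variables (Db : set 'rV[R]_k) (Rr m M g E : R).
Hypotheses (oDb : open Db) (bDb : bounded_set Db) (Rr0 : 0 < Rr).
Local Notation mu := (@lebesgue_measure R).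
Local Notation d := k.+1.
Local Notation Dbp := (Dbp (d := d) Db Rr).
Local Notation Tc := (Tc Db Rr m M g E).
Implicit Types (x : 'rV[R]_k) (y t l : R) (p q u v : nat -> R) (n : nat).

(** Exhibits [Dbp] as [Db] minus the open balls of radius [Rr] about the points outside [Db], hence
    as a difference of two open sets. *)
Lemma DbpP x : Dbp x <-> Db x /\ forall z, ~ Db z -> Rr ^+ 2 <= \sum_(j < k) (z 0 j - x 0 j) ^+ 2.
Proof.
split=> [Dx|[Dx H]].
  split=> [|z nDz]; first by case: Dx.
  rewrite leNgt; apply/negP => zR; apply: nDz.
  have [] // := @Dbp_ball _ _ Db Rr Rr0 x Rr Dx (lexx _) (z, Rr).
  by rewrite /eball /= edist_lt_pt //= subrr expr0n addr0.
split => // y Ry z; rewrite /eball /= edist_lt_pt //= => zB.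
have S0 : 0 <= \sum_(j < k) (z.1 0 j - x 0 j) ^+ 2 by apply: sumr_ge0 => j _; exact: sqr_ge0.
have Dz : Db z.1.
  apply: contrapT => /H; rewrite leNgt => /negP; apply; apply: le_lt_trans zB.
  by rewrite lerDl sqr_ge0.
split => //; rewrite leNgt; apply/negP => z0.
have zy : Rr <= y - z.2 by rewrite lerBrDr (le_trans _ (ltW Ry)) // gerDl ltW.
have : Rr ^+ 2 <= (z.2 - y) ^+ 2.
  rewrite -[(z.2 - y) ^+ 2]sqrrN opprB ler_pXn2r // nnegrE ?ltW //.
  exact: lt_le_trans zy.
by rewrite leNgt => /negP; apply; apply: le_lt_trans zB; rewrite lerDr.
Qed.

Lemma measurable_Dbp : measurable [set q : seqT R | Dbp (\row_(j < k) q j)].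
Proof.
pose U := \bigcup_(z in ~` Db) [set x : 'rV[R]_k | \sum_(j < k) (z 0 j - x 0 j) ^+ 2 < Rr ^+ 2].
have oU : open U.
  apply: bigcup_open => z _.
  have cz : continuous (fun x : 'rV[R]_k => \sum_(j < k) (z 0 j - x 0 j) ^+ 2).
    apply: continuous_big => [|j _ x]; first exact: add_continuous.
    apply: (@cvg_comp _ _ _ (fun w : 'rV[R]_k => z 0 j - w 0 j) (fun t : R => t ^+ 2)
      _ (nbhs (z 0 j - x 0 j))); last exact: exprn_continuous.
    apply: (@continuousB _ _ _ (fun=> z 0 j) (fun w : 'rV[R]_k => w 0 j)).
      exact: cst_continuous.
    exact: coord_continuous.
  rewrite (_ : [set x | _] = (fun x : 'rV[R]_k => \sum_(j < k) (z 0 j - x 0 j) ^+ 2) @^-1`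
     `]-oo, (Rr ^+ 2)[%classic).
    by apply: open_comp => // x _; exact: cz.
  by apply/seteqP; split => x /=; rewrite in_itv.
rewrite (_ : [set q | _] = [set q : seqT R | Db (\row_(j < k) q j)] `\`
    [set q : seqT R | U (\row_(j < k) q j)]).
  by apply: measurableD; exact: measurable_open_row.
apply/seteqP; split => q /=.
  move=> /DbpP[Dq H]; split => // -[z nDz /=]; rewrite ltNge => /negP; apply.
  exact: H.
move=> [Dq nU]; apply/DbpP; split => // z nDz; rewrite leNgt; apply/negP => zR.
by apply: nU; exists z.
Qed.

Lemma Tc0 n x P : ~ Dbp x -> Tc n x P = 0%:E.
Proof.
move=> nD; rewrite -(leb_int0 (n * d + 1)); apply: eq_leb_int => p.
by rewrite posdensE // hx_setx (indicF0 nD) !mul0r.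
Qed.

(** The coordinates of X_{n+1} come last in the encoding, so they are integrated outermost, and the
    inner integral is [Tc]. *)
Lemma leb_int_posdens n (P : set (nat -> R)) :
  leb_int (n.+1 * d) (fun p => (posdens d n Db Rr m M g E p * \1_P p)%:E) =
  leb_int k (fun v => Tc n (\row_(j < k) v j) P).
Proof.
have -> : (n.+1 * d = (n * d + 1) + k)%N by rewrite mulSnr -addnA add1n.
rewrite leb_int_cat; apply: leb_int_supp => v v0; apply: leb_int_supp => u u0.
suff -> : merge (n * d + 1) u v = setx d n (\row_(j < k) v j) u by [].
apply/funext => i; rewrite /merge /setx addn1 ltnS.
case: leqP => //= lti.
case: ltnP => [ltid|leid].
  have ik : (i - n * d - 1 < k)%N.
    by rewrite -subnDA addn1 ltn_subLR // addSn -addnS.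
  by rewrite (rvnth_ord _ (Ordinal ik)) mxE /= -subnDA addn1.
rewrite u0 ?v0 //; last by rewrite addn1.
by rewrite leq_subRL // addSn -addnS.
Qed.

(** [Tc] is constant for [x] in [P0] and [Dbp], and 0 elsewhere. [Y = setT] gives the marginal of X;
    [P0 = setT] reduces the law of the height to one fixed [x]. *)
Lemma leb_int_posdens_prod n xt (P : set (nat -> R)) (P0 : set 'rV[R]_k) (Y : set R) (z : R) :
  Dbp xt -> measurable [set q : seqT R | P0 (\row_(j < k) q j)] ->
  (forall x y u, P (cfg (k := k) n x y u) <-> P0 x /\ Y y) ->
  Tc n xt [set p | Y (hy d n p)] = z%:E ->
  leb_int (n.+1 * d) (fun p => (posdens d n Db Rr m M g E p * \1_P p)%:E) =
  (z * lebk k (P0 `&` Dbp))%:E.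
Proof.
move=> Dxt mP0 HP Hz; rewrite leb_int_posdens.
have mI : measurable_fun setT (fun v : seqT R => \1_(P0 `&` Dbp) (\row_(j < k) v j) : R).
  apply: (measurable_indicS (F := fun v => \row_(j < k) v j)).
  by apply: measurableI => //; exact: measurable_Dbp.
have lI : lint k (fun v => \1_(P0 `&` Dbp) (\row_(j < k) v j)).
  apply: (lint_le mI (lint_base oDb bDb)) => v.
  rewrite !ger0_norm ?indic_ge0 //.
  have [[Pv Dv]|nI] := pselect ((P0 `&` Dbp) (\row_(j < k) v j)); last first.
    by rewrite indicF0 // indic_ge0.
  by rewrite indicT1 // indicT1 //; case: Dv.
have z0 : (0 <= z%:E)%E.
  rewrite -Hz; apply: leb_int_ge0 => p; rewrite lee_fin.
  by rewrite mulr_ge0 ?indic_ge0 // mulr_ge0 ?indic_ge0 // powR_ge0.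
rewrite EFinM -[(lebk _ _)%:E](lintP lI); last by move=> v; exact: indic_ge0.
rewrite -leb_intZl //; last exact: (measurable_EFinS mI).
apply: eq_leb_int => v; set x := \row_(j < k) v j.
have [Dx|nD] := pselect (Dbp x); last by rewrite Tc0 // indicF0 ?mule0 // => -[].
have [Px|nP] := pselect (P0 x); last first.
  rewrite indicF0 ?mule0; last by move=> [].
  rewrite TcE // integral0_eq // => y _; case: ifP => // _.
  transitivity (leb_int (n * d) (fun _ : seqT R => 0%:E)); last exact: leb_int0.
  apply: eq_leb_int => u; congr EFin.
  by rewrite indicF0 ?mulr0 //= => /HP[].
rewrite indicT1 // mule1 -Hz -(@Tc_indep _ _ Db Rr m M g E oDb bDb Rr0 n x xt _ Y) //; last first.
  by move=> w y u /=; rewrite cfg_hy.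
rewrite !TcE //; apply: eq_integral => y _; case: ifP => // _.
apply: eq_leb_int => u; congr (_ * _)%:E; rewrite !indicE; congr (nat_of_bool _)%:R.
apply/idP/idP; rewrite !inE /= cfg_hy => H; first by have [] := (HP x y u).1 H.
exact: ((HP x y u).2 (conj Px H)).
Qed.

Hypotheses (k0 : (0 < k)%N) (m0 : 0 < m) (M0 : 0 < M) (g0 : 0 < g).

Lemma exponent_ge0 n : 0 <= ((n.+1 * d)%:R - 2) / 2 :> R.
Proof.
rewrite divr_ge0 // subr_ge0 ler_nat (leq_trans (_ : 2 <= 1 * d)%N) ?mul1n //.
by rewrite mulSn leq_addr.
Qed.

(** Below height h, points of the ball are within horizontal distance sqrt(2 Rr h) of its axis,
    hence in a box of side 2s; at most this box is lost from the layer. *)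
Lemma low_layer_mass x y (s h : R) : Dbp x -> Rr <= y -> 0 < h -> h <= Rr -> 0 <= s ->
  2 * Rr * h <= s ^+ 2 ->
  exists2 K : R, h * (lebk k Db - (2 * s) ^+ k) <= K &
    leb_int d (fun v => (xi Db Rr x y (snoc_pt k v) * \1_(`[0, h]%classic) (v k))%:E) = K%:E.
Proof.
move=> Dx Ry h0 hR s0 hs.
pose f v := xi Db Rr x y (snoc_pt k v) * \1_(`[0, h]%classic) (v k).
have mxi : measurable_fun setT (fun v : seqT R => xi Db Rr x y (snoc_pt k v)).
  exact: measurable_xi.
have mh : measurable_fun setT (fun v : seqT R => \1_(`[0, h]%classic) (v k) : R).
  exact: (measurableT_comp (measurable_itv_indic _) (measurable_coord k)).
have f0 v : 0 <= f v by rewrite mulr_ge0 ?indic_ge0.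
have lf : lint d f.
  apply: (lint_le _ (lintZ (expR h) (lint_xiw oDb bDb Rr0 Dx Ry ltr01))).
    exact: measurable_funM.
  move=> v; rewrite !ger0_norm ?mulr_ge0 ?expR_ge0 ?xiw_ge0 ?indic_ge0 //.
  rewrite /f /xiw mulrCA ler_wpM2l ?indic_ge0 // -expRD mul1r.
  have [vh|nv] := pselect (`[0, h]%classic (v k)); last by rewrite indicF0 // expR_ge0.
  rewrite indicT1 // -expR0 ler_expR subr_ge0.
  by move: vh; rewrite /= in_itv /= => /andP[].
exists (leb_intR d f); last by rewrite lintP.
pose phi i : R -> R := if (i < k)%N then \1_(`[rvnth x i - s, rvnth x i + s]%classic)
  else \1_(`[0, h]%classic).
have Q : leb_int d (fun v => (\prod_(i < d) phi i (v i))%:E) =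
    (\prod_(i < d) (if (i < k)%N then 2 * s else h))%:E.
  apply: (@leb_int_prod R d phi (fun i => if (i < k)%N then 2 * s else h)).
  - by move=> i; rewrite /phi; case: ifP => _; exact: measurable_itv_indic.
  - by move=> i t; rewrite /phi; case: ifP => _; exact: indic_ge0.
  - move=> i; rewrite /phi; case: ifP => _; rewrite integral_indic // setIT /= lebesgue_measure_itv /= lte_fin.
      case: ifP => [_|/negbT]; first by rewrite -EFinB; congr EFin; ring.
      by rewrite -leNgt => ss; congr EFin; lra.
    by rewrite h0 -EFinB subr0.
have QE : \prod_(i < d) (if (i < k)%N then 2 * s else h) = h * (2 * s) ^+ k.
  rewrite big_ord_recr /= ltnn mulrC; congr (_ * _).
  rewrite (eq_bigr (fun=> 2 * s)) ?prodr_const ?card_ord // => i _.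
  by rewrite ltn_ord.
have phi0 v : 0 <= \prod_(i < d) phi i (v i).
  by apply: prodr_ge0 => i _; rewrite /phi; case: ifP => _; exact: indic_ge0.
have mphi : measurable_fun setT (fun v : seqT R => \prod_(i < d) phi i (v i)).
  apply: measurable_prod => i _.
  have mi : measurable_fun setT (phi i).
    by rewrite /phi; case: ifP => _; exact: measurable_itv_indic.
  exact: (measurableT_comp mi (measurable_coord i)).
have C : leb_int d (fun q => (\1_(cyl (d := d) Db) (snoc_pt k q) * \1_(`[0, h]%classic) (q k))%:E) =
    (lebk k Db * h)%:E.
  rewrite (@leb_int_cyl _ _ Db oDb bDb (\1_(`[0, h]%classic))); last 2 first.
  - exact: measurable_itv_indic.
  - by move=> t; exact: indic_ge0.
  rewrite EFinM; congr (_ * _)%E.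
  transitivity (\int[mu]_t (\1_(`[0, h]%classic) t)%:E)%E.
    apply: eq_integral => t _; congr EFin.
    have [th|nt] := pselect (`[0, h]%classic t); last by rewrite (indicF0 nt) mulr0.
    rewrite (indicT1 th) mulr1 indicT1 //=.
    by move: th; rewrite /= !in_itv /= => /andP[-> _].
  by rewrite integral_indic // setIT /= lebesgue_measure_itv /= lte_fin h0 -EFinB subr0.
rewrite -lee_fin.
have -> : (h * (lebk k Db - (2 * s) ^+ k))%:E =
    ((lebk k Db * h)%:E - (h * (2 * s) ^+ k)%:E)%E.
  by rewrite -EFinB; congr EFin; ring.
have D := @leb_intD R d _ _ (measurable_EFinS lf.1) (measurable_EFinS mphi) f0 phi0.
rewrite leeBlDr // -C -lintP // -QE -Q -D.
apply: le_leb_int => v; first by rewrite lee_fin mulr_ge0 ?indic_ge0.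
rewrite -EFinD lee_fin.
have [vh|nv] := pselect (`[0, h]%classic (v k)); last first.
  by rewrite (indicF0 nv) mulr0 addr_ge0.
have [B|nB] := pselect (eball ((x, y) : pt R d) Rr (snoc_pt k v)); last first.
  by rewrite /f xiE // (indicF0 nB) subr0 lerDl.
rewrite (_ : \prod_(i < d) _ = 1).
  by rewrite (le_trans (_ : _ <= 1)) ?lerDr // (indicT1 vh) mulr1 indic_le1.
rewrite big1 // => i _; rewrite /phi; case: ifP => ik; last first.
  have -> : (i : nat) = k by apply/eqP; rewrite eqn_leq -ltnS ltn_ord leqNgt ik.
  by rewrite indicT1.
rewrite indicT1 //= in_itv /= -ler_distlC distrC.
have vh' : 0 <= v k <= h by move: vh; rewrite /= in_itv.
move: B; rewrite /eball /= edist_lt //= => B.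
have -> : rvnth x i = x 0 (Ordinal ik) by rewrite -rvnth_ord.
rewrite -(ler_pXn2r (n := 2)) ?nnegrE // real_normK ?num_real //.
have h1 : (v i - x 0 (Ordinal ik)) ^+ 2 <= \sum_(j < k) (v j - x 0 j) ^+ 2.
  by rewrite (bigD1 (Ordinal ik)) //= lerDl sumr_ge0 // => j _; exact: sqr_ge0.
have h2 : (Rr - h) ^+ 2 <= (v k - y) ^+ 2.
  have /andP[v0 v1] := vh'.
  by rewrite -[leRHS]sqrrN opprB ler_pXn2r ?nnegrE ?subr_ge0 //; lra.
have h3 : 0 <= h ^+ 2 by exact: sqr_ge0.
apply: le_trans h1 _; apply: le_trans hs.
rewrite sqrrB in h2; lra.
Qed.

(** The marginal is claimed to be uniform at every n, so the normalising constant must be positive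
    at each n and not only asymptotically. The mass comes from configurations with the ball nearly
    on the floor and all light particles in a thin layer. *)
Lemma Tc_gt0 n x : Dbp x -> 0 < lebk k Db -> M * g * Rr < E -> (0 < Tc n x setT)%E.
Proof.
move=> Dx A0 ERr.
(* Gives (2s)^k <= 2s < [lebk k Db], as k >= 1. *)
pose s := Num.min 1 (lebk k Db) / 4.
have mA : 0 < Num.min 1 (lebk k Db) by rewrite lt_min ltr01.
have s0 : 0 < s by exact: divr_gt0.
have sk : (2 * s) ^+ k < lebk k Db.
  have s1 : 2 * s <= 1.
    by have : Num.min 1 (lebk k Db) <= 1; [rewrite ge_min lexx|rewrite /s; lra].
  apply: (@le_lt_trans _ _ (2 * s)).
    by rewrite -[leRHS]expr1 ler_wiXn2l // mulr_ge0 // ltW.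
  have : Num.min 1 (lebk k Db) <= lebk k Db by rewrite ge_min lexx orbT.
  by rewrite /s; move: mA; lra.
have mg0 : 0 < m * g by exact: mulr_gt0.
have Mg0 : 0 < M * g by exact: mulr_gt0.
(* Half of the spare energy stays kinetic; the other half pays for raising all particles by at most
   [h]. *)
pose c0 := (E - M * g * Rr) / 2.
have c00 : 0 < c0 by rewrite divr_gt0 // subr_gt0.
pose h := Num.min Rr (Num.min (s ^+ 2 / (2 * Rr)) (c0 / (m * g + M * g))).
have h0 : 0 < h.
  rewrite !lt_min Rr0 /=; apply/andP; split; apply: divr_gt0 => //.
  - exact: exprn_gt0.
  - exact: mulr_gt0.
  - exact: addr_gt0.
have hR : h <= Rr by rewrite ge_min lexx.
have hs : 2 * Rr * h <= s ^+ 2.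
  by rewrite mulrC -ler_pdivlMr ?mulr_gt0 // /h !ge_min lexx !orbT.
have hc : h * (m * g + M * g) <= c0.
  by rewrite -ler_pdivlMr ?addr_gt0 // /h !ge_min lexx !orbT.
pose rho := h * (lebk k Db - (2 * s) ^+ k).
have rho0 : 0 < rho by rewrite mulr_gt0 // subr_gt0.
pose N : R := ((n.+1 * d)%:R - 2) / 2.
pose c := c0 `^ N * rho ^+ n.
have c_gt0 : 0 < c by rewrite mulr_gt0 ?powR_gt0 ?exprn_gt0.
rewrite TcE //; apply: (@lt_le_trans _ _ (c%:E * h%:E)%E).
  by rewrite -EFinM lte_fin mulr_gt0.
have -> : (c%:E * h%:E = \int[mu]_y (c%:E * (\1_(`[Rr, Rr + h]%classic) y)%:E))%E.
  rewrite (lebesgue_integralZl (measurable_itv_indic _) _ (ltW c_gt0)); last first.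
    by move=> y; exact: indic_ge0.
  rewrite integral_indic // setIT /= lebesgue_measure_itv /= lte_fin ltrDl h0.
  by rewrite -EFinB addrAC subrr add0r.
apply: ge0_le_integral_nomeas => y.
  by rewrite mule_ge0 // lee_fin ?indic_ge0 // ltW.
have [yh|ny] := pselect (`[Rr, Rr + h]%classic y); last first.
  rewrite (indicF0 ny) mule0; case: ifP => // _; apply: leb_int_ge0 => u.
  by rewrite lee_fin mulr_ge0 ?indic_ge0 // mulr_ge0 ?wgt_ge0 // chi_ge0.
rewrite (indicT1 yh) mule1; move: yh; rewrite /= in_itv /= => /andP[Ry yRh].
rewrite Ry.
have [K Kr HK] := low_layer_mass Dx Ry h0 hR (ltW s0) hs.
pose G v := xi Db Rr x y (snoc_pt k v) * \1_(`[0, h]%classic) (v k).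
have mG : measurable_fun setT (G : seqT R -> R).
  apply: measurable_funM; first exact: measurable_xi.
  exact: (measurableT_comp (measurable_itv_indic _) (measurable_coord k)).
have G0 v : 0 <= G v by rewrite mulr_ge0 ?indic_ge0.
have B := leb_int_blocks n mG G0 HK.
apply: (@le_trans _ _ (leb_int (n * d)
    (fun u => (c0 `^ N)%:E * (\prod_(i < n) G (block d i u))%:E)%E)).
  have mp : measurable_fun setT (fun u : seqT R => (\prod_(i < n) G (block d i u))%:E).
    apply: measurable_EFinS; apply: measurable_prod => i _.
    exact: (measurableT_comp mG (measurable_block _ _)).
  rewrite (@leb_intZl R (n * d) _ (c0 `^ N)%:E mp) ?B.
  - rewrite -EFinM lee_fin ler_wpM2l ?powR_ge0 // lerXn2r ?nnegrE ?(ltW rho0) //.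
    exact: le_trans (ltW rho0) Kr.
  - by move=> u; rewrite lee_fin prodr_ge0.
  - by rewrite lee_fin powR_ge0.
apply: le_leb_int => u.
  by rewrite -EFinM lee_fin mulr_ge0 ?powR_ge0 ?prodr_ge0.
rewrite -EFinM lee_fin [\1_ _ u]indicT1 // mulr1.
rewrite big_split /= -/(chi Db Rr n x y u) mulrCA ler_wpM2l ?chi_ge0 //.
have [H|/existsNP[i /not_implyP[iN ni]]] :=
    pselect (forall i, (i < n)%N -> `[0, h]%classic (block d i u k)); last first.
  by rewrite (bigD1 (Ordinal iN)) //= (indicF0 ni) mul0r mulr0 wgt_ge0.
rewrite big1 ?mulr1 => [|i _]; last by rewrite indicT1 //; exact: H.
have av : c0 <= avail (k := k) m M g E n u y.
  have S : \sum_(i < n) m / n%:R * g * u (i * d + k)%N <= m * g * h.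
    have [n0|n0] := posnP n.
      by rewrite n0 big_ord0 !mulr_ge0 // ltW.
    apply: (@le_trans _ _ (\sum_(i < n) m / n%:R * g * h)).
      apply: ler_sum => i _; apply: ler_wpM2l.
        by apply: mulr_ge0; [apply: divr_ge0; [exact: ltW|exact: ler0n]|exact: ltW].
      have := H i (ltn_ord i); rewrite /= in_itv /block ltnSn /=.
      by case/andP.
    rewrite sumr_const card_ord -[_ *+ n]mulr_natr le_eqVlt; apply/orP; left; apply/eqP.
    by field; rewrite pnatr_eq0 -lt0n.
  rewrite /avail; have := ler_wpM2l (ltW Mg0) yRh.
  have Ec : E - M * g * Rr = c0 + c0 by rewrite /c0; lra.
  move: hc S; lra.
rewrite /wgt indicT1 ?mul1r; last first.
  by rewrite /= in_itv /= andbT; exact: le_trans (ltW c00) av.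
by apply: ge0_ler_powR => //; rewrite ?nnegrE ?exponent_ge0 ?(ltW c00) // (le_trans (ltW c00)).
Qed.

End marginals.

(** * Concentration *)

Section concentration.
Context {R : realType} {k : nat}.
Variables (Db : set 'rV[R]_k) (Rr m M g E : R).
Hypotheses (oDb : open Db) (bDb : bounded_set Db) (Rr0 : 0 < Rr) (k0 : (0 < k)%N)
  (m0 : 0 < m) (M0 : 0 < M) (g0 : 0 < g).
Local Notation mu := (@lebesgue_measure R).
Local Notation d := k.+1.
Local Notation Dbp := (Dbp (d := d) Db Rr).
Local Notation Tc := (Tc Db Rr m M g E).
Local Notation inner := (inner Db Rr m M g E).
Local Notation availE := (avail (k := k) m M g E).
Local Notation xiw := (xiw Db Rr).
Local Notation chiD := (chi Db Rr).
Local Notation A := (lebk k Db).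
Local Notation L := (ballL (k := k) Rr).
Local Notation L1 := (ballL1 (k := k) Rr).
Implicit Types (x : 'rV[R]_k) (y t : R) (p q u v : nat -> R) (n : nat).

Variables (x : 'rV[R]_k) (yA l : R).
Hypotheses (Dx : Dbp x) (sA : saddle L L1 A Rr m M g E d%:R yA l).

Let RyA : Rr <= yA. Proof. by case: sA. Qed.
Let l0 : 0 < l. Proof. by case: sA. Qed.
Let i0 : 0 < moment0 L A yA l.
Proof. by apply: (saddle_moment0_gt0 M0 _ sA) => y' l' ? ?; exact: moment0_ge0 Dx _ _. Qed.

Definition mass0 y : R := moment0 L A y l / l.
Definition expo n : R := ((n.+1 * d)%:R - 2) / 2.
Definition kin0 : R := d%:R * m * g / (2 * l).
(** The part (d-2)/2 of the exponent that is not proportional to n, divided by [kin0]. *)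
Definition excess : R := (d%:R - 2) * l / (d%:R * m * g).
Definition height0 : R := moment1 L L1 A yA l / moment0 L A yA l.
(* The tangent bound [a^N <= b^N e^{N (a/b - 1)}] at [b = kin0], the kinetic energy
   at the saddle point, replaces the microcanonical weight by [Bn n y] times a
   product of exponential one-particle weights. *)
Definition Bn n y : R := kin0 `^ expo n * expR (- expo n) *
  expR (n%:R * l * (E - M * g * y) / (m * g)).
(** The value at [yA] of the profile [Bn n y * mass0 y ^+ n], against which all bounds are
    measured. *)
Definition Hn n : R := Bn n yA * mass0 yA ^+ n.

Let dgt0 : 0 < d%:R :> R. Proof. by rewrite ltr0n. Qed.
Let mg0 : 0 < m * g. Proof. exact: mulr_gt0. Qed.
Let Mg0 : 0 < M * g. Proof. exact: mulr_gt0. Qed.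
Let yA0 : 0 < yA. Proof. exact: lt_le_trans RyA. Qed.

Lemma mass0_gt0 : 0 < mass0 yA. Proof. exact: divr_gt0. Qed.

Lemma kin0_gt0 : 0 < kin0.
Proof. by rewrite divr_gt0 ?mulr_gt0. Qed.

Lemma excess_ge0 : 0 <= excess.
Proof.
apply: divr_ge0; first by apply: mulr_ge0; [rewrite subr_ge0 ler_nat|exact: ltW].
by rewrite -mulrA mulr_ge0 ?ltW.
Qed.

Lemma expo_ge0 n : 0 <= expo n.
Proof. exact: exponent_ge0. Qed.

Lemma energy_balance : E - M * g * yA - m * g * height0 = kin0.
Proof. by case: sA => _ _ _ <-; rewrite /energy /kin0 /height0; ring. Qed.

Lemma expo_kin0 n a : expo n / kin0 * a = n%:R * l / (m * g) * a + excess * a.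
Proof.
rewrite /expo /kin0 /excess mulSn natrD natrM.
by field; rewrite !gt_eqF.
Qed.

Lemma powR_tangent (a b N : R) : 0 <= a -> 0 < b -> 0 <= N ->
  a `^ N <= b `^ N * expR (- N) * expR (N / b * a).
Proof.
move=> a0 b0 N0; have [->|a_neq0] := eqVneq a 0.
  rewrite mulr0 expR0 mulr1; have [->|N_neq0] := eqVneq N 0.
    by rewrite !powRr0 oppr0 expR0 mulr1.
  by rewrite powR0 // mulr_ge0 ?powR_ge0 ?expR_ge0.
have a_gt0 : 0 < a by rewrite lt_def a_neq0.
rewrite /powR (negbTE a_neq0) gt_eqF // -!expRD ler_expR.
have := ln_le_subr1 (divr_gt0 a_gt0 b0); rewrite ln_div ?posrE // => h.
have := ler_wpM2l N0 h; rewrite mulrAC -mulrA; lra.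
Qed.

(** The loss 3 tau N is made of 2 tau N from ln(1 - tau) >= -2 tau and tau N from a/b <= 1 + tau. *)
Lemma powR_tangent_lower (a b N tau : R) : 0 < b -> 0 <= N -> 0 <= tau <= 2^-1 ->
  `|a - b| <= tau * b ->
  b `^ N * expR (- N) * expR (N / b * a) * expR (- (3 * tau * N)) <= a `^ N.
Proof.
move=> b0 N0 /andP[t0 t1] ab.
have := ab; rewrite ler_distl => /andP[ab1 ab2].
have a1 : b * (1 - tau) <= a by lra.
have t2 : 0 < 1 - tau by lra.
have a_gt0 : 0 < a by apply: lt_le_trans a1; exact: mulr_gt0.
apply: (@le_trans _ _ ((b * (1 - tau)) `^ N)); last first.
  by apply: ge0_ler_powR => //; rewrite nnegrE ltW // mulr_gt0.
rewrite powRM ?(ltW b0) ?(ltW t2) // -!mulrA ler_wpM2l ?powR_ge0 // -!expRD.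
rewrite /powR gt_eqF // ler_expR.
have lnt : - (2 * tau) <= ln (1 - tau).
  have t12 : 1 <= (1 - tau) * (1 + 2 * tau).
    have := mulr_ge0 t0 t0; have : tau * tau <= tau * 2^-1 by rewrite ler_wpM2l.
    lra.
  have := expR_ge1Dx (2 * tau) => e2.
  rewrite -[leLHS]expRK ler_ln ?posrE ?expR_gt0 // expRN.
  rewrite -(ler_pM2r (expR_gt0 (2 * tau))) mulVf ?gt_eqF ?expR_gt0 //.
  by apply: le_trans t12 _; rewrite ler_wpM2l // ltW.
have h1 : N / b * a <= N * (1 + tau).
  by rewrite -mulrA ler_wpM2l // ler_pdivrMl //; lra.
have := ler_wpM2l N0 lnt; lra.
Qed.

Lemma xiw_prod n y u :
  \prod_(i < n) xiw x y l (block d i u) =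
  chiD n x y u * expR (- (l * \sum_(i < n) u (i * d + k)%N)).
Proof.
rewrite big_split /=; congr (_ * _); rewrite mulr_sumr -sumrN expR_sum.
by apply: eq_bigr => i _; rewrite /block ltnSn.
Qed.

Lemma chi_cases n y u : (forall i, (i < n)%N -> 0 <= u (i * d + k)%N) \/ chiD n x y u = 0.
Proof.
have [H|/existsNP[i /not_implyP[iN ni]]] :=
    pselect (forall i, (i < n)%N -> cyl (d := d) Db (snoc_pt k (block d i u))); last first.
  right; rewrite /chi (bigD1 (Ordinal iN)) //= /xi indicF0 ?mul0r // => -[H _].
  exact: ni.
by left => i /H [_ /=]; rewrite /block ltnSn.
Qed.

Lemma avail_le n y u : (forall i, (i < n)%N -> 0 <= u (i * d + k)%N) ->
  availE n u y <= E - M * g * y.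
Proof.
move=> H; rewrite /avail lerD2l lerN2 lerDr sumr_ge0 // => i _.
by rewrite mulr_ge0 ?H // mulr_ge0 ?divr_ge0 ?ler0n // ltW.
Qed.

(** A light particle has mass m/n, so the factor n l/(m g) turns its potential energy into l times
    its height: the independent weights e^{-l r} originate here. *)
Lemma avail_exponent n y u : (0 < n)%N ->
  n%:R * l / (m * g) * availE n u y =
  n%:R * l * (E - M * g * y) / (m * g) - l * \sum_(i < n) u (i * d + k)%N.
Proof.
move=> n0; rewrite /avail -mulr_sumr; field.
by rewrite pnatr_eq0 -lt0n n0 !gt_eqF.
Qed.

(** The tangent bound at [kin0]; the remainder of the exponent costs at most e^{excess E}, since at
    most E is available. *)
Lemma weight_le n y u : (0 < n)%N -> Rr <= y ->
  chiD n x y u * wgt (k := k) n (availE n u y) <=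
  expR (excess * E) * (Bn n y * \prod_(i < n) xiw x y l (block d i u)).
Proof.
move=> n0 Ry; rewrite xiw_prod.
have Bn0 : 0 <= Bn n y by rewrite !mulr_ge0 ?expR_ge0 ?powR_ge0.
have c0 := chi_ge0 Db Rr n x y u.
have [H|->] := chi_cases n y u; last by rewrite !mul0r !mulr0.
rewrite [Bn n y * _]mulrCA [leRHS]mulrCA ler_wpM2l //.
have [a0|a0] := leP 0 (availE n u y); last first.
  rewrite /wgt indicF0 ?mul0r; last by rewrite /= in_itv /= andbT leNgt a0.
  by rewrite mulr_ge0 ?expR_ge0 // mulr_ge0 ?expR_ge0.
rewrite /wgt indicT1 ?mul1r; last by rewrite /= in_itv /= andbT.
apply: le_trans (powR_tangent a0 kin0_gt0 (expo_ge0 n)) _.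
rewrite expo_kin0 expRD avail_exponent // expRD /Bn.
have aE : expR (excess * availE n u y) <= expR (excess * E).
  rewrite ler_expR ler_wpM2l ?excess_ge0 // (le_trans (avail_le y H)) // gerBl.
  by rewrite mulr_ge0 ?(ltW Mg0) // (le_trans (ltW Rr0)).
set a := _ `^ _ * _; set b := expR (n%:R * _ * _ / _); set c := expR (- (l * _)).
rewrite [leLHS](_ : _ = a * b * c * expR (excess * availE n u y)); last by ring.
rewrite [leRHS](_ : _ = a * b * c * expR (excess * E)); last by ring.
by rewrite ler_wpM2l // !mulr_ge0 ?expR_ge0 ?powR_ge0.
Qed.

Definition chernoff_mass y s (h : seqT R -> R) (K : R) : Prop :=
  [/\ 0 <= s, measurable_fun setT h, 0 <= K &
    leb_int d (fun q => (xiw x y l q * expR (s * h q))%:E) = K%:E].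


Lemma measurable_tilt y (s : R) (h : seqT R -> R) : measurable_fun setT h ->
  measurable_fun setT (fun q : seqT R => xiw x y l q * expR (s * h q)).
Proof.
move=> mh; apply: measurable_funM; first exact: measurable_xiw.
have m1 : measurable_fun setT (fun q : seqT R => s * h q) by exact: measurable_funM.
exact: (measurableT_comp (@measurable_expR R) m1).
Qed.

Lemma measurable_tilt_prod n y (s : R) (h : seqT R -> R) : measurable_fun setT h ->
  measurable_fun setT (fun u : seqT R =>
    (\prod_(i < n) (xiw x y l (block d i u) * expR (s * h (block d i u))))%:E).
Proof.
move=> mh; apply: measurable_EFinS; apply: measurable_prod => i _.
exact: (measurableT_comp (measurable_tilt y s mh) (measurable_block _ _)).
Qed.

Lemma tilt_prod_int n y s h K : chernoff_mass y s h K ->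
  leb_int (n * d) (fun u =>
    (\prod_(i < n) (xiw x y l (block d i u) * expR (s * h (block d i u))))%:E) =
  (K ^+ n)%:E.
Proof.
move=> [s0 mh K0 HK].
apply: (leb_int_blocks n (measurable_tilt y s mh) _ HK) => q.
by rewrite mulr_ge0 ?expR_ge0 ?xiw_ge0.
Qed.

(** The exponential Markov inequality in pointwise form. *)
Lemma tilt_prod_ge n y s (h : seqT R -> R) u : 0 <= s -> 0 <= \sum_(i < n) h (block d i u) ->
  \prod_(i < n) xiw x y l (block d i u) <=
  \prod_(i < n) (xiw x y l (block d i u) * expR (s * h (block d i u))).
Proof.
move=> s0 h0; rewrite [leRHS]big_split /=.
have -> : \prod_(i < n) expR (s * h (block d i u)) = expR (s * \sum_(i < n) h (block d i u)).
  by rewrite mulr_sumr expR_sum.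
rewrite ler_peMr //.
  by apply: prodr_ge0 => i _; exact: xiw_ge0.
by rewrite -expR0 ler_expR mulr_ge0.
Qed.

Lemma tilt_prod_ge0 n y s (h : seqT R -> R) u :
  0 <= \prod_(i < n) (xiw x y l (block d i u) * expR (s * h (block d i u))).
Proof. by apply: prodr_ge0 => i _; rewrite mulr_ge0 ?expR_ge0 ?xiw_ge0. Qed.

(** Two tilts are carried along because the events are two-sided deviations, each side being charged
    to its own tilt. *)
Lemma inner_le n y (Q : set (nat -> R)) s1 s2 h1 h2 K1 K2 : (0 < n)%N -> Rr <= y ->
  chernoff_mass y s1 h1 K1 -> chernoff_mass y s2 h2 K2 ->
  (forall u, Q u -> 0 <= \sum_(i < n) h1 (block d i u) \/ 0 <= \sum_(i < n) h2 (block d i u)) ->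
  (inner n x y Q <= (expR (excess * E) * Bn n y * (K1 ^+ n + K2 ^+ n))%:E)%E.
Proof.
move=> n0 Ry C1 C2 HQ; have [s10 mh1 _ _] := C1; have [s20 mh2 _ _] := C2.
have c0 : 0 <= expR (excess * E) * Bn n y.
  by rewrite mulr_ge0 ?expR_ge0 // !mulr_ge0 ?expR_ge0 ?powR_ge0.
have m1 := measurable_tilt_prod n y s1 mh1.
have m2 := measurable_tilt_prod n y s2 mh2.
rewrite EFinM EFinD -(tilt_prod_int n C1) -(tilt_prod_int n C2).
rewrite -leb_intD //; last 2 first.
- by move=> u; rewrite lee_fin tilt_prod_ge0.
- by move=> u; rewrite lee_fin tilt_prod_ge0.
rewrite -leb_intZl ?lee_fin //; last 2 first.
- exact: emeasurable_funD.
- by move=> u; rewrite -EFinD lee_fin addr_ge0 ?tilt_prod_ge0.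
apply: le_leb_int => u.
  by rewrite lee_fin mulr_ge0 ?indic_ge0 // mulr_ge0 ?wgt_ge0 // chi_ge0.
rewrite -EFinD -EFinM lee_fin.
have [Qu|nQ] := pselect (Q u); last first.
  by rewrite (indicF0 nQ) mulr0 mulr_ge0 // addr_ge0 ?tilt_prod_ge0.
rewrite (indicT1 Qu) mulr1; apply: le_trans (weight_le u n0 Ry) _.
rewrite [leLHS]mulrA ler_wpM2l //.
have [H|H] := HQ u Qu.
  by apply: le_trans (tilt_prod_ge y s10 H) _; rewrite lerDl tilt_prod_ge0.
by apply: le_trans (tilt_prod_ge y s20 H) _; rewrite lerDr tilt_prod_ge0.
Qed.

Lemma inner0 n y Q : E < M * g * y -> inner n x y Q = 0%:E.
Proof.
move=> Ey; rewrite -(leb_int0 (n * d)); apply: eq_leb_int => u; congr EFin.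
have [H|->] := chi_cases n y u; last by rewrite !mul0r.
rewrite /wgt indicF0 ?mul0r ?mulr0 ?mul0r //= in_itv /= andbT => a0.
by have := le_trans a0 (avail_le y H); rewrite leNgt subr_lt0 Ey.
Qed.

(** Energy confines the heavy ball to heights at most E/(M g), so a bound uniform in y is multiplied
    by this length. *)
Lemma Tc_le n (P : set (nat -> R)) (c : R) : 0 <= c ->
  (forall y, Rr <= y -> (inner n x y [set u | P (cfg n x y u)] <= c%:E)%E) ->
  (Tc n x P <= (c * (E / (M * g)))%:E)%E.
Proof.
move=> c0 H; rewrite TcE //.
have E0 : 0 < E / (M * g).
  have : 0 < E - M * g * yA - m * g * height0 by rewrite energy_balance kin0_gt0.
  have : 0 <= height0.
    rewrite divr_ge0 ?(ltW i0) //.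
    by have /andP[] := moment1_bounds oDb bDb Rr0 Dx RyA l0.
  move=> /(mulr_ge0 (ltW mg0)) h1 h2; rewrite divr_gt0 //.
  have := mulr_gt0 Mg0 yA0; lra.
apply: (@le_trans _ _ (\int[mu]_y (c%:E * (\1_(`[0, E / (M * g)]%classic) y)%:E)%E)%E).
  apply: ge0_le_integral_nomeas => y.
    case: ifP => // _; apply: leb_int_ge0 => u.
    by rewrite lee_fin mulr_ge0 ?indic_ge0 // mulr_ge0 ?wgt_ge0 // chi_ge0.
  have r0 : (0 <= c%:E * (\1_(`[0%R, (E / (M * g))%R]%classic) y)%:E)%E.
    by rewrite mule_ge0 // lee_fin indic_ge0.
  case: ifP => // Ry; have [yE|yE] := leP y (E / (M * g)).
    rewrite indicT1 ?mule1; first exact: H.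
    by rewrite /= in_itv /= yE (le_trans (ltW Rr0)).
  by rewrite inner0 //; move: yE; rewrite ltr_pdivrMr // mulrC.
rewrite (lebesgue_integralZl (measurable_itv_indic _) (fun t => indic_ge0 _ t) c0).
by rewrite integral_indic // setIT /= lebesgue_measure_itv /= lte_fin E0 -EFinB subr0 -EFinM.
Qed.

Lemma Bn_shift n y : Bn n y = Bn n yA * expR (- (l * M / m * (y - yA))) ^+ n.
Proof.
rewrite /Bn -[RHS]mulrA; congr (_ * _); rewrite -expRM_natl -expRD.
by congr expR; field; rewrite !gt_eqF.
Qed.

(** By the first equation the hole at [yA] holds M/m times the mass outside it, and moving it to [y]
    multiplies its mass by e^{-l (y - yA)}. *)
Lemma mass0_shift y : mass0 y =
  mass0 yA * (1 + M / m * (1 - expR (- (l * (y - yA))))).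
Proof.
have capE : cap L yA l = M / m * moment0 L A yA l.
  by case: sA => _ _ HM _; rewrite {1}HM; field; rewrite !gt_eqF.
have AE : A = moment0 L A yA l + cap L yA l by rewrite /moment0 subrK.
rewrite /mass0 {1}/moment0 (cap_shift L yA) {1}AE capE.
by field; rewrite !gt_eqF.
Qed.

Lemma mass0_ge0 y : Rr <= y -> 0 <= mass0 y.
Proof. by move=> Ry; rewrite divr_ge0 ?(ltW l0) //; exact: moment0_ge0 Dx _ _. Qed.

Lemma Bn_ge0 n y : 0 <= Bn n y.
Proof. by rewrite !mulr_ge0 ?expR_ge0 ?powR_ge0. Qed.

Lemma Hn_gt0 n : 0 < Hn n.
Proof.
by rewrite mulr_gt0 ?exprn_gt0 ?mass0_gt0 // !mulr_gt0 ?expR_gt0 ?powR_gt0 ?kin0_gt0.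
Qed.

(** Times M/m, an exponential rate at which heights with l (y - yA) = z are suppressed. *)
Definition gap (z : R) : R := expR (- z) - 1 + z.

Lemma gap_gt0 z : z != 0 -> 0 < gap z.
Proof. by rewrite -oppr_eq0 => /expR_gt1Dx; rewrite /gap; lra. Qed.

(** [gap] is convex with minimum at 0; the supporting lines at z0 and -z0 give the bound on either
    side. *)
Lemma gap_mono z0 z : 0 < z0 -> z0 <= `|z| -> Num.min (gap z0) (gap (- z0)) <= gap z.
Proof.
move=> z00; rewrite ge_min; have [zge|zlt] := leP 0 z.
  rewrite ger0_norm // => h; apply/orP; left.
  have e1 := expR_ge1Dx (- (z - z0)).
  have := ler_wpM2l (expR_ge0 (- z0)) e1; rewrite -expRD.
  rewrite (_ : - z0 + _ = - z); last by ring.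
  have e2 : expR (- z0) <= 1 by rewrite -expR0 ler_expR oppr_le0 ltW.
  have : expR (- z0) * (z - z0) <= 1 * (z - z0) by rewrite ler_wpM2r // subr_ge0.
  rewrite /gap; lra.
rewrite ltr0_norm // => h; apply/orP; right.
have e1 := expR_ge1Dx (- (z + z0)).
have := ler_wpM2l (expR_ge0 z0) e1; rewrite -expRD.
rewrite (_ : z0 + _ = - z); last by ring.
have e2 : 1 <= expR z0 by rewrite -expR0 ler_expR ltW.
have : 1 * (- (z + z0)) <= expR z0 * (- (z + z0)) by rewrite ler_wpM2r //; lra.
rewrite /gap opprK; lra.
Qed.

(* [1 + b (1 - e^{-z}) <= exp (b (1 - e^{-z}))] makes the height profile
   [Bn y * mass0 y ^+ n] exponentially smaller than its value at [yA]. *)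
Lemma far_height (e : R) : 0 < e -> exists2 th : R, 0 < th < 1 &
  forall n y, Rr <= y -> e <= `|y - yA| -> Bn n y * mass0 y ^+ n <= Hn n * th ^+ n.
Proof.
move=> e0; have z00 : 0 < l * e by exact: mulr_gt0.
pose kap := Num.min (gap (l * e)) (gap (- (l * e))).
have kap0 : 0 < kap by rewrite lt_min !gap_gt0 ?oppr_eq0 ?gt_eqF.
have b0 : 0 < M / m by exact: divr_gt0.
exists (expR (- (M / m * kap))).
  by rewrite expR_gt0 -expR0 ltr_expR oppr_lt0 mulr_gt0.
move=> n y Ry ey; rewrite Bn_shift /Hn -[leLHS]mulrA -[leRHS]mulrA.
rewrite ler_wpM2l ?Bn_ge0 //.
rewrite -!exprMn; apply: lerXn2r.
- by rewrite nnegrE mulr_ge0 ?expR_ge0 ?mass0_ge0.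
- by rewrite nnegrE mulr_ge0 ?expR_ge0 ?(ltW mass0_gt0).
rewrite mass0_shift mulrCA ler_wpM2l ?(ltW mass0_gt0) //.
set z := l * (y - yA).
apply: (@le_trans _ _ (expR (- (l * M / m * (y - yA))) * expR (M / m * (1 - expR (- z))))).
  by rewrite ler_wpM2l ?expR_ge0 // expR_ge1Dx.
rewrite -expRD ler_expR.
have : kap <= gap z.
  by apply: gap_mono => //; rewrite /z normrM (gtr0_norm l0) ler_wpM2l // ltW.
move=> /(ler_wpM2l (ltW b0)).
rewrite (_ : l * M / m * (y - yA) = M / m * z); last by rewrite /z; ring.
by rewrite /gap; lra.
Qed.

Lemma chernoff_near (h : seqT R -> R) (C : R) : measurable_fun setT h -> 0 <= C ->
  (forall q, cyl (d := d) Db (snoc_pt k q) -> `|h q| <= C * (1 + q k)) ->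
  leb_intR d (fun q => h q * xiw x yA l q) < 0 ->
  exists s th eta : R, [/\ 0 <= th < 1, 0 < eta &
    forall y, Rr <= y -> `|y - yA| <= eta ->
      exists2 K, K <= th * mass0 yA & chernoff_mass y s h K].
Proof.
move=> mh C0 hC H.
have [s [th [eta [s0 th01 eta0 HK]]]] := chernoff oDb bDb Rr0 Dx RyA l0 i0 mh C0 hC H.
exists s, th, eta; split => // y Ry yy.
have [K /andP[K0 K1] KE] := HK y Ry yy.
by exists K => //; split => //; exact: ltW.
Qed.

Lemma mass0_chernoff y : Rr <= y -> chernoff_mass y 0 (fun=> 0) (mass0 y).
Proof.
move=> Ry; split => //; first exact: mass0_ge0.
rewrite /mass0 -(xiw_int oDb bDb Rr0 Dx Ry l0) -lintP; last 2 first.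
- exact: (lint_xiw oDb bDb Rr0 Dx Ry l0).
- by move=> q; exact: xiw_ge0.
by apply: eq_leb_int => q; rewrite mul0r expR0 mulr1.
Qed.

Lemma expo_le n : (0 < n)%N -> expo n <= n%:R * d%:R.
Proof.
move=> n0; rewrite /expo ler_pdivrMr // mulSn natrD natrM.
have : 1 * d%:R <= n%:R * d%:R :> R by rewrite ler_wpM2r ?ler1n // ltW.
lra.
Qed.

(** With the ball and the mean light height within [eta] of their saddle values, [energy_balance]
    puts the available energy within [tau * kin0] of [kin0], where the tangent bound can be
    reversed. The remainder of the exponent contributes a factor at least 1. *)
Lemma weight_ge n y u (eta tau : R) : (0 < n)%N -> 0 <= tau <= 2^-1 ->
  (M * g + m * g) * eta <= tau * kin0 -> yA <= y <= yA + eta ->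
  `|(\sum_(i < n) u (i * d + k)%N) / n%:R - height0| <= eta ->
  Bn n y * expR (- (3 * tau * expo n)) * \prod_(i < n) xiw x y l (block d i u) <=
  chiD n x y u * wgt (k := k) n (availE n u y).
Proof.
move=> n0 tau01 etau /andP[y1 y2] hu; have /andP[tau_ge0 tau_le] := tau01.
have Ry : Rr <= y by exact: le_trans y1.
have nR : 0 < n%:R :> R by rewrite ltr0n.
have av : `|availE n u y - kin0| <= tau * kin0.
  apply: le_trans etau; rewrite mulrDl -energy_balance.
  have -> : availE n u y - (E - M * g * yA - m * g * height0) =
      - (M * g * (y - yA)) - m * g * ((\sum_(i < n) u (i * d + k)%N) / n%:R - height0).
    by rewrite /avail -mulr_sumr; field; rewrite gt_eqF.
  apply: le_trans (ler_normB _ _) _; rewrite normrN.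
  apply: lerD; rewrite normrM gtr0_norm //; first by rewrite ler_wpM2l ?(ltW Mg0) // ger0_norm; lra.
  by rewrite ler_wpM2l // ltW.
have a0 : 0 <= availE n u y.
  move: av; rewrite ler_distl => /andP[+ _]; apply: le_trans.
  by have := kin0_gt0; have : tau * kin0 <= 2^-1 * kin0; [rewrite ler_wpM2r // ltW // kin0_gt0|lra].
rewrite xiw_prod mulrCA ler_wpM2l ?chi_ge0 //.
rewrite /wgt indicT1 ?mul1r; last by rewrite /= in_itv /= andbT.
apply: le_trans (powR_tangent_lower kin0_gt0 (expo_ge0 n) tau01 av).
rewrite expo_kin0 expRD avail_exponent // expRD /Bn.
set a := _ `^ _ * _; set b := expR (n%:R * _ * _ / _); set c := expR (- (l * _)).
set e := expR (- (3 * _ * _)).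
rewrite [leLHS](_ : _ = a * b * c * e * 1); last by ring.
rewrite [leRHS](_ : _ = a * b * c * e * expR (excess * availE n u y)); last by ring.
apply: ler_wpM2l; first by rewrite !mulr_ge0 ?expR_ge0 ?powR_ge0.
by rewrite -expR0 ler_expR mulr_ge0 // excess_ge0.
Qed.

(** The weight is bounded below on typical configurations only; the others are removed from the
    total [mass0 y ^+ n] at the cost of the two tilted masses. *)
Lemma inner_ge n y (eta tau s1 s2 : R) h1 h2 K1 K2 : (0 < n)%N -> 0 <= tau <= 2^-1 ->
  (M * g + m * g) * eta <= tau * kin0 -> yA <= y <= yA + eta ->
  chernoff_mass y s1 h1 K1 -> chernoff_mass y s2 h2 K2 ->
  (forall u, [\/ `|(\sum_(i < n) u (i * d + k)%N) / n%:R - height0| <= eta,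
     0 <= \sum_(i < n) h1 (block d i u) | 0 <= \sum_(i < n) h2 (block d i u)]) ->
  ((Bn n y * expR (- (3 * tau * expo n)) * (mass0 y ^+ n - (K1 ^+ n + K2 ^+ n)))%:E <=
     inner n x y setT)%E.
Proof.
move=> n0 tau01 etau yy C1 C2 H; have [s10 mh1 _ _] := C1; have [s20 mh2 _ _] := C2.
have Ry : Rr <= y by case/andP: yy => y1 _; exact: le_trans y1.
set c := Bn n y * _.
have c0 : 0 <= c by rewrite mulr_ge0 ?expR_ge0 ?Bn_ge0.
have m1 := measurable_tilt_prod n y s1 mh1.
have m2 := measurable_tilt_prod n y s2 mh2.
have C0 := mass0_chernoff Ry.
have m3 := measurable_tilt_prod n y 0 (@measurable_cst _ _ (seqT R) R setT 0).
pose W u : R := chiD n x y u * wgt (k := k) n (availE n u y).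
have W0 u : 0 <= W u by rewrite mulr_ge0 ?wgt_ge0 // chi_ge0.
have mW : measurable_fun setT (fun u : seqT R => (W u)%:E).
  apply: measurable_EFinS; apply: measurable_funM.
    exact: measurable_chi.
  have me : measurable_fun setT (fun u : seqT R => availE n u y).
    apply: measurable_funB => //; apply: measurable_funD => //.
    apply: measurable_sum => i; apply: measurable_funM => //; exact: measurable_coord.
  have mw : measurable_fun setT (wgt (k := k) n : R -> R).
    apply: measurable_funM; first exact: measurable_itv_indic.
    exact: measurable_powR.
  exact: (measurableT_comp mw me).
pose F s h u : R := \prod_(i < n) (xiw x y l (block d i u) * expR (s * h (block d i u))).
have F0 s h u : 0 <= F s h u by exact: tilt_prod_ge0.
have -> : inner n x y setT = leb_int (n * d) (fun u => (W u)%:E).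
  by apply: eq_leb_int => u; rewrite indicT1 // mulr1.
rewrite mulrBr EFinB leeBlDr //.
rewrite EFinM -(tilt_prod_int n C0) [X in (_ + X)%E]EFinM EFinD.
rewrite -(tilt_prod_int n C1) -(tilt_prod_int n C2).
rewrite -(@leb_intD R (n * d) _ _ m1 m2 (F0 s1 h1) (F0 s2 h2)).
have m12 := emeasurable_funD m1 m2.
have F12 u : (0 <= (F s1 h1 u)%:E + (F s2 h2 u)%:E)%E.
  by rewrite -EFinD lee_fin addr_ge0.
have cE : (0 <= c%:E)%E by rewrite lee_fin.
rewrite -(@leb_intZl R (n * d) _ c%:E m3 (F0 0 (fun=> 0)) cE).
rewrite -(@leb_intZl R (n * d) _ c%:E m12 F12 cE).
have mc12 : measurable_fun setT (fun u : seqT R => (c%:E * ((F s1 h1 u)%:E + (F s2 h2 u)%:E))%E).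
  by apply: emeasurable_funM => //; exact: measurable_cst.
have Fc12 u : (0 <= c%:E * ((F s1 h1 u)%:E + (F s2 h2 u)%:E))%E.
  by rewrite mule_ge0.
rewrite -(@leb_intD R (n * d) _ _ mW mc12 W0 Fc12).
apply: le_leb_int => u; first by rewrite -EFinM lee_fin mulr_ge0 // F0.
have cF : (c%:E * ((F s1 h1 u)%:E + (F s2 h2 u)%:E))%E = (c * (F s1 h1 u + F s2 h2 u))%:E by [].
rewrite cF -[leLHS]EFinM -EFinD lee_fin /=.
have -> : \prod_(i < n) (xiw x y l (block d i u) * expR (0 * 0)) =
    \prod_(i < n) xiw x y l (block d i u).
  by apply: eq_bigr => i _; rewrite mul0r expR0 mulr1.
have [h|h|h] := H u.
- apply: le_trans (weight_ge n0 tau01 etau yy h) _.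
  by rewrite lerDl mulr_ge0 // addr_ge0 // F0.
- apply: (@le_trans _ _ (c * (F s1 h1 u + F s2 h2 u))); last by rewrite lerDr.
  by rewrite ler_wpM2l // (le_trans (tilt_prod_ge y s10 h)) // lerDl F0.
- apply: (@le_trans _ _ (c * (F s1 h1 u + F s2 h2 u))); last by rewrite lerDr.
  by rewrite ler_wpM2l // (le_trans (tilt_prod_ge y s20 h)) // lerDr F0.
Qed.

(** Subtracting [eta] makes the mean of the tilting function negative at the saddle, as Chernoff's
    bound requires; [sg] selects the side of the deviation. *)
Lemma height_chernoff (sg eta : R) : `|sg| = 1 -> 0 < eta ->
  exists s th e : R, [/\ 0 <= th < 1, 0 < e &
    forall y, Rr <= y -> `|y - yA| <= e -> exists2 K, K <= th * mass0 yA &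
      chernoff_mass y s (fun q => sg * (q k - height0) - eta) K].
Proof.
move=> sg1 eta0.
apply: (chernoff_near (C := 1 + `|height0| + eta)).
- apply: measurable_funB => //; apply: measurable_funM => //.
  by apply: measurable_funB => //; exact: measurable_coord.
- by rewrite !addr_ge0 // ltW.
- move=> q [_ /= q0]; apply: le_trans (ler_normB _ _) _.
  rewrite normrM sg1 mul1r (gtr0_norm eta0).
  have := ler_normB (q k) height0; rewrite (ger0_norm q0) => h.
  have := mulr_ge0 (normr_ge0 height0) q0; have := mulr_ge0 (ltW eta0) q0; lra.
have lx := lint_xiw oDb bDb Rr0 Dx RyA l0; have lx1 := lint_xiw1 oDb bDb Rr0 Dx RyA l0.
rewrite (_ : (fun q => _) = (fun q => sg * (q k * xiw x yA l q) -
  (sg * height0 + eta) * xiw x yA l q)); last by apply/funext => q; ring.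
rewrite leb_intRB; [|exact: lintZ|exact: lintZ].
rewrite !leb_intRZ // (xiw_int oDb bDb Rr0 Dx RyA l0) (xiw1_int oDb bDb Rr0 Dx RyA l0).
have -> : moment1 L L1 A yA l = height0 * moment0 L A yA l by rewrite divfK ?gt_eqF.
have := mulr_gt0 eta0 mass0_gt0; rewrite /mass0; lra.
Qed.

Lemma geometric_near (th c : R) : 0 <= th < 1 -> 0 < c ->
  \forall n \near \oo, th ^+ n <= c.
Proof.
move=> /andP[t0 t1] c0; have t1' : `|th| < 1 by rewrite ger0_norm.
have /cvgrPdist_le/(_ _ c0) := cvg_expr t1'.
apply: filterS => n; rewrite sub0r normrN; exact: le_trans (ler_norm _).
Qed.

(** Of the loss n delta, a quarter pays for reversing the tangent bound, a quarter for letting y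
    vary over an interval of length [eta], and half for the factor [eta / 2]. *)
Lemma Tc_lower (delta : R) : 0 < delta ->
  \forall n \near \oo, ((Hn n * expR (- (n%:R * delta)))%:E <= Tc n x setT)%E.
Proof.
move=> delta0.
have kg0 := kin0_gt0.
pose tau := Num.min 2^-1 (delta / (12 * d%:R)).
have tau0 : 0 < tau by rewrite lt_min invr_gt0 ltr0n divr_gt0 // mulr_gt0.
have tau01 : 0 <= tau <= 2^-1 by rewrite (ltW tau0) /tau ge_min lexx.
have tau_d : 12 * d%:R * tau <= delta.
  by rewrite mulrC -ler_pdivlMr ?mulr_gt0 // ge_min lexx orbT.
pose eta0 := tau * kin0 / (M * g + m * g).
have MM0 : 0 < M * g + m * g by exact: addr_gt0.
have eta00 : 0 < eta0 by rewrite divr_gt0 // mulr_gt0.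
have [s1 [th1 [e1 [/andP[t10 t11] e10 H1]]]] := height_chernoff (normr1 R) eta00.
have [s2 [th2 [e2 [/andP[t20 t21] e20 H2]]]] := height_chernoff (normrN1 R) eta00.
pose th := Num.max th1 th2.
have th01 : 0 <= th < 1 by rewrite le_max t10 gt_max t11 t21.
have lMm : 0 < l * M / m by rewrite divr_gt0 // mulr_gt0.
pose eta := Num.min eta0 (Num.min (Num.min e1 e2) (delta / 4 / (l * M / m))).
have eta_gt0 : 0 < eta.
  by rewrite !lt_min eta00 e10 e20 /=; apply: divr_gt0 => //; exact: divr_gt0.
have etale0 : eta <= eta0 by rewrite ge_min lexx.
have etae1 : eta <= e1 by rewrite /eta !ge_min lexx !orbT.
have etae2 : eta <= e2 by rewrite /eta !ge_min lexx !orbT.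
have etad : l * M / m * eta <= delta / 4.
  by rewrite mulrC -ler_pdivlMr // /eta !ge_min lexx !orbT.
(* Each tilted mass is then at most a quarter of [mass0 yA ^+ n], so that half of it survives the
   subtraction. *)
have hth4 : \forall n \near \oo, th ^+ n <= 4^-1 by apply: geometric_near; rewrite ?invr_gt0.
have hd : 0 <= expR (- (delta / 2)) < 1 by rewrite expR_ge0 -expR0 ltr_expR oppr_lt0 divr_gt0.
have heta : \forall n \near \oo, expR (- (delta / 2)) ^+ n <= eta / 2.
  by apply: geometric_near => //; rewrite divr_gt0.
near=> n.
have n0 : (0 < n)%N by near: n; exact: nbhs_infty_gt.
have thn : th ^+ n <= 4^-1 by near: n.
have etn : expR (- (delta / 2)) ^+ n <= eta / 2 by near: n.
have nR : 0 < n%:R :> R by rewrite ltr0n.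
have J0 := mass0_gt0.
pose c := Hn n * expR (- (n%:R * (delta / 2))) / 2.
have c0 : 0 <= c by rewrite divr_ge0 // mulr_ge0 ?expR_ge0 // ltW // Hn_gt0.
(* Only heights above [yA] are used: they satisfy [Rr <= y], and there [mass0] is at least its value
   at [yA]. *)
have inner_c y : yA <= y <= yA + eta -> (c%:E <= inner n x y setT)%E.
  move=> /andP[y1 y2].
  have Ry : Rr <= y by exact: le_trans y1.
  have yy : `|y - yA| <= eta by rewrite ger0_norm ?subr_ge0 // lerBlDl.
  have [K1 K1le C1] := H1 y Ry (le_trans yy etae1).
  have [K2 K2le C2] := H2 y Ry (le_trans yy etae2).
  have [_ _ K10 _] := C1; have [_ _ K20 _] := C2.
  have etau : (M * g + m * g) * eta0 <= tau * kin0.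
    by rewrite mulrC -ler_pdivlMr.
  have yy0 : yA <= y <= yA + eta0 by rewrite y1 /= (le_trans y2) // lerD2l.
  apply: le_trans (inner_ge n0 tau01 etau yy0 C1 C2 _); last first.
    move=> u; set a := (\sum_(i < n) u (i * d + k)%N) / n%:R - height0.
    have sE (sg : R) : \sum_(i < n) (sg * (block d i u k - height0) - eta0) =
        n%:R * (sg * a - eta0).
      rewrite big_split /= -mulr_sumr big_split /= !sumr_const card_ord.
      rewrite (eq_bigr (fun i : 'I_n => u (i * d + k)%N)); last first.
        by move=> i _; rewrite /block ltnSn.
      by rewrite /a -(mulr_natr (- height0)) -(mulr_natr (- eta0)); field; rewrite gt_eqF.
    have [h|h] := leP `|a| eta0; first by constructor 1.
    have [a0|a0] := leP 0 a.
      constructor 2; rewrite sE mulr_ge0 ?(ltW nR) // mul1r subr_ge0.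
      by move: h; rewrite ger0_norm // => /ltW.
    constructor 3; rewrite sE mulr_ge0 ?(ltW nR) // mulN1r subr_ge0.
    by move: h; rewrite ltr0_norm // => /ltW.
  rewrite lee_fin.
  have Kth (K thi : R) : 0 <= K -> 0 <= thi -> thi <= th -> K <= thi * mass0 yA ->
      K ^+ n <= 4^-1 * mass0 yA ^+ n.
    move=> K0 thi0 thle Kle; apply: (@le_trans _ _ ((th * mass0 yA) ^+ n)).
      apply: lerXn2r; rewrite ?nnegrE //.
        by rewrite mulr_ge0 ?(ltW J0) // (le_trans thi0).
      by apply: le_trans Kle _; rewrite ler_wpM2r // ltW.
    by rewrite exprMn ler_wpM2r // exprn_ge0 // ltW.
  have K1n : K1 ^+ n <= 4^-1 * mass0 yA ^+ n by apply: (Kth _ th1); rewrite ?le_max ?lexx.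
  have K2n : K2 ^+ n <= 4^-1 * mass0 yA ^+ n by apply: (Kth _ th2); rewrite ?le_max ?lexx ?orbT.
  have Jy : mass0 yA ^+ n <= mass0 y ^+ n.
    apply: lerXn2r; rewrite ?nnegrE ?mass0_ge0 //.
    rewrite (mass0_shift y) ler_peMr ?(ltW J0) // lerDl; apply: mulr_ge0.
      by rewrite ltW // divr_gt0.
    by rewrite subr_ge0 -expR0 ler_expR oppr_le0 mulr_ge0 ?(ltW l0) // subr_ge0.
  have hJ : mass0 yA ^+ n / 2 <= mass0 y ^+ n - (K1 ^+ n + K2 ^+ n) by lra.
  have hB : Bn n yA * expR (- (n%:R * (delta / 2))) <= Bn n y * expR (- (3 * tau * expo n)).
    rewrite (Bn_shift n y) -[leRHS]mulrA ler_wpM2l ?Bn_ge0 // -expRM_natl -expRD ler_expR.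
    have h1 : l * M / m * (y - yA) <= delta / 4.
      apply: le_trans etad; rewrite ler_wpM2l ?(ltW lMm) //; lra.
    have h2 := ler_wpM2l (ltW nR) h1.
    have h3 : 3 * tau * expo n <= 3 * tau * (n%:R * d%:R).
      by rewrite ler_wpM2l ?expo_le // mulr_ge0 // ltW.
    have h4 := ler_wpM2l (ltW nR) tau_d.
    rewrite mulrN; lra.
  rewrite /c /Hn [leLHS](_ : _ = Bn n yA * expR (- (n%:R * (delta / 2))) * (mass0 yA ^+ n / 2)); last by ring.
  apply: ler_pM => //; first by rewrite mulr_ge0 ?Bn_ge0 ?expR_ge0.
  by rewrite divr_ge0 // exprn_ge0 // ltW.
apply: (@le_trans _ _ (c%:E * eta%:E)%E).
  rewrite -EFinM lee_fin /c.
  rewrite [leRHS](_ : _ = Hn n * expR (- (n%:R * (delta / 2))) * (eta / 2)); last by ring.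
  rewrite (_ : n%:R * delta = n%:R * (delta / 2) + n%:R * (delta / 2)); last by field.
  have HE : 0 <= Hn n * expR (- (n%:R * (delta / 2))).
    by apply: mulr_ge0; [exact/ltW/Hn_gt0|exact: expR_ge0].
  rewrite opprD expRD mulrA ler_wpM2l ?HE //.
  by move: etn; rewrite -expRM_natl mulrN.
rewrite TcE //.
have -> : (c%:E * eta%:E = \int[mu]_y (c%:E * (\1_(`[yA, yA + eta]%classic) y)%:E))%E.
  rewrite (lebesgue_integralZl (measurable_itv_indic _) (fun t => indic_ge0 _ t) c0).
  rewrite integral_indic // setIT /= lebesgue_measure_itv /= lte_fin ltrDl eta_gt0.
  by rewrite -EFinB addrAC subrr add0r.
apply: ge0_le_integral_nomeas => y; first by rewrite mule_ge0 // lee_fin indic_ge0.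
have [yh|ny] := pselect (`[yA, yA + eta]%classic y); last first.
  rewrite (indicF0 ny) mule0; case: ifP => // _; apply: leb_int_ge0 => u.
  by rewrite lee_fin mulr_ge0 ?indic_ge0 // mulr_ge0 ?wgt_ge0 // chi_ge0.
rewrite (indicT1 yh) mule1; move: yh; rewrite /= in_itv /= => yh.
have Ry : Rr <= y by case/andP: yh => y1 _; exact: le_trans y1.
by rewrite Ry; exact: inner_c.
Unshelve. all: by end_near. Qed.

Lemma height_max n y : Rr <= y -> Bn n y * mass0 y ^+ n <= Hn n.
Proof.
move=> Ry; have [->//|yyA] := eqVneq y yA.
have e0 : 0 < `|y - yA| by rewrite normr_gt0 subr_eq0.
have [th /andP[t0 t1] H] := far_height e0.
apply: le_trans (H n y Ry (lexx _)) _.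
by rewrite ler_piMr ?(ltW (Hn_gt0 n)) // exprn_ile1 // ltW.
Qed.

(** Both tilts are trivial, whence the factor 2. *)
Lemma inner_le_mass n y (Q : set (nat -> R)) : (0 < n)%N -> Rr <= y ->
  (inner n x y Q <= (expR (excess * E) * 2 * (Bn n y * mass0 y ^+ n))%:E)%E.
Proof.
move=> n0 Ry; have C0 := mass0_chernoff Ry.
have H : forall u, Q u -> 0 <= \sum_(i < n) (fun=> 0 : R) (block d i u) \/
    0 <= \sum_(i < n) (fun=> 0 : R) (block d i u).
  by move=> u _; left; rewrite big1.
apply: le_trans (inner_le n0 Ry C0 C0 H) _; rewrite lee_fin le_eqVlt.
by apply/orP; left; apply/eqP; ring.
Qed.

Lemma Tc_ge0 n P : (0 <= Tc n x P)%E.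
Proof.
apply: leb_int_ge0 => p; rewrite lee_fin.
by rewrite mulr_ge0 ?indic_ge0 // mulr_ge0 ?indic_ge0 // powR_ge0.
Qed.

Lemma Tc_fin n P : (0 < n)%N -> Tc n x P \is a fin_num.
Proof.
move=> n0; rewrite ge0_fin_numE; last exact: Tc_ge0.
pose c := expR (excess * E) * 2 * Hn n.
have c0 : 0 <= c.
  by apply: mulr_ge0; [rewrite mulr_ge0 ?expR_ge0|exact/ltW/Hn_gt0].
apply: le_lt_trans (Tc_le c0 _) (ltry _) => y Ry.
apply: le_trans (inner_le_mass _ n0 Ry) _.
by rewrite lee_fin ler_wpM2l ?height_max // mulr_ge0 ?expR_ge0.
Qed.

(** The partition function may lose e^{-n delta} for any delta; the choice -(ln th)/2 leaves a decay
    th^{n/2}. *)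
Lemma Tc_ratio (P : nat -> set (nat -> R)) (C th : R) : 0 <= C -> 0 < th < 1 ->
  (forall n, (0 < n)%N -> forall y, Rr <= y ->
     (inner n x y [set u | P n (cfg n x y u)] <= (C * Hn n * th ^+ n)%:E)%E) ->
  fine (Tc n x (P n)) / fine (Tc n x setT) @[n --> \oo] --> 0.
Proof.
move=> C0 /andP[th0 th1] H.
pose delta := - ln th / 2.
have lnth : ln th < 0 by rewrite ln_lt0 // th0.
have delta0 : 0 < delta by rewrite divr_gt0 // oppr_gt0.
pose r := expR (ln th / 2).
have r0 : 0 <= r by exact: expR_ge0.
have r1 : `|r| < 1 by rewrite ger0_norm // -expR0 ltr_expR; lra.
pose C' := C * (E / (M * g)).
have HC' n : (0 < n)%N -> fine (Tc n x (P n)) <= C' * (Hn n * th ^+ n).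
  move=> n0; rewrite -lee_fin fineK ?Tc_fin //.
  have c0 : 0 <= C * Hn n * th ^+ n.
    by apply: mulr_ge0; [apply: mulr_ge0 => //; exact/ltW/Hn_gt0|rewrite exprn_ge0 // ltW].
  apply: le_trans (Tc_le c0 (H n n0)) _; rewrite lee_fin le_eqVlt.
  by apply/orP; left; apply/eqP; rewrite /C'; ring.
apply: (@squeeze_cvgr _ _ _ _ (cst 0) (fun n => C' * r ^+ n)).
- near=> n.
  have n0 : (0 < n)%N by near: n; exact: nbhs_infty_gt.
  have low : Hn n * expR (- (n%:R * delta)) <= fine (Tc n x setT).
    by rewrite -lee_fin fineK ?Tc_fin //; near: n; exact: Tc_lower.
  have p0 : 0 < Hn n * expR (- (n%:R * delta)) by apply: mulr_gt0; [exact: Hn_gt0|exact: expR_gt0].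
  have T0 : 0 < fine (Tc n x setT) by exact: lt_le_trans low.
  have P0 : 0 <= fine (Tc n x (P n)) by apply: fine_ge0; exact: Tc_ge0.
  rewrite /cst divr_ge0 ?(ltW T0) //= ler_pdivrMr //.
  apply: le_trans (HC' n n0) _; rewrite -[leRHS]mulrA.
  have C'0 : 0 <= C'.
    have cc : 0 <= C * Hn n * th ^+ n.
      by apply: mulr_ge0; [apply: mulr_ge0 => //; exact/ltW/Hn_gt0|rewrite exprn_ge0 // ltW].
    rewrite mulr_ge0 // divr_ge0 ?(ltW Mg0) //.
    have : 0 < E - M * g * yA - m * g * height0 by rewrite energy_balance kin0_gt0.
    have : 0 <= height0.
      by rewrite divr_ge0 ?(ltW i0) //; have /andP[] := moment1_bounds oDb bDb Rr0 Dx RyA l0.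
    move=> /(mulr_ge0 (ltW mg0)) a1 a2; have := mulr_gt0 Mg0 yA0; lra.
  rewrite ler_wpM2l //.
  have -> : Hn n * th ^+ n = r ^+ n * (Hn n * expR (- (n%:R * delta))).
    rewrite mulrCA; congr (_ * _).
    rewrite -[th in LHS]lnK ?posrE // -!expRM_natl -expRD; congr expR.
    by rewrite /delta; field.
  by rewrite ler_wpM2l // exprn_ge0.
- exact: cvg_cst.
- by rewrite -[X in _ --> X](mulr0 C'); apply: cvgMl_tmp; exact: cvg_expr.
Unshelve. all: by end_near. Qed.

Lemma Tc_far (eps : R) : 0 < eps ->
  fine (Tc n x [set p | eps < `|hy d n p - yA|]) / fine (Tc n x setT)
    @[n --> \oo] --> 0.
Proof.
move=> eps0; have [th th01 H] := far_height eps0; have /andP[t0 t1] := th01.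
pose C := expR (excess * E) * 2.
have C0 : 0 <= C by rewrite mulr_ge0 ?expR_ge0.
apply: (Tc_ratio (P := fun n => [set p | eps < `|hy d n p - yA|]) C0 th01).
move=> n n0 y Ry.
have [yy|yy] := ltP eps `|y - yA|; last first.
  have c0 : 0 <= C * Hn n * th ^+ n.
    by apply: mulr_ge0; [apply: mulr_ge0 => //; exact/ltW/Hn_gt0|rewrite exprn_ge0 // ltW].
  rewrite (_ : inner _ _ _ _ = 0%:E) ?lee_fin //.
  rewrite -(leb_int0 (n * d)); apply: eq_leb_int => u; congr EFin.
  by rewrite indicF0 ?mulr0 //= cfg_hy; apply/negP; rewrite -leNgt.
apply: le_trans (inner_le_mass _ n0 Ry) _.
by rewrite lee_fin -[leRHS]mulrA ler_wpM2l // H // ltW.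
Qed.

(** * Empirical averages of a bounded continuous function *)

Section empirical.
Variables (f : pt R d -> R) (B : R).
Hypotheses (cf : continuous f) (fB : forall z, `|f z| <= B).
Definition fbar : R := leb_intR d (fun q => f (snoc_pt k q) * xiw x yA l q) / mass0 yA.

Let mf : measurable_fun setT (fun q : seqT R => f (snoc_pt k q)).
Proof. exact: measurable_continuous_snoc. Qed.

Let B0 : 0 <= B. Proof. exact: le_trans (normr_ge0 _) (fB 0). Qed.

Lemma lint_f_xiw : lint d (fun q => f (snoc_pt k q) * xiw x yA l q).
Proof.
apply: (lint_le _ (lintZ B (lint_xiw oDb bDb Rr0 Dx RyA l0))).
  by apply: measurable_funM => //; exact: measurable_xiw.
move=> q; rewrite !normrM [`|B|]ger0_norm // ler_wpM2r //; exact: fB.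
Qed.

Lemma nu_intE : nu_int d Db Rr x yA l f = fbar.
Proof.
rewrite /nu_int (I0E oDb bDb Rr0 Dx RyA l0).
rewrite (_ : (fun q => _) = (fun q => l * (f (snoc_pt k q) * xiw x yA l q))); last first.
  by apply/funext => q; rewrite nu_dens_xiw -mulrA; congr (_ * _); rewrite mulrC.
rewrite leb_intRZ; last exact: lint_f_xiw.
by rewrite /fbar /mass0; field; rewrite !gt_eqF.
Qed.

Lemma empirical_chernoff (sg eps : R) : `|sg| = 1 -> 0 < eps ->
  exists s th e : R, [/\ 0 <= th < 1, 0 < e &
    forall y, Rr <= y -> `|y - yA| <= e -> exists2 K, K <= th * mass0 yA &
      chernoff_mass y s (fun q => sg * (f (snoc_pt k q) - fbar) - eps) K].
Proof.
move=> sg1 eps0.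
apply: (chernoff_near (C := B + `|fbar| + eps)).
- apply: measurable_funB => //; apply: measurable_funM => //; exact: measurable_funB.
- by rewrite !addr_ge0 // ltW.
- move=> q [_ /= q0]; apply: le_trans (ler_normB _ _) _.
  rewrite normrM sg1 mul1r (gtr0_norm eps0).
  apply: (@le_trans _ _ (B + `|fbar| + eps)).
    by rewrite lerD2r (le_trans (ler_normB _ _)) // lerD2r; exact: fB.
  by rewrite ler_peMr ?lerDl // !addr_ge0 // ltW.
have lx := lint_xiw oDb bDb Rr0 Dx RyA l0; have lf := lint_f_xiw.
rewrite (_ : (fun q => _) = (fun q => sg * (f (snoc_pt k q) * xiw x yA l q) -
  (sg * fbar + eps) * xiw x yA l q)); last by apply/funext => q; ring.
rewrite leb_intRB; [|exact: lintZ|exact: lintZ].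
rewrite !leb_intRZ // (xiw_int oDb bDb Rr0 Dx RyA l0) -/(mass0 yA).
have -> : leb_intR d (fun q => f (snoc_pt k q) * xiw x yA l q) = fbar * mass0 yA.
  by rewrite divfK // gt_eqF // mass0_gt0.
have := mulr_gt0 eps0 mass0_gt0; lra.
Qed.

(** Heights away from [yA] are negligible by [far_height]. Near [yA] the tilted masses decay like
    [tm ^+ n], but [Bn n y] may exceed [Bn n yA] by a factor exponential in n; the distance [e] is
    chosen so that this uses up only half of the rate. *)
Lemma Tc_empirical (eps : R) : 0 < eps ->
  fine (Tc n x [set p | eps < `|emp_int d n p f - fbar|]) / fine (Tc n x setT)
    @[n --> \oo] --> 0.
Proof.
move=> eps0.
have [s1 [th1 [e1 [/andP[t10 t11] e10 H1]]]] := empirical_chernoff (normr1 R) eps0.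
have [s2 [th2 [e2 [/andP[t20 t21] e20 H2]]]] := empirical_chernoff (normrN1 R) eps0.
(* The maximum may be 0; its average with 1 is positive, so its logarithm can serve as a rate. *)
pose tm := (1 + Num.max th1 th2) / 2.
have max0 : 0 <= Num.max th1 th2 by rewrite le_max t10.
have max1 : Num.max th1 th2 < 1 by rewrite gt_max t11.
have tm0 : 0 < tm by rewrite divr_gt0 // ltr_pwDl.
have tm1 : tm < 1 by rewrite ltr_pdivrMr //; lra.
have tmle : Num.max th1 th2 <= tm by rewrite ler_pdivlMr //; lra.
have lnt : ln tm < 0 by rewrite ln_lt0 // tm0.
have lMm : 0 < l * M / m by rewrite divr_gt0 // mulr_gt0.
pose e := Num.min (Num.min e1 e2) (- ln tm / 2 / (l * M / m)).
have e0 : 0 < e.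
  rewrite !lt_min e10 e20 /=; apply: divr_gt0 => //; apply: divr_gt0 => //.
  by rewrite oppr_gt0.
have [thf /andP[tf0 tf1] Hf] := far_height e0.
pose tn := expR (ln tm / 2).
have tn1 : tn < 1 by rewrite -expR0 ltr_expR; lra.
pose th := Num.max thf tn.
have th01 : 0 < th < 1 by rewrite lt_max tf0 gt_max tf1 tn1.
have /andP[th0 th1'] := th01.
pose C := expR (excess * E) * 2.
have C0 : 0 <= C by rewrite mulr_ge0 ?expR_ge0.
apply: (Tc_ratio (P := fun n => [set p | eps < `|emp_int d n p f - fbar|]) C0 th01).
move=> n n0 y Ry; have nR : 0 < n%:R :> R by rewrite ltr0n.
have [yy|yy] := leP e `|y - yA|.
  apply: le_trans (inner_le_mass _ n0 Ry) _.
  rewrite lee_fin -[leRHS]mulrA ler_wpM2l //; apply: le_trans (Hf n y Ry yy) _.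
  apply: ler_wpM2l; first exact/ltW/Hn_gt0.
  by apply: lerXn2r; rewrite ?nnegrE ?(ltW tf0) ?(ltW th0) // le_max lexx.
have yle : `|y - yA| <= e by exact: ltW.
have ye1 : `|y - yA| <= e1 by rewrite (le_trans yle) // /e !ge_min lexx.
have ye2 : `|y - yA| <= e2 by rewrite (le_trans yle) // /e !ge_min lexx orbT.
have [K1 K1le C1] := H1 y Ry ye1; have [K2 K2le C2] := H2 y Ry ye2.
have [_ _ K10 _] := C1; have [_ _ K20 _] := C2.
apply: le_trans (inner_le n0 Ry C1 C2 _) _.
  move=> u /= epsu.
  have sE (sg : R) : \sum_(i < n) (sg * (f (snoc_pt k (block d i u)) - fbar) - eps) =
      n%:R * (sg * (emp_int d n (cfg n x y u) f - fbar) - eps).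
    have -> : emp_int d n (cfg n x y u) f = (\sum_(i < n) f (snoc_pt k (block d i u))) / n%:R.
      rewrite /emp_int; congr (_ / _); apply: eq_bigr => i _.
      by rewrite -snoc_block cfg_block.
    rewrite big_split /= -mulr_sumr big_split /= !sumr_const card_ord.
    by rewrite -(mulr_natr (- fbar)) -(mulr_natr (- eps)); field; rewrite gt_eqF.
  have [a0|a0] := leP 0 (emp_int d n (cfg n x y u) f - fbar).
    left; rewrite sE mulr_ge0 ?(ltW nR) // mul1r subr_ge0.
    by move: epsu; rewrite ger0_norm // => /ltW.
  right; rewrite sE mulr_ge0 ?(ltW nR) // mulN1r subr_ge0.
  by move: epsu; rewrite ltr0_norm // => /ltW.
rewrite lee_fin -[leRHS]mulrA /C -[leLHS]mulrA -[leRHS]mulrA ler_wpM2l ?expR_ge0 //.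
have J0 := mass0_gt0.
have Kt (K thi : R) : 0 <= K -> thi <= Num.max th1 th2 -> K <= thi * mass0 yA ->
    K ^+ n <= (tm * mass0 yA) ^+ n.
  move=> K0 thle Kle; apply: lerXn2r; rewrite ?nnegrE //.
    by apply: mulr_ge0; exact: ltW.
  by apply: le_trans Kle _; rewrite ler_wpM2r ?(ltW J0) // (le_trans thle).
have K1n : K1 ^+ n <= (tm * mass0 yA) ^+ n by apply: (Kt _ th1); rewrite ?le_max ?lexx.
have K2n : K2 ^+ n <= (tm * mass0 yA) ^+ n by apply: (Kt _ th2); rewrite ?le_max ?lexx ?orbT.
apply: (@le_trans _ _ (Bn n y * (2 * (tm * mass0 yA) ^+ n))).
  rewrite ler_wpM2l ?Bn_ge0 //; lra.
rewrite mulrCA ler_wpM2l // (Bn_shift n y) [(tm * _) ^+ n]exprMn /Hn.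
rewrite [leLHS](_ : _ = Bn n yA * mass0 yA ^+ n *
  (expR (- (l * M / m * (y - yA))) * tm) ^+ n); last first.
  by rewrite [(expR _ * tm) ^+ n]exprMn; ring.
apply: ler_wpM2l; first exact/ltW/Hn_gt0.
apply: lerXn2r; rewrite ?nnegrE ?(ltW th0) //.
  by apply: mulr_ge0; [exact: expR_ge0|exact: ltW].
apply: (@le_trans _ _ tn); last by rewrite le_max lexx orbT.
rewrite -[tm]lnK ?posrE // -expRD ler_expR.
have h1 : l * M / m * - (y - yA) <= l * M / m * e.
  by rewrite ler_wpM2l ?(ltW lMm) // (le_trans _ yle) // ler_normr lexx orbT.
have h2 : l * M / m * e <= - ln tm / 2.
  by rewrite mulrC -ler_pdivlMr // /e !ge_min lexx !orbT.
rewrite mulrN in h1; lra.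
Qed.

End empirical.

End concentration.

(** * The laws of the theorem as ratios of [Tc] *)

Section law_formulas.
Context {R : realType} {k : nat}.
Variables (Db : set 'rV[R]_k) (Rr m M g E : R).
Hypotheses (oDb : open Db) (bDb : bounded_set Db) (Rr0 : 0 < Rr).
Local Notation d := k.+1.
Local Notation Tc := (Tc Db Rr m M g E).

Lemma PcondE n (x : 'rV[R]_k) (P : set (nat -> R)) :
  Pcond d n Db Rr m M g E x (fun p _ => P p) =
  fine (Tc n x P) / fine (Tc n x setT).
Proof.
rewrite /Pcond; congr (fine _ / fine _).
  by apply: eq_leb_int => p; rewrite sphere_prob_position.
by apply: eq_leb_int => p; rewrite indicT1 // mulr1.
Qed.

Lemma PnE n (xt : 'rV[R]_k) (P : set (nat -> R)) (P0 : set 'rV[R]_k) (Y : set R) :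
  Dbp (d := d) Db Rr xt -> (forall Q, Tc n xt Q \is a fin_num) ->
  measurable [set q : seqT R | P0 (\row_(j < k) q j)] ->
  (forall x y u, P (cfg (k := k) n x y u) <-> P0 x /\ Y y) ->
  Pn d n Db Rr m M g E (fun p _ => P p) =
  (fine (Tc n xt [set p | Y (hy d n p)]) / fine (Tc n xt setT)) *
  (lebk k (P0 `&` Dbp (d := d) Db Rr) / lebk k (Dbp (d := d) Db Rr)).
Proof.
move=> Dxt Tfin mP0 HP; rewrite mulf_div /Pn; congr (_ / _).
  rewrite (_ : leb_int _ _ =
      leb_int (n.+1 * d) (fun p => (posdens d n Db Rr m M g E p * \1_P p)%:E)).
    by rewrite (leb_int_posdens_prod (z := fine (Tc n xt [set p | Y (hy d n p)]))
      oDb bDb Rr0 Dxt mP0 HP) // fineK.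
  by apply: eq_leb_int => p; rewrite sphere_prob_position.
rewrite (_ : leb_int _ _ =
    leb_int (n.+1 * d) (fun p => (posdens d n Db Rr m M g E p * \1_setT p)%:E)).
  rewrite (leb_int_posdens_prod (z := fine (Tc n xt setT)) (P0 := setT) (Y := setT)
    oDb bDb Rr0 Dxt) ?setTI ?fineK //.
  exact: measurableT.
by apply: eq_leb_int => p; rewrite indicT1 // mulr1.
Qed.

End law_formulas.

Theorem theorem2p3 (R : realType) (d : nat) (Db : set 'rV[R]_(d.-1)) (Rr : R)
  (m M g E : R) (xt : 'rV[R]_(d.-1)) (ls : R) :
  (2 <= d)%N -> 0 < Rr ->
  bounded_domain Db -> smooth_boundary Db -> inner_ball_condition Db Rr ->
  (exists c : pt R d, ecball c Rr `<=` interior (cyl Db)) ->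
  0 < m -> 0 < M -> 0 < g -> M * g * Rr < E ->
  Dbp Db Rr xt ->
  (* lambda_* : the unique positive solution of its defining equation *)
  0 < ls ->
  d%:R * m * g / (2 * ls) + m * g * (I1 d Db Rr xt Rr ls / I0 d Db Rr xt Rr ls)
    + M * g * Rr = E ->
  (forall l, 0 < l ->
     d%:R * m * g / (2 * l) + m * g * (I1 d Db Rr xt Rr l / I0 d Db Rr xt Rr l)
       + M * g * Rr = E -> l = ls) ->
  (* the displayed hypothesis *)
  M < m * (IB d Rr xt Rr ls / I0 d Db Rr xt Rr ls) ->
  let sol := fun yA lA : R =>
    [/\ Rr <= yA, 0 < lA,
        M = m * (IB d Rr xt yA lA / I0 d Db Rr xt yA lA) &
        d%:R * m * g / (2 * lA) + m * g * (I1 d Db Rr xt yA lA / I0 d Db Rr xt yA lA)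
          + M * g * yA = E] in
  (exists yA lA, sol yA lA /\ forall y' l', sol y' l' -> y' = yA /\ l' = lA) /\
  forall yA lA, sol yA lA ->
  (* (i) *)
  (forall eps : R, 0 < eps ->
     (fun n => Pn d n Db Rr m M g E (fun p _ => eps < `|hy d n p - yA|)) @ \oo --> 0)
  /\
  (* (ii) marginal of X_{n+1} is uniform on D_b' *)
  (forall n : nat, (1 <= n)%N ->
     forall A : set 'rV[R]_(d.-1), <<s [set U | open U] >> A ->
       Pn d n Db Rr m M g E (fun p _ => A (hx d n p))
       = lebk (d.-1) (A `&` Dbp Db Rr) / lebk (d.-1) (Dbp Db Rr))
  /\
  (* (ii) conditionally on X_{n+1} = x, Q_n -> nu_{x,yA,lA} weakly in probability *)
  (forall x : 'rV[R]_(d.-1), Dbp Db Rr x ->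
     forall f : pt R d -> R, continuous f -> (exists C, forall z, `|f z| <= C) ->
     forall eps : R, 0 < eps ->
       (fun n => Pcond d n Db Rr m M g E x
          (fun p _ => eps < `|emp_int d n p f - nu_int d Db Rr x yA lA f|)) @ \oo --> 0).
Proof.
case: d Db xt => [//|k] Db xt d2 Rr0 [_ oDb _ bDb] _ _ _ m0 M0 g0 ERr Dxt ls0 _ lsU hyp sol.
have k0 : (0 < k)%N by [].
pose sad := saddle (ballL (k := k) Rr) (ballL1 (k := k) Rr) (lebk k Db) Rr m M g E k.+1%:R.
have solE yA lA : sol yA lA <-> sad yA lA.
  by split=> -[Ry l0]; [rewrite (IBE Rr0) | rewrite -(IBE Rr0 xt)];
    [rewrite (I0E oDb bDb Rr0 Dxt Ry l0) (I1E oDb bDb Rr0 Dxt Ry l0)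
    |rewrite /energy -(I0E oDb bDb Rr0 Dxt Ry l0) -(I1E oDb bDb Rr0 Dxt Ry l0)].
have mom0 y l : Rr <= y -> 0 < l -> 0 <= moment0 (ballL (k := k) Rr) (lebk k Db) y l.
  by move=> Ry l0; exact: (moment0_ge0 oDb bDb Rr0 Dxt Ry l0).
rewrite (IBE Rr0) (I0E oDb bDb Rr0 Dxt (lexx Rr) ls0) in hyp.
have L0 l : 0 <= ballL (k := k) Rr l by exact: ballL_ge0.
have cap0 : 0 <= cap (ballL (k := k) Rr) Rr ls by rewrite !mulr_ge0 ?expR_ge0 // ltW.
(* The hypothesis on M forces positive mass outside the ball and inside it: otherwise its right-hand
   side would be 0, division by 0 included. *)
have i0 : 0 < moment0 (ballL (k := k) Rr) (lebk k Db) Rr ls.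
  rewrite lt_neqAle mom0 // andbT; apply/eqP => H0.
  by move: hyp; rewrite -H0 invr0 !mulr0 ltNge ltW.
have A0 : 0 < lebk k Db.
  by apply: lt_le_trans i0 _; rewrite /moment0 gerBl.
have Lls : 0 < ballL (k := k) Rr ls.
  rewrite lt_neqAle L0 andbT; apply/eqP => H0.
  by move: hyp; rewrite /cap -H0 mulr0 mul0r mulr0 ltNge ltW.
have dgt0 : 0 < k.+1%:R :> R by rewrite ltr0n.
have sad_uniq y1 l1 y2 l2 : sad y1 l1 -> sad y2 l2 -> y1 = y2 /\ l1 = l2.
  exact: (saddle_unique m0 M0 g0 dgt0 (moment_jensen oDb bDb Rr0 Dxt) mom0).
split.
  have [|y [l sl]] := saddle_exists A0 Rr0 m0 M0 g0 dgt0 ERr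
    (continuous_ballL (k := k) Rr0) (continuous_ballL1 (k := k) Rr0)
    (fun l _ => ballL_gt0 Rr0 l Lls) mom0
    (fun y l Ry l0 => moment1_bounds oDb bDb Rr0 Dxt Ry l0) ls0 _ hyp.
    move=> l l0 Hl; apply: lsU => //.
    by rewrite (I0E oDb bDb Rr0 Dxt (lexx Rr) l0) (I1E oDb bDb Rr0 Dxt (lexx Rr) l0).
  exists y, l; split; first exact/solE.
  by move=> y' l' /solE s'; exact: sad_uniq s' sl.
move=> yA lA /solE sA.
have Tfin n x Q : (0 < n)%N -> Dbp (d := k.+1) Db Rr x -> Tc Db Rr m M g E n x Q \is a fin_num.
  by move=> n0 Dx; exact: (Tc_fin oDb bDb Rr0 k0 m0 M0 g0 Dx sA).
split; [move=> eps eps0|split; [move=> n n1 A mA|]].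
- set b := lebk k (Dbp (d := k.+1) Db Rr).
  have far := Tc_far oDb bDb Rr0 k0 m0 M0 g0 Dxt sA eps0.
  (* By the product form the law of the height carries the factor [b / b], which is constant in n,
     so the limit is still 0. *)
  rewrite -[X in _ --> X](mul0r (b / b)).
  apply: cvg_trans (cvgMr_tmp (b := b / b) far).
  apply: near_eq_cvg; near=> n.
  have n0 : (0 < n)%N by near: n; exact: nbhs_infty_gt.
  apply/esym; rewrite (PnE (P := [set p | eps < `|hy k.+1 n p - yA|]) (P0 := setT)
    (Y := [set y | eps < `|y - yA|]) oDb bDb Rr0 Dxt) ?setTI //.
  + by move=> Q; exact: Tfin.
  + exact: measurableT.
  + by move=> x y u /=; rewrite cfg_hy; split => // -[].
- rewrite (PnE (P := [set p | A (hx k.+1 n p)]) (P0 := A) (Y := setT) oDb bDb Rr0 Dxt).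
  + have T0 := Tc_gt0 oDb bDb Rr0 k0 m0 M0 g0 n Dxt A0 ERr.
    rewrite divff ?mul1r // gt_eqF // -lte_fin fineK //; exact: Tfin.
  + by move=> Q; exact: Tfin.
  + exact: measurable_borel_row.
  + by move=> x y u /=; rewrite cfg_hx; split => // -[].
move=> x Dx f cf [C fC] eps eps0.
have H := Tc_empirical oDb bDb Rr0 k0 m0 M0 g0 Dx sA cf fC eps0.
rewrite -(nu_intE oDb bDb Rr0 M0 Dx sA cf fC) in H.
apply: cvg_trans H; apply: near_eq_cvg; near=> n.
by rewrite -PcondE.
Unshelve. all: by end_near. Qed.
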